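(* There is a conformal map $\phi$ on the unit disk $\mathbb{D}$ that has a computable boundary extension even though its range $\phi(\mathbb{D})$ does not have a computable boundary connectivity function. That is, there is a conformal map $\phi$ on $\mathbb{D}$ that extends to a continuous function on $\overline{\mathbb{D}}$, this extension $\overline{\mathbb{D}}\to\mathbb{C}$ is computable, and no boundary connectivity function $g:\mathbb{N}\to\mathbb{N}$ for the domain $\phi(\mathbb{D})$ is computable.
   Context: $\mathbb{D}$ is the open disk in $\mathbb{C}$ with center $0$ and radius $1$. A conformal map on $\mathbb{D}$ is an injective holomorphic function on $\mathbb{D}$. The boundary extension of a conformal map $\phi$ on $\mathbb{D}$ (when it exists) is the continuous extension of $\phi$ to $\overline{\mathbb{D}}$. A boundary connectivity function for a domain $D\subseteq\mathbb{C}$ is a function $g:\mathbb{N}\to\mathbb{N}$ such that whenever $k\in\mathbb{N}$ and $p,q$ are boundary points of $D$ with $0<|p-q|\le 2^{-g(k)}$, the boundary of $D$ includes an arc from $p$ to $q$ whose diameter is smaller than $2^{-k}$. (An arc is a homeomorphic image of $[0,1]$.) A function $\mathbb{N}\to\mathbb{N}$ is computable if it is Turing computable. An open rational rectangle is a set $(a,b)\times(c,d)$ with rational $a<b$, $c<d$, regarded as a subset of $\mathbb{C}$. A function $f$ from a subset $\operatorname{dom}(f)$ of $\mathbb{C}$ to $\mathbb{C}$ is computable if there is an algorithm $P$ such that: (Approximation) given an open rational rectangle as input, $P$ either does not halt or outputs an open rational rectangle; (Correctness) whenever $P$ halts on an open rational rectangle $R$, the rectangle it outputs contains $f(z)$ for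 each $z\in R\cap\operatorname{dom}(f)$; (Convergence) whenever $U$ is a neighborhood of a point $z\in\operatorname{dom}(f)$ and $V$ is a neighborhood of $f(z)$, there is an open rational rectangle $R$ with $z\in R\subseteq U$ such that on input $R$, $P$ produces a rational rectangle included in $V$. *)

(* Defs.v *)
From HB Require Import structures.
From mathcomp Require Import all_boot all_order all_algebra.
From mathcomp Require Import all_classical all_reals all_analysis.
From mathcomp Require Import complex.

Set Implicit Arguments.
Unset Strict Implicit.
Unset Printing Implicit Defensive.

Import Order.TTheory GRing.Theory Num.Theory numFieldNormedType.Exports.

Local Open Scope classical_set_scope.
Local Open Scope ring_scope.

(* Deterministic multi-tape Turing machines on two-way infinite tapes.  The
   alphabet of a machine consists of the blank [None], the input/output letters
   [Some (inl b)] for [b : bool], and finitely many auxiliary letters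
   [Some (inr e)]. *)

Definition symbol (E : finType) : Type := option (bool + E).

(* The cells left of the head are listed from the head outwards, those right of
   it likewise; the cells that are not listed are blank. *)
Record tape (E : finType) := Tape {
  tape_left : seq (symbol E);
  tape_head : symbol E;
  tape_right : seq (symbol E) }.

Inductive head_move := MoveLeft | Stay | MoveRight.

Definition write (E : finType) (s : symbol E) (t : tape E) : tape E :=
  Tape (tape_left t) s (tape_right t).

Definition move_head (E : finType) (m : head_move) (t : tape E) : tape E :=
  let: Tape l h r := t in
  match m with
  | MoveLeft =>
      if l is a :: l' then Tape l' a (h :: r) else Tape [::] None (h :: r)
  | Stay => t
  | MoveRight =>
      if r is a :: r' then Tape (h :: l) a r' else Tape (h :: l) None [::]
  end.

(* The machine halts when the transition function returns [None]. *)
Record turing_machine := TuringMachine {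
  tm_tapes : nat;
  tm_state : finType;
  tm_aux : finType;
  tm_start : tm_state;
  tm_trans : tm_state -> tm_tapes.-tuple (symbol tm_aux) ->
    option (tm_state * tm_tapes.-tuple (symbol tm_aux * head_move)) }.

Definition tm_config (M : turing_machine) : Type :=
  (tm_state M * (tm_tapes M).-tuple (tape (tm_aux M)))%type.

Definition tm_step (M : turing_machine) (c : tm_config M) :
    option (tm_config M) :=
  if tm_trans c.1 (map_tuple (@tape_head _) c.2) is Some (q, acts) then
    Some (q, [tuple move_head (tnth acts i).2
                      (write (tnth acts i).1 (tnth c.2 i)) | i < tm_tapes M])
  else None.

Definition input_tape (E : finType) (w : seq bool) : tape E :=
  if [seq Some (inl b) | b <- w] is a :: s then Tape [::] a s
  else Tape [::] None [::].

(* The word that starts under the head and extends to the right up to the first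
   symbol that is not an input/output letter. *)
Fixpoint leading_word (E : finType) (s : seq (symbol E)) : seq bool :=
  if s is Some (inl b) :: s' then b :: leading_word s' else [::].

Definition output_word (E : finType) (t : tape E) : seq bool :=
  leading_word (tape_head t :: tape_right t).

(* The [i]-th argument is written on the [i]-th tape; the other tapes are
   blank. *)
Definition tm_init (M : turing_machine) (ws : seq (seq bool)) : tm_config M :=
  (tm_start M, [tuple input_tape (tm_aux M) (nth [::] ws i) | i < tm_tapes M]).

(* The first [m] output words, where a tape that [M] does not have counts as
   blank. *)
Definition tm_output (M : turing_machine) (m : nat) (c : tm_config M) :
    seq (seq bool) :=
  [seq output_word (nth (input_tape (tm_aux M) [::]) c.2 i) | i <- iota 0 m].

Definition tm_halts_in (M : turing_machine) (ws : seq (seq bool))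
    (c : tm_config M) : Prop :=
  (exists n, iter n (obind (@tm_step M)) (Some (tm_init M ws)) = Some c)
  /\ tm_step c = None.

Definition tm_halts (M : turing_machine) (ws : seq (seq bool)) : Prop :=
  exists c : tm_config M, tm_halts_in ws c.

Definition tm_computes (M : turing_machine) (ws vs : seq (seq bool)) : Prop :=
  exists2 c : tm_config M, tm_halts_in ws c & tm_output (size vs) c = vs.

(* Natural numbers are written in unary; a negative integer is preceded by the
   letter [false]. *)
Definition nat_word (n : nat) : seq bool := nseq n true.

Definition int_word (z : int) : seq bool :=
  match z with
  | Posz n => nat_word n
  | Negz n => false :: nat_word n.+1
  end.

Definition computable_nat_fun (g : nat -> nat) : Prop :=
  exists M : turing_machine,
    forall n, tm_computes M [:: nat_word n] [:: nat_word (g n)].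

(* [R[i]] with the topology and the normed module structure that it carries as a
   numeric field, so that [derivable f z 1] is complex differentiability of
   [f : C R -> C R]. *)
Definition C (R : realType) : numClosedFieldType := R[i].

Record rat_rect := RatRect {
  rect_a : rat;
  rect_b : rat;
  rect_c : rat;
  rect_d : rat;
  rect_ltab : rect_a < rect_b;
  rect_ltcd : rect_c < rect_d }.

Definition rect_set (R : realType) (Q : rat_rect) : set (C R) :=
  [set z | ratr (rect_a Q) < complex.Re z < ratr (rect_b Q) /\
           ratr (rect_c Q) < complex.Im z < ratr (rect_d Q)].

(* Eight words: numerator and denominator, in lowest terms, of each of the four
   endpoints. *)
Definition rect_words (Q : rat_rect) : seq (seq bool) :=
  flatten [seq [:: int_word (numq q); int_word (denq q)] |
           q <- [:: rect_a Q; rect_b Q; rect_c Q; rect_d Q]].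

Definition computable_complex_fun (R : realType) (dom : set (C R))
    (f : C R -> C R) : Prop :=
  exists P : turing_machine,
    [/\
        forall Q, tm_halts P (rect_words Q) ->
          exists Q', tm_computes P (rect_words Q) (rect_words Q'),
        forall Q Q', tm_computes P (rect_words Q) (rect_words Q') ->
          forall z : C R, rect_set Q z -> dom z -> rect_set Q' (f z)
      &
        forall (z : C R) (U V : set (C R)),
          dom z -> nbhs z U -> nbhs (f z) V ->
          exists Q Q',
            [/\ rect_set Q z, rect_set Q `<=` U,
                tm_computes P (rect_words Q) (rect_words Q')
              & rect_set Q' `<=` V]].

Definition unit_disk (R : realType) : set (C R) := [set z | `|z| < 1].
Arguments unit_disk R : clear implicits.

Definition conformal_on_disk (R : realType) (phi : C R -> C R) : Prop :=
  (forall z : C R, unit_disk R z -> derivable phi z 1) /\ set_inj (unit_disk R) phi.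

Definition boundary_extension (R : realType) (phi f : C R -> C R) : Prop :=
  {within closure (unit_disk R), continuous f} /\
  (forall z : C R, unit_disk R z -> f z = phi z).

Definition boundary (R : realType) (D : set (C R)) : set (C R) :=
  closure D `\` interior D.

(* [A] is an arc from [p] to [q]: [gamma] restricts to a homeomorphism from
   [0, 1] onto [A], with inverse [delta]. *)
Definition is_arc (R : realType) (p q : C R) (A : set (C R)) : Prop :=
  exists (gamma : R -> C R) (delta : C R -> R),
    [/\ {within `[0, 1], continuous gamma} /\ {within A, continuous delta},
        gamma @` `[0, 1] = A,
        {in `[0, 1], cancel gamma delta},
        gamma 0 = p
      & gamma 1 = q].

Definition diameter (R : realType) (A : set (C R)) : \bar R :=
  ereal_sup [set (complex.Re `|x - y|)%:E | x in A & y in A].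

Definition boundary_connectivity_function (R : realType) (D : set (C R))
    (g : nat -> nat) : Prop :=
  forall (k : nat) (p q : C R),
    boundary D p -> boundary D q -> 0 < `|p - q| <= 2 ^- g k ->
    exists A : set (C R),
      [/\ A `<=` boundary D, is_arc p q A
        & (diameter A < (2 ^- k)%:E)%E].

(* Main.v *)
Require Import Defs.
From mathcomp Require Import all_boot all_order all_algebra zify ring lra.
From mathcomp Require Import all_classical all_reals all_analysis.
From mathcomp Require Import complex.
Import numFieldNormedType.Exports.

Set Implicit Arguments.
Unset Strict Implicit.
Unset Printing Implicit Defensive.

(** Let [M] be the conformal map of the disk onto its upper half that carries an arc
    of the circle to the segment from [-1] to [1].  The map of the theorem is
    [20 + 20 i + G (M z) ^ 2], where
    [G w = w + sum_j tau_j 2 ^ -(j + 10) h_(site j) (w)] is a small perturbation of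
    the identity and [h_n w = - (sqrt (w - a_n) sqrt (w - b_n)) ^ 3].  On the real
    axis the imaginary part of [h_n] is positive between [a_n] and [b_n] and zero
    elsewhere, and the intervals of different [n] are disjoint.  So [G] bends the
    flat side of the half disk upwards at the sites [n_j = site j] with [tau_j = 1],
    and moves the negative half of that side only along itself.  Without bumps, the
    square would glue the two halves of the flat side into the two sides of a slit.
    A bump of height [beta] over an interval of radius [r] opens a lens of that size
    between the sides of the slit: boundary points on opposite walls of the lens are
    only [4 beta] apart, but every arc in the boundary that joins them must pass
    around an end of the lens, and has diameter at least of the order of [r]
    ([slit_map_gap], [slit_map_connectivity]).  Since [beta] is of the order of
    [2 ^ -j r ^ 3] and [r = 2 ^ -(n + 4)], a boundary connectivity function [g] has
    [g (n + 9) > j + 3 n + 19] whenever the bump [j] at the site [n] is present.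

    The bump with index [j = pairn n s] is present if the machine with code [n] halts
    on the input [n + 9] after exactly [s] steps.  A machine that computes [g] has a
    code [n], and cannot write a word longer than [n + 9 + s + 1] in [s] steps; but
    [j + 3 n + 19] exceeds that length, which is absurd ([computable_halting_time],
    [halting_growth]).

    The map is computable all the same, because the presence of the bump [j] is
    decidable from [j] and its effect is below a multiple of [2 ^ -j]: the value at a
    point can be approximated without knowing which machines halt.  In detail, [M]
    and [G] are continuous up to the circle, with the explicit modulus
    [slit_map_dist], and the values of [slit_map] at a primitive recursive family of
    points have primitive recursive rational approximations ([capp_slit_map]).
    Primitive recursive functions are executed by Turing machines ([prec_turing]), by
    way of loop programs and of machines with jumps whose registers are the tapes.
    The final machine evaluates the map at one point close to the given rectangle and
    encloses the result in a square whose size is given by the modulus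
    ([computable_on_disk]). *)

(** * Primitive recursive functions of an environment *)

(** A function of finitely many variables is represented as a function of an
    environment, where the missing entries count as zero.  This removes all
    bookkeeping of arities; by [prec_finite] only finitely many entries matter. *)
Inductive prec : (seq nat -> nat) -> Prop :=
| prec_var i : prec (fun e => nth 0 e i)
| prec_zero : prec (fun=> 0)
| prec_succ f : prec f -> prec (fun e => (f e).+1)
| prec_comp f gs : prec f ->
    (forall i, i < size gs -> prec (nth (fun=> 0) gs i)) ->
    prec (fun e => f [seq g e | g <- gs])
| prec_rec n f g : prec n -> prec f -> prec g ->
    prec (fun e =>
      nat_rect (fun=> nat) (f e) (fun i acc => g [:: acc, i & e]) (n e)).

Lemma prec_finite f : prec f ->
  exists m, forall e e', (forall i, i < m -> nth 0 e i = nth 0 e' i) -> f e = f e'.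
Proof.
elim=> {f} [i||f _ [m Hm]|f gs _ [m Hm] _ IH|n f g _ [m1 H1] _ [m2 H2] _ [m3 H3]].
- by exists i.+1 => e e'; apply.
- by exists 0.
- by exists m => e e' H; rewrite (Hm e e').
- have /choice[h Hh] : forall i, exists m, i < size gs ->
    forall e e', (forall j, j < m -> nth 0 e j = nth 0 e' j) ->
      nth (fun=> 0) gs i e = nth (fun=> 0) gs i e'.
    move=> i; case: (ltnP i (size gs)) => [/IH [k Hk]|]; first by exists k.
    by exists 0.
  exists (\max_(i < size gs) h i) => e e' H; congr f.
  apply: (@eq_from_nth _ 0); rewrite ?size_map// => i Hi.
  rewrite !(nth_map (fun=> 0))//; apply: Hh => // j Hj; apply: H.
  by apply: leq_trans Hj _; apply: (leq_bigmax (Ordinal Hi)).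
- exists (m1 + m2 + m3) => e e' H.
  rewrite (H1 e e') ?(H2 e e'); try by move=> i Hi; apply: H; lia.
  elim: (n e') => //= k ->; apply: H3 => -[|[|i]] //= Hi; apply: H; lia.
Qed.

Lemma prec_ext f g : prec f -> f =1 g -> prec g.
Proof. by move=> Hf /funext <-. Qed.

(** The length of [r e] may depend on [e]; [prec_comp] applies since only the finitely many
    entries that [f] reads have to be computed. *)
Lemma prec_subst f (r : seq nat -> seq nat) : prec f ->
  (forall i, prec (fun e => nth 0 (r e) i)) -> prec (fun e => f (r e)).
Proof.
move=> Hf Hr; have [m Hm] := prec_finite Hf.
pose gs := mkseq (fun i e => nth 0 (r e) i) m.
apply: (@prec_ext (fun e => f [seq g e | g <- gs])).
  apply: prec_comp => // i; rewrite size_mkseq => Hi.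
  by rewrite nth_mkseq.
move=> e; apply: Hm => i Hi.
by rewrite (nth_map (fun=> 0)) ?size_mkseq// nth_mkseq.
Qed.

Lemma prec_drop k f : prec f -> prec (fun e => f (drop k e)).
Proof.
move=> Hf; apply: prec_subst => // i.
by apply: prec_ext (prec_var (k + i)) _ => e; rewrite nth_drop.
Qed.

Lemma prec_const k : prec (fun=> k).
Proof. by elim: k => [|k IH]; [exact: prec_zero | exact: prec_succ]. Qed.

Lemma prec_let f g : prec g -> prec f -> prec (fun e => f (g e :: e)).
Proof.
move=> Hg Hf; apply: (prec_subst (r := fun e => g e :: e)) => // -[|i] //=.
exact: prec_var.
Qed.

(** ** Arithmetic *)

Lemma prec_add f g : prec f -> prec g -> prec (fun e => f e + g e).
Proof.
move=> Hf Hg.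
apply: prec_ext (prec_rec Hg Hf (prec_succ (prec_var 0))) _ => e /=.
by elim: (g e) => [|k /= ->]; rewrite ?addn0 ?addnS.
Qed.

Lemma prec_mul f g : prec f -> prec g -> prec (fun e => f e * g e).
Proof.
move=> Hf Hg.
apply: prec_ext (prec_rec Hg prec_zero
  (prec_add (prec_drop 2 Hf) (prec_var 0))) _ => e /=.
by elim: (g e) => [|k /= ->]; rewrite ?muln0 ?mulnS ?drop0.
Qed.

Lemma prec_pow f g : prec f -> prec g -> prec (fun e => f e ^ g e).
Proof.
move=> Hf Hg.
apply: prec_ext (prec_rec Hg (prec_const 1)
  (prec_mul (prec_drop 2 Hf) (prec_var 0))) _ => e /=.
by elim: (g e) => [|k /= ->]; rewrite ?expn0 ?expnS ?drop0.
Qed.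

Lemma prec_pred f : prec f -> prec (fun e => (f e).-1).
Proof.
move=> Hf; apply: prec_ext (prec_rec Hf prec_zero (prec_var 1)) _ => e /=.
by case: (f e).
Qed.

Lemma prec_sub f g : prec f -> prec g -> prec (fun e => f e - g e).
Proof.
move=> Hf Hg.
apply: prec_ext (prec_rec Hg Hf (prec_pred (prec_var 0))) _ => e /=.
by elim: (g e) => [|k /= ->]; rewrite ?subn0 ?subnS.
Qed.

Lemma prec_eq0 f : prec f -> prec (fun e => (f e == 0) : nat).
Proof.
move=> Hf; apply: prec_ext (prec_sub (prec_const 1) Hf) _ => e.
by case: (f e).
Qed.

Lemma prec_leq f g : prec f -> prec g -> prec (fun e => (f e <= g e) : nat).
Proof. by move=> Hf Hg; apply: prec_eq0 (prec_sub Hf Hg). Qed.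

Lemma prec_and (a b : seq nat -> bool) : prec (fun e => a e : nat) ->
  prec (fun e => b e : nat) -> prec (fun e => (a e && b e) : nat).
Proof.
move=> Ha Hb; apply: prec_ext (prec_mul Ha Hb) _ => e.
by rewrite mulnb.
Qed.

Lemma prec_not (a : seq nat -> bool) : prec (fun e => a e : nat) ->
  prec (fun e => (~~ a e) : nat).
Proof. by move=> Ha; apply: prec_ext (prec_eq0 Ha) _ => e; case: (a e). Qed.

Lemma prec_eq f g : prec f -> prec g -> prec (fun e => (f e == g e) : nat).
Proof.
move=> Hf Hg; apply: prec_ext (prec_and (prec_leq Hf Hg) (prec_leq Hg Hf)) _.
by move=> e /=; rewrite eqn_leq.
Qed.

Lemma prec_if (b : seq nat -> bool) f g : prec (fun e => b e : nat) ->
  prec f -> prec g -> prec (fun e => if b e then f e else g e).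
Proof.
move=> Hb Hf Hg.
apply: prec_ext (prec_add (prec_mul Hb Hf) (prec_mul (prec_not Hb) Hg)) _ => e.
by case: (b e) => /=; lia.
Qed.

Lemma prec_index f : prec f -> prec (fun e => f (nth 0 e 1 :: drop 2 e)).
Proof.
move=> Hf; apply: (prec_subst (r := fun e => nth 0 e 1 :: drop 2 e)) => // -[|i] /=.
  exact: prec_var.
exact: (prec_drop 2 (prec_var i)).
Qed.

(** The bound of a sum is evaluated outside of the scope of its index. *)
Lemma prec_sum n f : prec n -> prec f ->
  prec (fun e => \sum_(i < n e) f ((i : nat) :: e)).
Proof.
move=> Hn Hf.
apply: prec_ext (prec_rec Hn prec_zero (prec_add (prec_var 0) (prec_index Hf))) _ => e /=.
elim: (n e) => [|k /= ->]; first by rewrite big_ord0.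
by rewrite big_ord_recr /= drop0.
Qed.

Lemma prec_prod n f : prec n -> prec f ->
  prec (fun e => \prod_(i < n e) f ((i : nat) :: e)).
Proof.
move=> Hn Hf.
apply: prec_ext (prec_rec Hn (prec_const 1) (prec_mul (prec_var 0) (prec_index Hf))) _ => e /=.
elim: (n e) => [|k /= ->]; first by rewrite big_ord0.
by rewrite big_ord_recr /= drop0.
Qed.

Lemma count_below (P : nat -> bool) q n : q <= n ->
  (forall i, P i = (i < q)) -> \sum_(i < n) P i = q.
Proof.
move=> Hq HP; under eq_bigr do rewrite HP.
rewrite -(big_mkord xpredT (fun i => (i < q) : nat)) (big_cat_nat _ Hq) //=.
rewrite big_nat [X in X + _](eq_bigr (fun=> 1)) -?big_nat; last first.
  by move=> i /andP[_ ->].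
rewrite sum_nat_const_nat subn0 muln1.
rewrite big_nat big1 ?addn0 // => i /andP[Hi _].
by rewrite ltnNge Hi.
Qed.

(** Bounded search in the form of counting: a quotient is the number of its
    positive lower bounds. *)
Lemma prec_div f g : prec f -> prec g -> prec (fun e => f e %/ g e).
Proof.
move=> Hf Hg.
apply: prec_ext (prec_mul (prec_leq (prec_const 1) Hg) (prec_sum Hf
  (prec_leq (prec_mul (prec_succ (prec_var 0)) (prec_drop 1 Hg)) (prec_drop 1 Hf)))) _.
move=> e; rewrite /= drop0; case: (posnP (g e)) => [->|Hg0]; first by rewrite divn0.
rewrite mul1n (@count_below (fun i => i.+1 * g e <= f e) (f e %/ g e)) //.
  exact: leq_div.
by move=> i; rewrite -leq_divRL.
Qed.

Lemma prec_mod f g : prec f -> prec g -> prec (fun e => f e %% g e).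
Proof.
move=> Hf Hg.
apply: prec_ext (prec_sub Hf (prec_mul (prec_div Hf Hg) Hg)) _ => e.
by rewrite {1}(divn_eq (f e) (g e)) addKn.
Qed.

Definition isqrt n := \sum_(i < n) (i.+1 ^ 2 <= n).

Lemma isqrt_spec n : (isqrt n) ^ 2 <= n < (isqrt n).+1 ^ 2.
Proof.
have [q [Hq1 Hq2]] : exists q, q ^ 2 <= n /\ n < q.+1 ^ 2.
  elim: n => [|n [q [H1 H2]]]; first by exists 0.
  case: (leqP (q.+1 ^ 2) n.+1) => H; last by exists q; lia.
  by exists q.+1; split => //; apply: leq_ltn_trans H2 _; rewrite ltn_sqr.
suff -> : isqrt n = q by rewrite Hq1.
apply: (@count_below (fun i => i.+1 ^ 2 <= n)); first by nia.
move=> i; apply/idP/idP => H.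
  by rewrite -ltnS -ltn_sqr; apply: leq_ltn_trans Hq2.
by apply: leq_trans Hq1; rewrite leq_sqr.
Qed.

Lemma isqrt_unique n q : q ^ 2 <= n < q.+1 ^ 2 -> isqrt n = q.
Proof.
move=> /andP[H1 H2]; have /andP[H3 H4] := isqrt_spec n.
by apply/eqP; rewrite eqn_leq -ltnS -[isqrt n < _]ltn_sqr (leq_ltn_trans H3) //=
  -ltnS -ltn_sqr (leq_ltn_trans H1).
Qed.

Lemma prec_isqrt f : prec f -> prec (fun e => isqrt (f e)).
Proof.
move=> Hf; apply: prec_ext (prec_sum Hf (prec_leq (prec_pow
  (prec_succ (prec_var 0)) (prec_const 2)) (prec_drop 1 Hf))) _ => e /=.
by rewrite drop0.
Qed.

(** ** Pairs and lists *)

(** Pairs are coded by squares and their distance from the next smaller square,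
    which makes both projections computable from an integer square root. *)
Definition pairn a b := (a + b) ^ 2 + a.
Definition fstn n := n - isqrt n ^ 2.
Definition sndn n := isqrt n - fstn n.

Lemma isqrt_pairn a b : isqrt (pairn a b) = a + b.
Proof. by apply: isqrt_unique; rewrite /pairn; nia. Qed.

Lemma fstnK a b : fstn (pairn a b) = a.
Proof. by rewrite /fstn isqrt_pairn /pairn addKn. Qed.

Lemma sndnK a b : sndn (pairn a b) = b.
Proof. by rewrite /sndn fstnK isqrt_pairn addKn. Qed.

Lemma prec_pairn f g : prec f -> prec g -> prec (fun e => pairn (f e) (g e)).
Proof.
by move=> Hf Hg; apply: prec_add (prec_pow (prec_add Hf Hg) (prec_const 2)) Hf.
Qed.

Lemma prec_fstn f : prec f -> prec (fun e => fstn (f e)).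
Proof.
by move=> Hf; apply: prec_sub Hf (prec_pow (prec_isqrt Hf) (prec_const 2)).
Qed.

Lemma prec_sndn f : prec f -> prec (fun e => sndn (f e)).
Proof. by move=> Hf; apply: prec_sub (prec_isqrt Hf) (prec_fstn Hf). Qed.

(** A list of numbers as a nested pair, shifted by one so that [0] is the empty list. *)
Definition coden (s : seq nat) := foldr (fun x c => (pairn x c).+1) 0 s.
Definition nthn c i := fstn (iter i (fun c => sndn c.-1) c).-1.

Lemma nthnE s i : i < size s -> nthn (coden s) i = nth 0 s i.
Proof.
elim: s i => // x s IH [|i] Hi; first by rewrite /nthn /= fstnK.
by rewrite [RHS]/= -IH // /nthn iterSr /= sndnK.
Qed.

Lemma coden_inj : injective coden.
Proof.
elim=> [|x s IH] [|y t] //= [] H.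
move: (congr1 fstn H) (congr1 sndn H); rewrite !fstnK !sndnK => -> /IH -> //.
Qed.

Lemma prec_nthn f g : prec f -> prec g -> prec (fun e => nthn (f e) (g e)).
Proof.
move=> Hf Hg; apply: prec_ext (prec_fstn (prec_pred (prec_rec Hg Hf
  (prec_sndn (prec_pred (prec_var 0)))))) _ => e.
by rewrite /nthn; congr (fstn _.-1); elim: (g e) => //= k ->.
Qed.

Definition mkseqn (f : nat -> nat) n := coden (mkseq f n).

(** The list is built from its end, so that the recursion step is a single pairing. *)
Lemma prec_mkseqn n f : prec n -> prec f ->
  prec (fun e => mkseqn (fun i => f (i :: e)) (n e)).
Proof.
move=> Hn Hf.
have Hf' : prec (fun e => f (nth 0 e 2 - (nth 0 e 1).+1 :: drop 3 e)).
  apply: (prec_subst (r := fun e => nth 0 e 2 - (nth 0 e 1).+1 :: drop 3 e)) => // -[|i] /=.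
    exact: (prec_sub (prec_var _) (prec_succ (prec_var _))).
  exact: (prec_drop 3 (prec_var i)).
have := prec_let Hn (prec_rec (prec_var 0) prec_zero
  (prec_succ (prec_pairn Hf' (prec_var 0)))).
move=> /prec_ext; apply=> e /=; rewrite drop0 /mkseqn /mkseq.
suff H k : k <= n e -> nat_rect (fun=> nat) 0 (fun i acc : nat =>
    (pairn (f (n e - i.+1 :: e)) acc).+1) k =
    coden [seq f (i :: e) | i <- iota (n e - k) k].
  by rewrite H // subnn.
elim: k => //= k IH Hk; rewrite IH; last exact: ltnW.
by congr (pairn _ (coden _)).+1; congr map; congr iota; lia.
Qed.

Lemma nthn_mkseqn f n i : i < n -> nthn (mkseqn f n) i = f i.
Proof. by move=> Hi; rewrite nthnE ?size_mkseq// nth_mkseq. Qed.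

(** * Loop programs *)

(** [Loop r c] is: as long as register [r] is positive, decrement it and run
    [c]. *)
Inductive cmd :=
| Skip
| Inc of nat
| Seq of cmd & cmd
| Loop of nat & cmd.

Definition upd (T : Type) (st : nat -> T) r v := fun x => if x == r then v else st x.

Inductive exec : cmd -> (nat -> nat) -> (nat -> nat) -> Prop :=
| exec_skip st : exec Skip st st
| exec_inc r st : exec (Inc r) st (upd st r (st r).+1)
| exec_seq c1 c2 st1 st2 st3 :
    exec c1 st1 st2 -> exec c2 st2 st3 -> exec (Seq c1 c2) st1 st3
| exec_loop0 r c st : st r = 0 -> exec (Loop r c) st st
| exec_loopS r c n st1 st2 st3 : st1 r = n.+1 ->
    exec c (upd st1 r n) st2 -> exec (Loop r c) st2 st3 -> exec (Loop r c) st1 st3.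

Ltac upds := rewrite /upd; repeat (case: eqP => ?); subst; try lia; try congruence.
Ltac regs := apply/funext => ?; upds.

Lemma exec_eq c st st1 st2 : exec c st st1 -> st1 = st2 -> exec c st st2.
Proof. by move=> H <-. Qed.

Lemma exec_clear r st : exec (Loop r Skip) st (upd st r 0).
Proof.
move E: (st r) => n; elim: n st E => [|n IH] st E.
  by apply: exec_eq (exec_loop0 _ E) _; regs.
apply: exec_loopS E (exec_skip _) _.
by apply: exec_eq (IH _ _) _; [upds | regs].
Qed.

Lemma exec_move r s st : r != s ->
  exec (Loop r (Inc s)) st (upd (upd st s (st s + st r)) r 0).
Proof.
move=> /eqP Hrs; move E: (st r) => n; elim: n st E => [|n IH] st E.
  by apply: exec_eq (exec_loop0 _ E) _; regs.
apply: exec_loopS E (exec_inc _ _) _.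
by apply: exec_eq (IH _ _) _; [upds | regs].
Qed.

Lemma exec_move2 r s t st : uniq [:: r; s; t] ->
  exec (Loop r (Seq (Inc s) (Inc t))) st
    (upd (upd (upd st s (st s + st r)) t (st t + st r)) r 0).
Proof.
rewrite /= !inE negb_or andbT => /andP[/andP[/eqP rs /eqP rt] /eqP ts].
move E: (st r) => n; elim: n st E => [|n IH] st E.
  by apply: exec_eq (exec_loop0 _ E) _; regs.
apply: exec_loopS E (exec_seq (exec_inc _ _) (exec_inc _ _)) _.
by apply: exec_eq (IH _ _) _; [upds | regs].
Qed.

Definition copy r s t := Seq (Loop s Skip)
  (Seq (Loop r (Seq (Inc s) (Inc t))) (Loop t (Inc r))).

Lemma exec_copy r s t st : uniq [:: r; s; t] -> st t = 0 ->
  exec (copy r s t) st (upd st s (st r)).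
Proof.
move=> U Ht; apply: exec_seq (exec_clear _ _) _.
apply: exec_seq (exec_move2 _ U) _.
move: U; rewrite /= !inE negb_or andbT => /andP[/andP[/eqP rs /eqP rt] /eqP ts].
apply: exec_eq (exec_move _ _) _; first by apply/eqP; lia.
by regs.
Qed.

Lemma exec_clears b m : exists c, forall st,
  exec c st (fun r => if b <= r < b + m then 0 else st r).
Proof.
elim: m => [|m [c Hc]].
  by exists Skip => st; apply: exec_eq (exec_skip _) _; apply/funext => r; case: ifP => //; lia.
exists (Seq c (Loop (b + m) Skip)) => st.
apply: exec_eq (exec_seq (Hc st) (exec_clear _ _)) _.
by apply/funext => r; rewrite /upd; repeat (case: ifP => ?); lia.
Qed.

(** Registers from [b] on serve as scratch space: they are zero before and after
    the computation. *)
Definition loop_computable f := forall xs y b,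
  all (fun x => x < b) xs -> y < b -> y \notin xs ->
  exists c, forall st, (forall r, b <= r -> st r = 0) ->
    exec c st (upd st y (f [seq st x | x <- xs])).

Lemma exec_tuple (F : nat -> seq nat -> nat) m xs b :
  (forall k, k < m -> loop_computable (F k)) -> all (fun x => x < b) xs ->
  exists c, forall st, (forall r, b <= r -> st r = 0) -> exec c st
    (fun r => if b <= r < b + m then F (r - b) [seq st x | x <- xs] else st r).
Proof.
move=> HF xsb.
have xsb' : all (fun x => x < b + m) xs.
  by apply: sub_all xsb => x /= Hx; lia.
suff H k : k <= m -> exists c, forall st, (forall r, b <= r -> st r = 0) -> exec c st
    (fun r => if b <= r < b + k then F (r - b) [seq st x | x <- xs] else st r).
  exact: H (leqnn m).
elim: k => [_|k IHk Hk].
  exists Skip => st _; apply: exec_eq (exec_skip _) _.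
  by apply/funext => r; case: ifP => //; lia.
have [c Hc] := IHk (ltnW Hk).
have [||c' Hc'] := HF k Hk xs (b + k) (b + m) xsb'; first lia.
  by apply/negP => /(allP xsb) /=; lia.
exists (Seq c c') => st Hst; apply: exec_eq (exec_seq (Hc st Hst) (Hc' _ _)) _.
  by move=> r Hr; rewrite ifF ?Hst //; lia.
apply/funext => r; rewrite /upd; case: eqP => [->|Hr].
  rewrite ifT ?addKn; last lia.
  by congr (F _ _); apply/eq_in_map => x /(allP xsb) /= Hx; rewrite ifF //; lia.
by repeat (case: ifP => ?); lia.
Qed.

(** The primitive recursion keeps the counter, the index and the accumulator in the
    first free registers. *)
Lemma prec_loop_computable f : prec f -> loop_computable f.
Proof.
elim=> {f} [i||f _ IH|f gs _ IHf _ IHg|n f g _ IHn _ IHf _ IHg]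
  xs y b xsb yb yxs.
- have [Hi|Hi] := ltnP i (size xs); last first.
    exists (Loop y Skip) => st _; rewrite nth_default ?size_map//.
    exact: exec_clear.
  have Hx := mem_nth 0 Hi; exists (copy (nth 0 xs i) y b) => st Hst.
  rewrite (nth_map 0)//; apply: exec_copy; last exact: Hst.
  move/allP: xsb => /(_ _ Hx) /= xb; have nx : nth 0 xs i != y by apply: contraNneq yxs => <-.
  by rewrite /= !inE; lia.
- by exists (Loop y Skip) => st _; apply: exec_clear.
- have [c Hc] := IH _ _ _ xsb yb yxs; exists (Seq c (Inc y)) => st Hst.
  by apply: exec_eq (exec_seq (Hc st Hst) (exec_inc _ _)) _; regs.
- have [c1 Hc1] := exec_tuple IHg xsb.
  have [|||c2 Hc2] := IHf [seq b + i | i <- iota 0 (size gs)] y (b + size gs).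
  - by apply/allP => x /mapP[ i]; rewrite mem_iota => Hi -> /=; lia.
  - by lia.
  - by apply/mapP => -[i _ Hi]; lia.
  have [c3 Hc3] := exec_clears b (size gs).
  exists (Seq c1 (Seq c2 c3)) => st Hst.
  apply: exec_seq (Hc1 _ Hst) _; apply: exec_eq (exec_seq (Hc2 _ _) (Hc3 _)) _.
    by move=> r Hr; rewrite ifF ?Hst //; lia.
  apply/funext => r; rewrite /upd; case: eqP => [->|Hr].
    rewrite ifF; last lia.
    congr (f _); apply: (@eq_from_nth _ 0); rewrite !size_map ?size_iota // => i Hi.
    rewrite (nth_map 0) ?size_map ?size_iota // (nth_map 0) ?size_iota // nth_iota //.
    by rewrite (nth_map (fun=> 0)) // ifT ?addKn //; lia.
  by case: (boolP (b <= r < b + size gs)) => // Hb; rewrite Hst //; lia.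
- have H4 : all (fun x => x < b + 4) xs by apply: sub_all xsb => x /= Hx; lia.
  have nxs k : b <= k -> k \notin xs.
    by move=> Hk; apply/negP => /(allP xsb) /=; lia.
  have [||c1 Hc1] := IHn xs b (b + 4) H4; [lia | exact: nxs |].
  have [||c2 Hc2] := IHf xs (b + 2) (b + 4) H4; [lia | by apply: nxs; lia |].
  have [|||c3 Hc3] := IHg [:: b + 2, b + 1 & xs] (b + 3) (b + 4).
  - by rewrite /= H4; lia.
  - by lia.
  - by rewrite !inE !negb_or nxs; lia.
  (* Register [b] counts down, [b + 1] holds the index, [b + 2] the accumulator and
     [b + 3] the next value of the accumulator. *)
  pose body := Seq c3 (Seq (Loop (b + 2) Skip) (Seq (Loop (b + 3) (Inc (b + 2)))
                 (Inc (b + 1)))).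
  pose S (st : nat -> nat) i acc k := upd (upd (upd st b k) (b + 1) i) (b + 2) acc.
  have loop st (A := nat_rect (fun=> nat) (f [seq st x | x <- xs])
        (fun i acc => g [:: acc, i & [seq st x | x <- xs]])) :
      (forall r, b <= r -> st r = 0) -> forall k i,
      exec (Loop b body) (S st i (A i) k) (S st (i + k) (A (i + k)) 0).
    move=> Hst; elim=> [|k IHk] i.
      by apply: exec_eq (exec_loop0 _ _) _; rewrite ?addn0 //= /S; upds.
    rewrite addnS -addSn; apply: (@exec_loopS _ _ k _ _ _ _ _ (IHk i.+1)).
      by rewrite /S; upds.
    apply: exec_seq (Hc3 _ _) _; first by move=> r Hr; rewrite /S; upds; apply: Hst; lia.
    apply: exec_seq (exec_clear _ _) _; apply: exec_seq (exec_move _ _) _; first lia.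
    apply: exec_eq (exec_inc _ _) _.
    have -> : [seq upd (S st i (A i) k.+1) b k x | x <- [:: b + 2, b + 1 & xs]] =
        [:: A i, i & [seq st x | x <- xs]].
      rewrite /=; congr [:: _, _ & _]; [by rewrite /S; upds..|].
      by apply/eq_in_map => x /(allP xsb) /= Hx; rewrite /S; upds.
    have H3 : st (b + 3) = 0 by [apply: Hst; lia].
    rewrite /S; apply/funext => r.
    rewrite -[g _]/(A i.+1); move: (A i) (A i.+1) => Ai Ai1.
    by upds.
  exists (Seq c1 (Seq c2 (Seq (Loop b body) (Seq (Loop (b + 1) Skip)
    (Seq (Loop y Skip) (Loop (b + 2) (Inc y))))))) => st Hst.
  apply: exec_seq (Hc1 _ _) _; first by move=> r Hr; apply: Hst; lia.
  apply: exec_seq (Hc2 _ _) _; first by move=> r Hr; upds; apply: Hst; lia.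
  have -> : [seq upd st b (n [seq st x | x <- xs]) x | x <- xs] = [seq st x | x <- xs].
    by apply/eq_in_map => x /(allP xsb) /= Hx; upds.
  have := loop st Hst (n [seq st x | x <- xs]) 0; rewrite add0n /=.
  move: (f _) (n _) (nat_rect _ _ _ _) => v0 k v {}loop.
  have -> : upd (upd st b k) (b + 2) v0 = S st 0 v0 k.
    by have H1 : st (b + 1) = 0 by [apply: Hst; lia]; rewrite /S; regs.
  apply: exec_seq loop _; apply: exec_seq (exec_clear _ _) _.
  apply: exec_seq (exec_clear _ _) _; apply: exec_eq (exec_move _ _) _; first lia.
  have H0 : st b = 0 by apply: Hst; lia.
  have H1 : st (b + 1) = 0 by apply: Hst; lia.
  have H2 : st (b + 2) = 0 by apply: Hst; lia.
  by rewrite /S; regs.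
Qed.

(** * Machines with jumps whose registers hold words *)

(** [Pop b r l] removes the first letter of register [r] if that letter is [b],
    and jumps to [l] otherwise. *)
Inductive instr := Push of nat | Pop of bool & nat & nat.

Definition wconfig := (nat * (nat -> seq bool))%type.

Definition wstep (p : seq instr) (c : wconfig) : option wconfig :=
  match onth p c.1 with
  | Some (Push r) => Some (c.1.+1, upd c.2 r (true :: c.2 r))
  | Some (Pop b r l) =>
      if c.2 r is b' :: w then
        if b' == b then Some (c.1.+1, upd c.2 r w) else Some (l, c.2)
      else Some (l, c.2)
  | None => None
  end.

Definition wreach p c c' := exists n, iter n (obind (wstep p)) (Some c) = Some c'.

Lemma wreach_refl p c : wreach p c c.
Proof. by exists 0. Qed.

Lemma wreach_trans p c1 c2 c3 : wreach p c1 c2 -> wreach p c2 c3 -> wreach p c1 c3.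
Proof. by move=> [n Hn] [m Hm]; exists (m + n); rewrite iterD Hn. Qed.

Lemma wreach_step p c1 c2 c3 : wstep p c1 = Some c2 -> wreach p c2 c3 -> wreach p c1 c3.
Proof. by move=> H; apply: wreach_trans; exists 1. Qed.

(** The compiled code of [c] is placed at position [o]. Register [0] holds the
    word of a number, so that a [Pop false 0 _] always jumps. *)
Fixpoint compile c o :=
  match c with
  | Skip => [::]
  | Inc r => [:: Push r]
  | Seq c1 c2 => let p := compile c1 o in p ++ compile c2 (o + size p)
  | Loop r c =>
      let p := compile c o.+1 in
      Pop true r (o + size p).+2 :: rcons p (Pop false 0 o)
  end.

Definition words (st : nat -> nat) r := nseq (st r) true.

Lemma words_upd st r n : upd (words st) r (nseq n true) = words (upd st r n).
Proof. by apply/funext => x; rewrite /words /upd; case: eqP. Qed.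

Lemma onth_mid (T : Type) (s1 s2 : seq T) x : onth (s1 ++ x :: s2) (size s1) = Some x.
Proof. by rewrite onth_cat ltnn subnn. Qed.

Lemma compile_correct c st st' : exec c st st' -> forall p1 p2,
  wreach (p1 ++ compile c (size p1) ++ p2) (size p1, words st)
    (size p1 + size (compile c (size p1)), words st').
Proof.
elim=> {c st st'} [st|r st|c1 c2 st1 st2 st3 _ IH1 _ IH2|r c st Hr
                  |r c n st1 st2 st3 Hr _ IH1 _ IH2] p1 p2 /=.
- by rewrite addn0; apply: wreach_refl.
- apply: wreach_step (wreach_refl _ _); rewrite /wstep onth_mid /= addn1.
  by rewrite -words_upd.
- rewrite -catA size_cat addnA.
  apply: wreach_trans (IH1 p1 _) _.
  have := IH2 (p1 ++ compile c1 (size p1)) p2.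
  by rewrite -catA !size_cat.
- apply: wreach_step (wreach_refl _ _); rewrite /wstep onth_mid /= /words Hr /=.
  by rewrite size_rcons !addnS.
- set p := _ ++ _; apply: (wreach_step (c2 := ((size p1).+1, words (upd st1 r n)))).
    by rewrite /wstep onth_mid /= {1}/words Hr /= words_upd.
  have := IH1 (rcons p1 (Pop true r (size p1 + size (compile c (size p1).+1)).+2))
    (Pop false 0 (size p1) :: p2).
  rewrite size_rcons cat_rcons -(cat_rcons (Pop false 0 _)) -/p => H.
  apply: wreach_trans H _.
  apply: (wreach_step (c2 := (size p1, words st2))); last exact: IH2.
  set q := rcons p1 (Pop true r (size p1 + size (compile c (size p1).+1)).+2)
             ++ compile c (size p1).+1.
  have -> : p = q ++ Pop false 0 (size p1) :: p2.
    by rewrite /p /q -catA cat_rcons /= cat_rcons.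
  have -> : ((size p1).+1 + size (compile c (size p1).+1)) = size q.
    by rewrite size_cat size_rcons.
  by rewrite /wstep onth_mid /= /words; case: (st2 0).
Qed.

(** Strips the signs [false] off the registers [i <= j < i + n] and records them
    in the registers [a + j]. *)
Fixpoint read_signs a i n :=
  if n is n'.+1 then [:: Pop false i (2 * i).+2, Push (a + i) & read_signs a i.+1 n']
  else [::].

Definition unsigned_word w := if w is false :: w' then w' else w.
Definition sign_word (w : seq bool) := if w is false :: w' then [:: true] else [::].

Lemma size_read_signs a i n : size (read_signs a i n) = 2 * n.
Proof. by elim: n i => //= n IH i; rewrite IH mulnS. Qed.

(** The input words of negative numbers start with the letter [false]; after
    this prelude all registers are words of natural numbers, as [compile_correct]
    needs them. *)
Lemma read_signs_correct a i n p1 p2 w : size p1 = 2 * i -> i + n <= a ->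
  (forall j, a <= j -> i <= j - a < i + n -> w j = [::]) ->
  wreach (p1 ++ read_signs a i n ++ p2) (2 * i, w)
    (2 * (i + n), fun j => if i <= j < i + n then unsigned_word (w j)
      else if (a <= j) && (i <= j - a < i + n) then sign_word (w (j - a)) else w j).
Proof.
elim: n i p1 w => [|n IH] i p1 w Hp Ha Hw /=.
  rewrite addn0 (_ : (fun j => _) = w); first exact: wreach_refl.
  by apply/funext => j; rewrite !ifF //; lia.
pose w1 := upd (upd w i (unsigned_word (w i))) (a + i) (sign_word (w i)).
apply: (@wreach_trans _ _ (2 * i.+1, w1)).
  rewrite mulnS add2n -{2}Hp -{2}Hp.
  have Hai : w (a + i) = [::] by apply: Hw; lia.
  case E : (w i) => [|[] u].
  1-2: apply: wreach_step (wreach_refl _ _); rewrite /wstep -{1}Hp onth_mid /= E;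
    congr (Some (_, _)); apply/funext => j; rewrite /w1 /upd E /=;
    by case: eqP => [->//|_]; case: eqP => [->|].
  apply: wreach_step; first by rewrite /wstep -{1}Hp onth_mid /= E.
  apply: wreach_step (wreach_refl _ _).
  set P := Pop false i _.
  have -> : (size p1).+1 = size (rcons p1 P) by rewrite size_rcons.
  rewrite /wstep -cat_rcons onth_mid /= size_rcons; congr (Some (_, _)); apply/funext => j.
  by rewrite /w1 /upd E /= (_ : (a + i == i) = false) ?Hai //; lia.
have := IH i.+1 (rcons (rcons p1 (Pop false i (2 * i).+2)) (Push (a + i))) w1.
rewrite !size_rcons !cat_rcons addSnnS => H.
have {H} := H _ Ha _; rewrite Hp mulnS => /(_ erefl) H.
have {H} : wreach (p1 ++ [:: Pop false i (2 * i).+2, Push (a + i) & read_signs a i.+1 n ++ p2])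
  (2 + 2 * i, w1) (2 * (i + n.+1), fun j => if i.+1 <= j < i + n.+1 then unsigned_word (w1 j)
      else if (a <= j) && (i.+1 <= j - a < i + n.+1) then sign_word (w1 (j - a)) else w1 j).
  apply: H => j Hj1 Hj2; rewrite /w1 /upd.
  rewrite (_ : (j == a + i) = false); last lia.
  rewrite (_ : (j == i) = false); last lia.
  by apply: Hw; lia.
congr (wreach _ _ (_, _)); apply/funext => j; rewrite /w1 /upd.
have [->|ji] := eqVneq j i.
  by repeat (case: ifP => ? //); lia.
have [->|jai] := eqVneq j (a + i).
  by rewrite addKn; repeat (case: ifP => ? //); lia.
by repeat (case: ifP => ? //); lia.
Qed.

(** * Compilation into Turing machines *)

(** The registers and the jump targets are bounded by one number [K], so that both
    the tapes and the states of the machine are indexed by ordinals below [K]. *)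
Definition instr_bound x := match x with Push r => r | Pop _ r l => maxn r l end.
Definition prog_bound k p := foldr maxn (maxn k (size p)) [seq instr_bound x | x <- p].

Lemma prog_bound_ge k p : maxn k (size p) <= prog_bound k p.
Proof. by rewrite /prog_bound; elim: (map _ _) => //= x s IH; lia. Qed.

Lemma prog_bound_instr k p n x : onth p n = Some x -> instr_bound x <= prog_bound k p.
Proof.
rewrite /prog_bound; move: (maxn k _) => m.
by elim: p n => [|y p IH] [|n] //= => [[->]|/IH]; lia.
Qed.

Section Machine.
Variables (k : nat) (p : seq instr).
Let K := (prog_bound k p).+1.

Definition act_on r s mv (heads : K.-tuple (symbol void)) :=
  [tuple if (i : nat) == r then (s, mv) else (tnth heads i, Stay) | i < K].

(** A [Push] takes two steps: the head first moves to the cell left of the word,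
    whose content is overwritten in the second step. *)
Definition machine_trans (q : 'I_K * bool) (heads : K.-tuple (symbol void)) :=
  match onth p q.1 with
  | Some (Push r) =>
      if q.2 then Some ((inord q.1.+1, false), act_on r (Some (inl true)) Stay heads)
      else Some ((q.1, true), act_on r (nth None heads r) MoveLeft heads)
  | Some (Pop b r l) =>
      if nth None heads r == Some (inl b)
      then Some ((inord q.1.+1, false), act_on r None MoveRight heads)
      else Some ((inord l, false), act_on K None Stay heads)
  | None => None
  end.

Definition machine : turing_machine :=
  @TuringMachine K ('I_K * bool)%type void (inord 0, false) machine_trans.

(** The word of a register starts under the head; what lies left of the head is
    arbitrary and may be overwritten. *)
Definition tape_word (t : tape void) (w : seq bool) :=
  exists n, tape_head t :: tape_right t = [seq Some (inl b) | b <- w] ++ nseq n None.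

Lemma tape_word_input w : tape_word (input_tape void w) w.
Proof.
by case: w => [|b w]; [exists 1 | exists 0; rewrite cats0].
Qed.

Lemma tape_word_output t w : tape_word t w -> output_word t = w.
Proof.
rewrite /output_word => -[n ->]; elim: w => [|b w IH] /=; last by rewrite IH.
by case: n.
Qed.

Definition simulates (c : tm_config machine) (d : wconfig) :=
  [/\ c.1 = (inord d.1, false), d.1 < K
    & forall i : 'I_K, tape_word (tnth c.2 i) (d.2 i)].

Definition do_act r s mv (ts : K.-tuple (tape void)) :=
  [tuple if (i : nat) == r then move_head mv (write s (tnth ts i)) else tnth ts i | i < K].

Lemma step_act q (ts : K.-tuple (tape void)) q' r s mv :
  machine_trans q (map_tuple (@tape_head _) ts) =
    Some (q', act_on r s mv (map_tuple (@tape_head _) ts)) ->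
  tm_step ((q, ts) : tm_config machine) = Some (q', do_act r s mv ts).
Proof.
rewrite /tm_step => /= ->; congr (Some (_, _)).
apply: eq_from_tnth => i; rewrite !tnth_mktuple.
by case: ifP => _ //=; rewrite tnth_map; case: (tnth ts i).
Qed.

Lemma nth_heads (ts : K.-tuple (tape void)) (i : 'I_K) :
  nth None (map_tuple (@tape_head _) ts) i = tape_head (tnth ts i).
Proof. by rewrite -tnth_nth tnth_map. Qed.

Lemma simulates_step c d d' : simulates c d -> wstep p d = Some d' ->
  exists n c', iter n (obind (@tm_step machine)) (Some c) = Some c' /\ simulates c' d'.
Proof.
case: c => q ts; case: d => pc w [/= -> Hpc Hts]; rewrite /wstep /=.
case E : (onth p pc) => [x|]; last by [].
have Hpc' : pc.+1 < K.
  have : onth p pc by rewrite E.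
  by rewrite onthTE ltnS; have := prog_bound_ge k p; lia.
have Hx : instr_bound x < K by rewrite ltnS; apply: prog_bound_instr E.
case: x E Hx => [r|b r l] E /= Hx.
- move=> [<-]; exists 2; eexists; split.
    rewrite (_ : iter 2 _ _ = obind (@tm_step machine) (@tm_step machine (inord pc, false, ts))) //.
    rewrite (@step_act _ _ (inord pc, true) r (nth None (map_tuple (@tape_head _) ts) r) MoveLeft);
      last by rewrite /machine_trans /= inordK // E.
    by apply: step_act; rewrite /machine_trans /= inordK // E; reflexivity.
  split => //= i; rewrite !tnth_mktuple /upd.
  case: eqP => [<-|_]; last exact: Hts.
  have [n Hn] := Hts i; exists n; rewrite -[nth _ _ _]/(nth None (map_tuple _ _) _) nth_heads.
  rewrite [RHS]/= -Hn.
  by case: (tnth ts i) {Hn} => [[|a L] h R].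
- have Hr : r < K by lia.
  have Hl : l < K by lia.
  have step q' r' s mv : machine_trans (inord pc, false) (map_tuple (@tape_head _) ts) =
      Some (q', act_on r' s mv (map_tuple (@tape_head _) ts)) ->
      iter 1 (obind (@tm_step machine)) (Some (inord pc, false, ts)) =
      Some (q', do_act r' s mv ts).
    by move=> /step_act.
  have [n Hn] := Hts (Ordinal Hr).
  have Hhd : nth None (map_tuple (@tape_head _) ts) r = Some (inl b) <->
      exists w', w r = b :: w'.
    rewrite -[r]/(nat_of_ord (Ordinal Hr)) nth_heads /=; case: (w r) Hn => [|b' w'] /=.
      by case: n => // n [-> _]; split=> // -[].
    by case=> -> _; split=> [[->]|[w'' [->]]] //; exists w'.
  have jump : ~ (exists w', w r = b :: w') ->
      exists n c', iter n (obind (@tm_step machine)) (Some (inord pc, false, ts)) = Some c' /\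
      simulates c' (l, w).
    move=> /Hhd /eqP/negbTE H; exists 1; eexists; split.
      apply: (step (inord l, false) K None Stay).
      by rewrite /machine_trans [(_, _).1]/= inordK // E H.
    by split => //= i; rewrite tnth_mktuple ifF; [exact: Hts | apply: ltn_eqF].
  case Ew : (w r) => [|b' w']; first by move=> [<-]; apply: jump; rewrite Ew => -[].
  case: eqP => [Hb|Hb] [<-]; last by apply: jump; rewrite Ew => -[w'' []].
  exists 1; eexists; split.
    apply: (step (inord pc.+1, false) r None MoveRight).
    rewrite /machine_trans [(_, _).1]/= inordK // E ifT //.
    by apply/eqP/Hhd; rewrite Ew Hb; exists w'.
  split => //= i; rewrite tnth_mktuple /upd.
  case: eqP => [Hi|_]; last exact: Hts.
  move: Hn; have -> : Ordinal Hr = i by apply: val_inj.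
  rewrite /= Hi Ew; case: (tnth ts i) => L h [|a R] /= [_ H].
    by exists 1; rewrite /=; case: w' {Ew} H => //; case: n.
  by exists n; rewrite -H.
Qed.

Lemma simulates_halt c w : simulates c (size p, w) -> tm_step c = None.
Proof.
case: c => q ts [/= -> H _].
by rewrite /tm_step /= /machine_trans /= inordK // onth_default.
Qed.

Lemma simulates_reach c d d' : simulates c d -> wreach p d d' ->
  exists n c', iter n (obind (@tm_step machine)) (Some c) = Some c' /\ simulates c' d'.
Proof.
move=> Hc [n]; elim: n d' => [|n IH] d' /=.
  by case=> <-; exists 0, c.
case E : (iter n _ _) => [d1|//] /= Hd'.
have [m [c1 [Hc1 Hs1]]] := IH _ E.
have [m' [c2 [Hc2 Hs2]]] := simulates_step Hs1 Hd'.
by exists (m' + m), c2; rewrite iterD Hc1.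
Qed.

Lemma machine_computes ws w' m : m <= k ->
  wreach p (0, nth [::] ws) (size p, w') ->
  tm_computes machine ws [seq w' i | i <- iota 0 m].
Proof.
move=> Hm Hreach.
have Hinit : simulates (tm_init machine ws) (0, nth [::] ws).
  by split=> //= i; rewrite tnth_mktuple; apply: tape_word_input.
have [n [c [Hc Hs]]] := simulates_reach Hinit Hreach.
exists c; first by split; [exists n | apply: simulates_halt Hs].
rewrite size_map size_iota; apply/eq_in_map => i; rewrite mem_iota => /andP[_ Hi].
have HK : i < K by rewrite ltnS; have := prog_bound_ge k p; lia.
case: Hs => _ _ /(_ (Ordinal HK)) /tape_word_output /= <-.
by rewrite (tnth_nth (input_tape void [::])).
Qed.
End Machine.

(** ** Functions of integers *)

Definition int_env (zs : seq int) : seq nat :=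
  [seq absz z | z <- zs] ++ [seq ((z < 0)%R : nat) | z <- zs].

Lemma unsigned_int_word z : unsigned_word (int_word z) = nat_word (absz z).
Proof. by case: z => [[]|]. Qed.

Lemma sign_int_word z : sign_word (int_word z) = nat_word (z < 0)%R.
Proof. by case: z => [[]|]. Qed.

(** The machine strips the signs off the input words and records them on other tapes; a
    loop program then writes the values into fresh registers and finally moves them into
    the first [n] ones, which are the output tapes. *)
Theorem prec_turing n (F : nat -> seq nat -> nat) :
  (forall i, i < n -> prec (F i)) ->
  exists M : turing_machine, forall zs : seq int, size zs = n ->
    tm_computes M [seq int_word z | z <- zs]
      [seq nat_word (F i (int_env zs)) | i <- iota 0 n].
Proof.
move=> HF.
have [|c1 Hc1] := @exec_tuple F n (iota 0 (2 * n)) (2 * n)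
  (fun i Hi => prec_loop_computable (HF i Hi)).
  by apply/allP => x; rewrite mem_iota.
pose mv := foldr (fun i c => Seq (Seq (Loop i Skip) (Loop (2 * n + i) (Inc i))) c) Skip.
have Hmv m st : m <= n -> exists st', exec (mv (iota (n - m) m)) st st' /\
    forall i, st' i = if i < n - m then st i else if i < n then st (2 * n + i)
      else if i < 2 * n + (n - m) then st i else if i < 3 * n then 0 else st i.
  elim: m st => [|m IH] st Hm.
    exists st; split; first exact: exec_skip.
    by move=> i; repeat (case: ifP => ? //); lia.
  have [] := IH (upd (upd st (n - m.+1) (st (2 * n + (n - m.+1)))) (2 * n + (n - m.+1)) 0) (ltnW Hm).
  move=> st' [H1 H2]; exists st'; split.
    rewrite /= (_ : (n - m.+1).+1 = n - m); last lia.
    apply: exec_seq H1; apply: exec_seq (exec_clear _ _) _.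
    apply: exec_eq (exec_move _ _) _; first lia.
    by regs.
  move=> i; rewrite H2 /upd.
  by repeat (case: ifP => ? //); try lia; congr st; lia.
pose c := Seq c1 (mv (iota 0 n)).
pose p := read_signs n 0 n ++ compile c (2 * n).
exists (machine n p) => zs Hzs.
have [st0 Hst0] : exists st0, st0 = nth 0 (int_env zs) by eexists.
have [|st1 [Hst1 Hst1']] := Hmv n
  (fun r => if 2 * n <= r < 2 * n + n then F (r - 2 * n) [seq st0 x | x <- iota 0 (2 * n)]
            else st0 r); first exact: leqnn.
have Hexec : exec c st0 st1.
  rewrite subnn in Hst1; apply: exec_seq Hst1; apply: Hc1 => r Hr.
  by rewrite Hst0 nth_default // size_cat !size_map Hzs; lia.
have Henv : [seq st0 x | x <- iota 0 (2 * n)] = int_env zs.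
  by rewrite Hst0 map_nth_iota0 ?take_oversize // size_cat !size_map Hzs; lia.
have -> : [seq nat_word (F i (int_env zs)) | i <- iota 0 n] =
    [seq words st1 i | i <- iota 0 n].
  apply/eq_in_map => i; rewrite mem_iota => /andP[_ Hi].
  by rewrite /words Hst1' subnn ltn0 Hi ifT ?addKn ?Henv //; lia.
apply: machine_computes (leqnn n) _.
have := @read_signs_correct n 0 n [::] (compile c (2 * n)) (nth [::] [seq int_word z | z <- zs])
  (esym (muln0 _)) (leqnn _).
rewrite muln0 add0n => H.
apply: wreach_trans (H _) _ => [j Hj1 Hj2|].
  by rewrite nth_default // size_map Hzs.
set w := (fun j => _); have -> : w = words st0.
  apply/funext => j; rewrite /w /words Hst0 /int_env nth_cat size_map Hzs /=.
  case: (ltnP j n) => Hj.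
    by rewrite !(nth_map (0%R : int)) ?Hzs // unsigned_int_word.
  case: (ltnP (j - n) n) => Hj' /=.
    by rewrite !(nth_map (0%R : int)) ?Hzs // sign_int_word.
  by rewrite !nth_default // size_map Hzs; lia.
have := compile_correct Hexec (read_signs n 0 n) [::].
by rewrite size_read_signs cats0 /p size_cat size_read_signs.
Qed.

(** * Universal simulation of Turing machines *)

(** A machine is coded by the list of its initial state, the size of its alphabet,
    its number of tapes and its table of transitions.  The table is indexed by the
    code of the state and the letters under the heads; the entry is [0] where the
    machine halts.  The two halves of a tape are numbers in base [m], with the
    digit [0] for the blank, so that blank cells at the far end do not count. *)

Definition univ_move m a t :=
  let L := fstn t in let R := sndn t in
  let R1 := fstn a + m * (R %/ m) in
  if sndn a == 0 then pairn (L %/ m) (L %% m + m * R1)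
  else if sndn a == 1 then pairn L R1
  else pairn (fstn a + m * L) (R %/ m).

Definition univ_key n c := mkseqn
  (fun i => if i == 0 then fstn c else sndn (nthn (sndn c) i.-1) %% nthn n 1)
  (nthn n 2).+1.

Definition univ_entry n c := nthn (nthn n 3) (univ_key n c).

Definition univ_step n c :=
  if univ_entry n c == 0 then c else
  pairn (nthn (univ_entry n c) 0)
    (mkseqn (fun i => univ_move (nthn n 1) (nthn (univ_entry n c) i.+1)
                                (nthn (sndn c) i)) (nthn n 2)).

Definition univ_init n x := pairn (nthn n 0)
  (mkseqn (fun i => pairn 0 (if i == 0 then \sum_(j < x) (nthn n 1) ^ j else 0))
     (nthn n 2)).

Definition univ_halted n x s := univ_entry n (iter s (univ_step n) (univ_init n x)) == 0.

Definition univ_halts_at n x s :=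
  univ_halted n x s && ((s == 0) || ~~ univ_halted n x s.-1).

Lemma univ_halted_mono n x s s' : s <= s' -> univ_halted n x s -> univ_halted n x s'.
Proof.
move=> /subnK <-; elim: (s' - s) => //= d IH /IH.
rewrite /univ_halted iterS; move: (iter _ _ _) => c H.
by rewrite /univ_step H.
Qed.

(** A machine that has halted stays halted, and [univ_halts_at] asks that it had not
    halted one step before. *)
Lemma univ_halts_at_unique n x s s' :
  univ_halts_at n x s -> univ_halts_at n x s' -> s = s'.
Proof.
wlog: s s' / s <= s'.
  by move=> H; case: (leqP s s') => [|/ltnW] /H{}H H1 H2; [|apply/esym]; apply: H.
rewrite leq_eqVlt => /orP[/eqP //|Hs] /andP[H1 _] /andP[_ /orP[/eqP|]]; first lia.
by rewrite (univ_halted_mono _ H1) //; lia.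
Qed.

Lemma prec_univ_entry f g : prec f -> prec g -> prec (fun e => univ_entry (f e) (g e)).
Proof.
move=> Hf Hg; apply: (prec_nthn (prec_nthn Hf (prec_const 3)) _).
have := prec_mkseqn (prec_succ (prec_nthn Hf (prec_const 2)))
  (prec_if (prec_eq0 (prec_var 0)) (prec_fstn (prec_drop 1 Hg))
    (prec_mod (prec_sndn (prec_nthn (prec_sndn (prec_drop 1 Hg)) (prec_pred (prec_var 0))))
       (prec_nthn (prec_drop 1 Hf) (prec_const 1)))).
by move/prec_ext; apply => e; rewrite /= drop0.
Qed.

Lemma prec_univ_move f g h : prec f -> prec g -> prec h ->
  prec (fun e => univ_move (f e) (g e) (h e)).
Proof.
move=> Hf Hg Hh.
have HL := prec_fstn Hh; have HR := prec_sndn Hh; have Hs := prec_fstn Hg.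
have HR1 := prec_add Hs (prec_mul Hf (prec_div HR Hf)).
apply: (prec_if (prec_eq0 (prec_sndn Hg)) _ _).
  exact: (prec_pairn (prec_div HL Hf) (prec_add (prec_mod HL Hf) (prec_mul Hf HR1))).
apply: (prec_if (prec_eq (prec_sndn Hg) (prec_const 1)) _ _).
  exact: (prec_pairn HL HR1).
exact: (prec_pairn (prec_add Hs (prec_mul Hf HL)) (prec_div HR Hf)).
Qed.

Lemma prec_univ_step f g : prec f -> prec g -> prec (fun e => univ_step (f e) (g e)).
Proof.
move=> Hf Hg; have He := prec_univ_entry Hf Hg.
apply: (prec_if (prec_eq0 He) Hg _).
apply: (prec_pairn (prec_nthn He (prec_const 0)) _).
have := prec_mkseqn (prec_nthn Hf (prec_const 2))
  (prec_univ_move (prec_nthn (prec_drop 1 Hf) (prec_const 1))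
    (prec_nthn (prec_drop 1 He) (prec_succ (prec_var 0)))
    (prec_nthn (prec_sndn (prec_drop 1 Hg)) (prec_var 0))).
by move/prec_ext; apply => e; rewrite /= drop0.
Qed.

Lemma prec_univ_init f g : prec f -> prec g -> prec (fun e => univ_init (f e) (g e)).
Proof.
move=> Hf Hg; apply: (prec_pairn (prec_nthn Hf (prec_const 0)) _).
have Hw : prec (fun e => \sum_(j < g e) nthn (f e) 1 ^ j).
  have := prec_sum Hg (prec_pow (prec_nthn (prec_drop 1 Hf) (prec_const 1)) (prec_var 0)).
  by move/prec_ext; apply => e; apply: eq_bigr => j _; rewrite /= drop0.
have := prec_mkseqn (prec_nthn Hf (prec_const 2)) (prec_pairn prec_zero
  (prec_if (prec_eq0 (prec_var 0)) (prec_drop 1 Hw) prec_zero)).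
by move/prec_ext; apply => e; rewrite /= drop0.
Qed.

Lemma prec_univ_halted f g h : prec f -> prec g -> prec h ->
  prec (fun e => univ_halted (f e) (g e) (h e) : nat).
Proof.
move=> Hf Hg Hh; apply: prec_eq0; apply: (prec_univ_entry Hf _).
have := prec_rec Hh (prec_univ_init Hf Hg) (prec_univ_step (prec_drop 2 Hf) (prec_var 0)).
move/prec_ext; apply => e; rewrite /= drop0.
by elim: (h e) => //= k ->.
Qed.

Lemma prec_univ_halts_at f g h : prec f -> prec g -> prec h ->
  prec (fun e => univ_halts_at (f e) (g e) (h e) : nat).
Proof.
move=> Hf Hg Hh; apply: (prec_and (prec_univ_halted Hf Hg Hh) _).
have := prec_if (prec_eq0 Hh) (prec_const 1)
  (prec_not (prec_univ_halted Hf Hg (prec_pred Hh))).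
by move/prec_ext; apply => e; case: (h e == 0).
Qed.

Section Simulation.
Variable M : turing_machine.
Let m := 3 + #|tm_aux M|.
Let k := tm_tapes M.

Definition symbol_code (s : symbol (tm_aux M)) : nat :=
  match s with
  | None => 0
  | Some (inl b) => if b then 1 else 2
  | Some (inr e) => 3 + enum_rank e
  end.

Definition move_code d := match d with MoveLeft => 0 | Stay => 1 | MoveRight => 2 end.

Lemma symbol_code_lt s : symbol_code s < m.
Proof. by case: s => [[[]|e]|] //=; rewrite /m ltn_add2l. Qed.

Lemma symbol_code_inj : injective symbol_code.
Proof.
move=> [[[]|e]|] [[[]|e']|] //= [] /ord_inj /enum_rank_inj -> //.
Qed.

(** The digit in front is the one next to the head. *)
Definition half_code := foldr (fun s c => symbol_code s + m * c) 0.
Definition tape_code (t : tape (tm_aux M)) :=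
  pairn (half_code (tape_left t)) (half_code (tape_head t :: tape_right t)).
Definition config_code (c : tm_config M) :=
  pairn (enum_rank c.1) (coden [seq tape_code t | t <- c.2]).
Definition key_code (q : tm_state M) (hs : k.-tuple (symbol (tm_aux M))) :=
  coden ((enum_rank q : nat) :: [seq symbol_code s | s <- hs]).
Definition entry_code (q : tm_state M) (hs : k.-tuple (symbol (tm_aux M))) :=
  if tm_trans q hs is Some (q', acts) then
    coden ((enum_rank q' : nat) :: [seq pairn (symbol_code a.1) (move_code a.2) | a <- acts])
  else 0.

Let keys := (tm_state M * k.-tuple (symbol (tm_aux M)))%type.
Let table_at i :=
  if [pick x : keys | key_code x.1 x.2 == i] is Some x then entry_code x.1 x.2 else 0.
Let table_size := (\max_(x : keys) key_code x.1 x.2).+1.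
Definition machine_code :=
  coden [:: (enum_rank (tm_start M) : nat); m; k; mkseqn table_at table_size].

Lemma key_code_inj q hs q' hs' : key_code q hs = key_code q' hs' -> q = q' /\ hs = hs'.
Proof.
move=> /coden_inj [] /ord_inj /enum_rank_inj -> H; split=> //.
by apply/val_inj/(inj_map symbol_code_inj).
Qed.

Lemma nthn_map (T : Type) (f : T -> nat) (x0 : T) s i : i < size s ->
  nthn (coden [seq f x | x <- s]) i = f (nth x0 s i).
Proof. by move=> Hi; rewrite nthnE ?size_map // (nth_map x0). Qed.

Lemma mkseqn_map (T : Type) (f : nat -> nat) (g : T -> nat) (x0 : T) n s : size s = n ->
  (forall i, i < n -> f i = g (nth x0 s i)) -> mkseqn f n = coden [seq g x | x <- s].
Proof.
move=> <- H; congr coden; apply: (@eq_from_nth _ 0); first by rewrite size_map size_mkseq.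
by move=> i; rewrite size_mkseq => Hi; rewrite nth_mkseq // (nth_map x0) // H.
Qed.

Lemma machine_codeE : [/\ nthn machine_code 0 = enum_rank (tm_start M),
  nthn machine_code 1 = m, nthn machine_code 2 = k &
  nthn machine_code 3 = mkseqn table_at table_size].
Proof. by split; rewrite nthnE. Qed.

Lemma half_code_mod s l : half_code (s :: l) %% m = symbol_code s.
Proof. by rewrite /= addnC mulnC modnMDl modn_small // symbol_code_lt. Qed.

Lemma half_code_div s l : half_code (s :: l) %/ m = half_code l.
Proof. by rewrite /= addnC mulnC divnMDl // divn_small ?addn0 // symbol_code_lt. Qed.

(** The key of a configuration is below the size of the table, and determines the state
    and the letters that it was made from. *)
Lemma univ_entryE (c : tm_config M) : univ_entry machine_code (config_code c) =
  entry_code c.1 (map_tuple (@tape_head _) c.2).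
Proof.
set hs := map_tuple _ _; have [_ m_code k_code table_code] := machine_codeE.
have -> : univ_entry machine_code (config_code c) =
    nthn (mkseqn table_at table_size) (key_code c.1 hs).
  rewrite /univ_entry table_code /univ_key m_code k_code /key_code; congr (nthn _ (coden _)).
  apply: (@eq_from_nth _ 0); first by rewrite /= !size_map size_iota size_tuple.
  move=> i; rewrite size_mkseq => Hi; rewrite nth_mkseq // /config_code fstnK sndnK.
  case: i Hi => //= i; rewrite ltnS => Hi.
  rewrite (nthn_map _ (input_tape _ [::])) ?size_tuple // sndnK half_code_mod.
  by rewrite -map_comp (nth_map (input_tape _ [::])) ?size_tuple.
rewrite nthn_mkseqn; last first.
  by rewrite ltnS (@leq_bigmax _ (fun x : keys => key_code x.1 x.2) (c.1, hs)).
rewrite /table_at; case: pickP => [[q hs'] /= /eqP /key_code_inj [-> ->] //|].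
by move=> /(_ (c.1, hs)); rewrite eqxx.
Qed.

Lemma univ_moveE s d t : univ_move m (pairn (symbol_code s) (move_code d)) (tape_code t) =
  tape_code (move_head d (write s t)).
Proof.
case: t => l h r; rewrite /univ_move /tape_code !fstnK !sndnK half_code_div.
by case: d; [case: l => [|a l] | | case: r => [|a r]];
  rewrite ?[tape_left _]/= ?[tape_head _]/= ?[tape_right _]/= ?half_code_mod ?half_code_div //=
     ?div0n ?mod0n ?muln0.
Qed.

Lemma univ_stepE (c c' : tm_config M) : tm_step c = Some c' ->
  univ_step machine_code (config_code c) = config_code c'.
Proof.
rewrite /univ_step univ_entryE /entry_code /tm_step.
case: tm_trans => // -[q' acts] [<-]; have [_ m_code k_code _] := machine_codeE.
set ts' := mktuple _.
rewrite [_ == 0]/= nthnE // /config_code sndnK m_code k_code; congr (pairn _ _).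
apply: (mkseqn_map (x0 := input_tape _ [::])); first exact: size_tuple.
move=> i Hi; rewrite nthnE; last by rewrite /= size_map size_tuple.
rewrite [nth 0 _ _]/=.
rewrite -[ i]/(nat_of_ord (Ordinal Hi)); move: (Ordinal Hi) => {Hi} {}i.
rewrite -[in RHS]tnth_nth /ts' tnth_mktuple -univ_moveE.
rewrite (nthn_map _ (input_tape _ [::])) ?size_tuple // -!tnth_nth; congr univ_move.
exact: tnth_map.
Qed.

Lemma half_code_nseq x : half_code (nseq x (Some (inl true))) = \sum_(j < x) m ^ j.
Proof.
elim: x => [|x IH]; first by rewrite big_ord0.
rewrite /= IH big_ord_recl /= big_distrr; congr (_ + _).
by apply: eq_bigr => j _; rewrite /bump add1n expnS.
Qed.

Lemma univ_initE x :
  univ_init machine_code x = config_code (tm_init M [:: nat_word x]).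
Proof.
have [q_code m_code k_code _] := machine_codeE.
rewrite /univ_init q_code m_code k_code; congr pairn.
apply: (mkseqn_map (x0 := input_tape _ [::])); first exact: size_tuple.
move=> i Hi; rewrite -[ i]/(nat_of_ord (Ordinal Hi)); move: (Ordinal Hi) => {Hi} {}i.
rewrite -tnth_nth tnth_mktuple; case: i => -[|i] Hi /=;
  last by rewrite nth_nil /tape_code /= muln0.
rewrite -half_code_nseq; case: x => [|x]; first by rewrite /tape_code /= muln0.
by rewrite /tape_code /nat_word /= map_nseq.
Qed.

Lemma univ_iterE x s (c : tm_config M) :
  iter s (obind (@tm_step M)) (Some (tm_init M [:: nat_word x])) = Some c ->
  iter s (univ_step machine_code) (univ_init machine_code x) = config_code c.
Proof.
elim: s c => [|s IH] c /=; first by case=> <-; exact: univ_initE.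
case E : (iter s (obind _) _) => [c0|//] /= H.
by rewrite (IH _ E); apply: univ_stepE.
Qed.

Lemma univ_haltedE x s (c : tm_config M) :
  iter s (obind (@tm_step M)) (Some (tm_init M [:: nat_word x])) = Some c ->
  univ_halted machine_code x s = ~~ isSome (tm_step c).
Proof.
move=> /univ_iterE; rewrite /univ_halted => ->; rewrite univ_entryE /entry_code /tm_step.
by case: tm_trans => [[]|].
Qed.

(** The part of a tape from the head on grows by at most one cell in a step. *)
Lemma tm_output_size x s (c : tm_config M) (i : 'I_k) :
  iter s (obind (@tm_step M)) (Some (tm_init M [:: nat_word x])) = Some c ->
  size (tape_right (tnth c.2 i)) <= x + s.
Proof.
elim: s c => [|s IH] c /=.
  case=> <-; rewrite tnth_mktuple; case: i => -[|i] Hi /=; last by rewrite nth_nil.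
  by case: x => //= x; rewrite size_map size_nseq; lia.
case E : (iter s (obind _) _) => [c0|//] /=.
move: (IH _ E) => {E} H.
rewrite /tm_step; case: tm_trans => // -[q acts] [<-] /=; rewrite tnth_mktuple.
case: (tnth acts i) => a d /=; move: H; case: (tnth c0.2 i) => l h r /=.
by case: d; [case: l|..|case: r] => //= *; lia.
Qed.
End Simulation.

Lemma leading_word_size E (s : seq (symbol E)) : size (leading_word s) <= size s.
Proof. by elim: s => // -[[b|e]|] s IH. Qed.

(** A machine cannot write a word that is longer than its input and its running time
    together. *)
Lemma computable_halting_time g : computable_nat_fun g ->
  exists n, forall x, exists s, univ_halts_at n x s /\ g x <= x + s + 1.
Proof.
move=> [M HM]; exists (machine_code M) => x.
have [c [[s Hs] Hc] Hout] := HM x.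
have [s0 [Hs0 Hhalt]] : exists s0, s0 <= s /\ univ_halts_at (machine_code M) x s0.
  have Hex : exists s, univ_halted (machine_code M) x s.
    by exists s; rewrite (univ_haltedE Hs) Hc.
  exists (ex_minn Hex); case: ex_minnP => s1 H1 Hmin; split.
    by apply: Hmin; rewrite (univ_haltedE Hs) Hc.
  rewrite /univ_halts_at H1 /=; case: s1 H1 Hmin => //= s1 _ Hmin.
  by apply/negP => /Hmin; rewrite ltnn.
(* The machine makes a step from every configuration before the last one. *)
have Hss0 : s0 = s.
  apply/eqP; rewrite eqn_leq Hs0 leqNgt; apply/negP => Hlt.
  have [c0 [Hc0 Hc0']] : exists c0, iter s0 (obind (@tm_step M))
       (Some (tm_init M [:: nat_word x])) = Some c0 /\ isSome (tm_step c0).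
    have stuck d : iter d (obind (@tm_step M)) None = None by elim: d => //= d ->.
    move: Hs; rewrite -(subnK Hlt) addnS -addSn iterD iterSr.
    case: (iter s0) => [c0|] /=; last by rewrite stuck.
    by case E : (tm_step c0) => [c1|]; [exists c0; rewrite E | rewrite stuck].
  by move: Hhalt; rewrite /univ_halts_at (univ_haltedE Hc0) Hc0'.
exists s; rewrite -{1}Hss0; split => //.
have : size (output_word (nth (input_tape (tm_aux M) [::]) c.2 0)) <= x + s + 1.
  have [H0|H0] := posnP (tm_tapes M).
    by rewrite nth_default // size_tuple H0.
  apply: leq_trans (leading_word_size _) _ => /=.
  have := tm_output_size (Ordinal H0) Hs.
  by rewrite (tnth_nth (input_tape _ [::])) /=; lia.
by move: Hout => [->]; rewrite size_nseq.
Qed.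

Import Order.TTheory GRing.Theory Num.Theory Normc.
Local Notation Re := (@complex.Re _).
Local Notation Im := (@complex.Im _).
Local Open Scope complex_scope.

Ltac prec_tac := repeat (assumption || apply: prec_add || apply: prec_mul ||
  apply: prec_pred || apply: prec_sub || apply: prec_succ).

(** * Computable families of real numbers *)
Section Numbers.
Variable R : rcfType.
Local Open Scope ring_scope.
Implicit Types x y a b : seq nat -> R.

(** Negative numbers are differences of naturals and denominators are successors,
    so that every choice of [p], [q] and [v] is meaningful. *)
Definition rat_prec a := exists p q v, [/\ prec p, prec q, prec v &
  forall e, a e = ((p e)%:R - (q e)%:R) / (v e).+1%:R].

(** The precision is the first entry of the environment of the approximation. *)
Definition rapp x := exists2 a, rat_prec a & forall e N, `|x e - a (N :: e)| <= 2 ^- N.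

Lemma natS_gt0 n : 0 < n.+1%:R :> R.
Proof. exact: ltr0Sn. Qed.

Lemma natS_neq0 n : n.+1%:R != 0 :> R.
Proof. exact: lt0r_neq0 (natS_gt0 n). Qed.

Lemma exp2_gt0 N : 0 < 2 ^- N :> R.
Proof. by rewrite invr_gt0 exprn_gt0. Qed.

Lemma exp2S N : 2 ^- N.+1 = 2 ^- N / 2 :> R.
Proof. by rewrite exprS invfM mulrC. Qed.

Lemma exp2D N M : 2 ^- (N + M) = 2 ^- N * 2 ^- M :> R.
Proof. by rewrite exprD invfM. Qed.

Lemma exp2_le N M : (N <= M)%N -> 2 ^- M <= 2 ^- N :> R.
Proof. by move=> H; rewrite lef_pV2 ?posrE ?exprn_gt0 // ler_weXn2l // ler1n. Qed.

Lemma exp2_le1 N : 2 ^- N <= 1 :> R.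
Proof. by have := exp2_le (leq0n N); rewrite expr0 invr1. Qed.

Lemma ltn_exp2 n : n%:R <= 2 ^+ n :> R.
Proof. by rewrite -natrX ler_nat ltnW // ltn_expl. Qed.

Lemma rat_prec_ext a b : rat_prec a -> a =1 b -> rat_prec b.
Proof. by move=> Ha /funext <-. Qed.

Lemma rat_prec_nat f : prec f -> rat_prec (fun e => (f e)%:R).
Proof.
move=> Hf; exists f, (fun=> 0)%N, (fun=> 0)%N; split=> //; try exact: prec_zero.
by move=> e; rewrite subr0 divr1.
Qed.

Lemma rat_prec_opp a : rat_prec a -> rat_prec (fun e => - a e).
Proof.
move=> [p [q [v [Hp Hq Hv Ha]]]]; exists q, p, v; split=> // e.
by rewrite Ha -mulNr opprB.
Qed.

Lemma rat_prec_add a b : rat_prec a -> rat_prec b -> rat_prec (fun e => a e + b e).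
Proof.
move=> [p [q [v [Hp Hq Hv Ha]]]] [p' [q' [v' [Hp' Hq' Hv' Hb]]]].
exists (fun e => p e * (v' e).+1 + p' e * (v e).+1)%N,
  (fun e => q e * (v' e).+1 + q' e * (v e).+1)%N,
  (fun e => ((v e).+1 * (v' e).+1).-1).
split; [prec_tac..|].
move=> e; rewrite Ha Hb prednK ?muln_gt0 // !natrD !natrM.
move: (natS_neq0 (v e)) (natS_neq0 (v' e)); move: (_.+1%:R) (_.+1%:R) => V V' HV HV'.
by field; rewrite HV HV'.
Qed.

Lemma rat_prec_mul a b : rat_prec a -> rat_prec b -> rat_prec (fun e => a e * b e).
Proof.
move=> [p [q [v [Hp Hq Hv Ha]]]] [p' [q' [v' [Hp' Hq' Hv' Hb]]]].
exists (fun e => p e * p' e + q e * q' e)%N,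
  (fun e => p e * q' e + q e * p' e)%N,
  (fun e => ((v e).+1 * (v' e).+1).-1).
split; [prec_tac..|].
move=> e; rewrite Ha Hb prednK ?muln_gt0 // !natrD !natrM.
move: (natS_neq0 (v e)) (natS_neq0 (v' e)); move: (_.+1%:R) (_.+1%:R) => V V' HV HV'.
by field; rewrite HV HV'.
Qed.

Lemma rat_prec_subst a (r : seq nat -> seq nat) : rat_prec a ->
  (forall i, prec (fun e => nth 0%N (r e) i)) -> rat_prec (fun e => a (r e)).
Proof.
move=> [p [q [v [Hp Hq Hv Ha]]]] Hr.
exists (fun e => p (r e)), (fun e => q (r e)), (fun e => v (r e)).
by split=> [|||e]; [exact: prec_subst..|exact: Ha].
Qed.

Lemma rat_prec_cons f a : prec f -> rat_prec a -> rat_prec (fun e => a (f e :: drop 1 e)).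
Proof.
move=> Hf Ha; apply: (rat_prec_subst (r := fun e => f e :: drop 1 e)) => // -[|i] //=.
exact: (prec_drop 1 (prec_var i)).
Qed.

(** Truncated subtraction of the numerators yields the positive part. *)
Lemma rat_prec_pos a : rat_prec a -> rat_prec (fun e => Num.max (a e) 0).
Proof.
move=> [p [q [v [Hp Hq Hv Ha]]]]; exists (fun e => p e - q e)%N, (fun=> 0)%N, v.
split=> //; [exact: prec_sub | exact: prec_zero |] => e; rewrite Ha subr0.
case: (leqP (q e) (p e)) => H.
  by rewrite natrB // max_l // divr_ge0 // subr_ge0 ler_nat.
rewrite max_r; first by rewrite (eqP (ltnW H : (p e - q e == 0)%N)) mul0r.
by rewrite pmulr_lle0 ?invr_gt0 ?natS_gt0 // subr_le0 ler_nat ltnW.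
Qed.

(** For a positive [a e], truncated subtraction of the numerators is exact, and the
    difference becomes the denominator. *)
Lemma rat_prec_inv a : rat_prec a ->
  exists2 b, rat_prec b & forall e, 0 < a e -> b e = (a e)^-1.
Proof.
move=> [p [q [v [Hp Hq Hv Ha]]]].
exists (fun e => (v e).+1%:R / ((p e - q e).-1).+1%:R).
  exists (fun e => (v e).+1), (fun=> 0)%N, (fun e => (p e - q e).-1)%N.
  split; [exact: prec_succ | exact: prec_zero | exact/prec_pred/prec_sub |].
  by move=> e; rewrite subr0.
move=> e; rewrite Ha pmulr_lgt0 ?invr_gt0 ?natS_gt0 // subr_gt0 ltr_nat => H.
by rewrite prednK ?subn_gt0 // natrB 1?ltnW // invfM invrK mulrC.
Qed.

(** The product of all denominators serves as a common denominator. *)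
Lemma rat_prec_sum n a : prec n -> rat_prec a ->
  rat_prec (fun e => \sum_(i < n e) a ((i : nat) :: e)).
Proof.
move=> Hn [p [q [v [Hp Hq Hv Ha]]]].
pose D e := (\prod_(i < n e) (v ((i : nat) :: e)).+1)%N.
have HD : prec D by exact: prec_prod Hn (prec_succ Hv).
have D0 e : (0 < D e)%N by apply: prodn_gt0.
have sumP f : prec f -> prec (fun e =>
    \sum_(i < n e) f ((i : nat) :: e) * (D e %/ (v ((i : nat) :: e)).+1))%N.
  move=> Hf; have := prec_sum Hn (prec_mul Hf (prec_div (prec_drop 1 HD) (prec_succ Hv))).
  by move/prec_ext; apply => e; apply: eq_bigr => i _; rewrite /= drop0.
exists (fun e => \sum_(i < n e) p ((i : nat) :: e) * (D e %/ (v ((i : nat) :: e)).+1))%N,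
  (fun e => \sum_(i < n e) q ((i : nat) :: e) * (D e %/ (v ((i : nat) :: e)).+1))%N,
  (fun e => (D e).-1).
split; [exact: sumP | exact: sumP | exact: prec_pred |].
move=> e; rewrite prednK // !natr_sum -sumrB mulr_suml; apply: eq_bigr => i _.
rewrite Ha !natrM -mulrBl -mulrA; congr (_ * _).
set w := (v _).+1; have Hw : (w %| D e)%N.
  by rewrite /D (bigD1 i) //= dvdn_mulr.
rewrite -{2}(divnK Hw) natrM invfM mulrA divff ?mul1r //.
by rewrite pnatr_eq0 -lt0n divn_gt0 // dvdn_leq.
Qed.

Lemma sqrt_dist (s t : R) : `|Num.sqrt s - Num.sqrt t| ^+ 2 <= `|s - t|.
Proof.
wlog ts : s t / t <= s.
  move=> H; case: (leP t s) => [|/ltW] /H //.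
  by rewrite [`|s - t|]distrC [X in X ^+ 2]distrC.
have [s0|s0] := leP s 0.
  by rewrite !ler0_sqrtr ?(le_trans ts s0) // subrr normr0 expr0n /= normr_ge0.
rewrite !ger0_norm ?subr_ge0 // ?ler_sqrt //; last exact: ltW.
have [t0|t0] := leP t 0.
  rewrite (ler0_sqrtr t0) subr0 sqr_sqrtr ?(ltW s0) //; lra.
have := sqr_sqrtr (ltW s0); have := sqr_sqrtr (ltW t0).
have := sqrtr_ge0 t; have : Num.sqrt t <= Num.sqrt s by rewrite ler_sqrt // ltW.
by nra.
Qed.

Lemma isqrt_dist n : `|Num.sqrt n%:R - (isqrt n)%:R| <= 1 :> R.
Proof.
have /andP[H1 H2] := isqrt_spec n.
have h1 : (isqrt n)%:R <= Num.sqrt n%:R :> R.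
  by rewrite -(@ler_sqr R) ?nnegrE ?sqrtr_ge0 // sqr_sqrtr // -natrX ler_nat.
have h2 : Num.sqrt n%:R <= (isqrt n).+1%:R :> R.
  by rewrite -(@ler_sqr R) ?nnegrE ?sqrtr_ge0 // sqr_sqrtr // -natrX ler_nat ltnW.
by rewrite ger0_norm ?subr_ge0 //; move: h2; rewrite -natr1; lra.
Qed.

(** Integer square roots of [(p - q) (v + 1) 4 ^ N], divided by [(v + 1) 2 ^ N]. *)
Lemma rat_prec_sqrt a : rat_prec a -> rapp (fun e => Num.sqrt (a e)).
Proof.
move=> Ha'; have [p [q [v [Hp Hq Hv Ha]]]] := Ha'.
pose n e := ((p e - q e) * (v e).+1)%N.
exists (fun e => (isqrt (n (drop 1 e) * 4 ^ nth 0 e 0))%:R /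
    (((v (drop 1 e)).+1 * 2 ^ nth 0 e 0).-1).+1%:R).
  have Hn : prec n by exact: prec_mul (prec_sub Hp Hq) (prec_succ Hv).
  exists (fun e => isqrt (n (drop 1 e) * 4 ^ nth 0 e 0))%N, (fun=> 0)%N,
    (fun e => ((v (drop 1 e)).+1 * 2 ^ nth 0 e 0).-1)%N; split.
  - apply/prec_isqrt/prec_mul; first exact: prec_drop.
    exact: (prec_pow (prec_const 4) (prec_var 0)).
  - exact: prec_zero.
  - apply/prec_pred/prec_mul; first exact/prec_succ/prec_drop.
    exact: (prec_pow (prec_const 2) (prec_var 0)).
  - by move=> e; rewrite subr0.
move=> e N; rewrite /= drop0 prednK ?muln_gt0 ?expn_gt0 // natrM natrX.
move E : ((v e).+1%:R : R) => V; have V0 : 0 < V by rewrite -E natS_gt0.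
have V1 : 1 <= V by rewrite -E ler1n.
have P0 : 0 < 2 ^+ N :> R by rewrite exprn_gt0.
have -> : Num.sqrt (a e) = Num.sqrt ((n e * 4 ^ N)%N%:R) / (V * 2 ^+ N).
  have -> : Num.sqrt (a e) = Num.sqrt (Num.max (a e) 0).
    by case: (leP 0 (a e)) => // /ltW H; rewrite !ler0_sqrtr.
  have -> : Num.max (a e) 0 = (n e * 4 ^ N)%N%:R / (V * 2 ^+ N) ^+ 2.
    rewrite Ha /n; case: (leqP (q e) (p e)) => H.
      rewrite max_l ?divr_ge0 // ?subr_ge0 ?ler_nat // !natrM natrB // natrX.
      rewrite E (_ : 4%:R = 2 ^+ 2 :> R); last by rewrite -natrX.
      rewrite -exprM mulnC exprM; move: (2 ^+ N) (lt0r_neq0 P0) => P HP.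
      by field; rewrite HP lt0r_neq0.
    rewrite (eqP (ltnW H : (p e - q e == 0)%N)) !mul0n mul0r max_r //.
    by rewrite pmulr_lle0 ?invr_gt0 // subr_le0 ler_nat ltnW.
  rewrite sqrtrM // sqrtrV ?exprn_ge0 ?mulr_ge0 ?ltW //.
  by rewrite sqrtr_sqr ger0_norm // mulr_ge0 // ltW.
rewrite -mulrBl normrM [`|_^-1|]ger0_norm ?invr_ge0 ?mulr_ge0 ?(ltW V0) ?(ltW P0) //.
rewrite invfM mulrA ler_piMl ?invr_ge0 ?(ltW P0) // ler_pdivrMr // mul1r.
exact: le_trans (isqrt_dist _) V1.
Qed.

Lemma rapp_ext x y : rapp x -> x =1 y -> rapp y.
Proof. by move=> Hx /funext <-. Qed.

Lemma rapp_rat a : rat_prec a -> rapp a.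
Proof.
move=> Ha; exists (fun e => a (drop 1 e)).
  apply: rat_prec_subst => // i; exact: (prec_drop 1 (prec_var i)).
by move=> e N; rewrite /= drop0 subrr normr0 ltW ?exp2_gt0.
Qed.

Lemma rapp_subst x (r : seq nat -> seq nat) : rapp x ->
  (forall i, prec (fun e => nth 0%N (r e) i)) -> rapp (fun e => x (r e)).
Proof.
move=> [a Ha Hx] Hr; exists (fun e => a (nth 0%N e 0 :: r (drop 1 e))).
  apply: (rat_prec_subst (r := fun e => nth 0%N e 0 :: r (drop 1 e))) => // -[|i] /=.
    exact: prec_var.
  exact: (prec_drop 1 (Hr i)).
by move=> e N; rewrite /= drop0.
Qed.

Lemma rapp_precision f x : prec f -> rapp x ->
  exists2 a, rat_prec a & forall e N, `|x e - a (N :: e)| <= 2 ^- f (N :: e).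
Proof.
move=> Hf [a Ha Hx]; exists (fun e => a (f e :: drop 1 e)); first exact: rat_prec_cons.
by move=> e N; rewrite /= drop0; apply: Hx.
Qed.

Lemma rapp_opp x : rapp x -> rapp (fun e => - x e).
Proof.
move=> [a Ha Hx]; exists (fun e => - a e); first exact: rat_prec_opp.
by move=> e N; rewrite -opprD normrN.
Qed.

Lemma rapp_add x y : rapp x -> rapp y -> rapp (fun e => x e + y e).
Proof.
move=> /(rapp_precision (prec_succ (prec_var 0))) [a Ha Hx].
move=> /(rapp_precision (prec_succ (prec_var 0))) [b Hb Hy].
exists (fun e => a e + b e); first exact: rat_prec_add.
move=> e N; have /= := Hx e N; have /= := Hy e N; rewrite exp2S => H1 H2.
by rewrite opprD addrACA (le_trans (ler_normD _ _)) //; lra.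
Qed.

Lemma rapp_sub x y : rapp x -> rapp y -> rapp (fun e => x e - y e).
Proof. by move=> Hx /rapp_opp; apply: rapp_add. Qed.

(** A bound on the factors tells how much precision the product loses; the bound
    itself may depend on the environment. *)
Lemma rapp_mul B x y : prec B -> (forall e, `|x e| <= (B e)%:R) ->
  (forall e, `|y e| <= (B e)%:R) -> rapp x -> rapp y -> rapp (fun e => x e * y e).
Proof.
move=> HB Bx By.
(* [2 B + 1] extra digits absorb the factor [2 B + 1 <= 2 ^ (2 B + 1)] of the error. *)
have HN : prec (fun e => nth 0 e 0 + (B (drop 1 e) + (B (drop 1 e)).+1))%N.
  have := prec_drop 1 HB; move=> ?; apply: prec_add (prec_var 0) _.
  by apply: prec_add => //; apply: prec_succ.
move=> /(rapp_precision HN) [a Ha Hx] /(rapp_precision HN) [b Hb Hy].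
exists (fun e => a e * b e); first exact: rat_prec_mul.
move=> e N; have /= := Hx e N; have /= := Hy e N; rewrite drop0 exp2D.
have := Bx e; have := By e; move: (x e) (y e) (a _) (b _) => X Y A B'.
set d := 2 ^- N; set c := 2 ^- _; set K := (B e)%:R => hY hX H1 H2.
have c0 : 0 < c by exact: exp2_gt0.
have d0 : 0 < d by exact: exp2_gt0.
have d1 : d <= 1 := exp2_le1 N.
have cK : (K + K + 1) * c <= 1.
  rewrite /c ler_pdivrMr ?exprn_gt0 // mul1r (le_trans _ (ltn_exp2 _)) //.
  by rewrite natrD -natr1 addrA.
have K0 : 0 <= K by rewrite ler0n.
have -> : X * Y - A * B' = X * (Y - B') + (X - A) * (Y - (Y - B')) by ring.
have h3 : `|Y - (Y - B')| <= K + 1.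
  rewrite (le_trans (ler_normB _ _)) // lerD // (le_trans H1) //.
  have : c <= 1 by nra.
  by nra.
rewrite (le_trans (ler_normD _ _)) // !normrM.
have h4 : `|X| * `|Y - B'| <= K * (d * c) by rewrite ler_pM.
have h5 : `|X - A| * `|Y - (Y - B')| <= (d * c) * (K + 1) by rewrite ler_pM.
by nra.
Qed.

Lemma rapp_sqrt x : rapp x -> rapp (fun e => Num.sqrt (x e)).
Proof.
(* By [sqrt_dist], square roots halve the number of correct digits. *)
have H2 : prec (fun e => nth 0 e 0 + nth 0 e 0 + 2)%N.
  by apply: prec_add (prec_const 2); apply: prec_add; apply: prec_var.
move=> /(rapp_precision H2) [a Ha Hx].
have [b Hb Hab] := rat_prec_sqrt Ha.
exists (fun e => b ((nth 0 e 0)%N.+1 :: e)).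
  apply: (rat_prec_subst (r := fun e => (nth 0 e 0)%N.+1 :: e)) => // -[|i] /=.
    exact: (prec_succ (prec_var 0)).
  exact: prec_var.
move=> e N; have /= := Hx e N; have /= := Hab (N :: e) N.+1.
have := sqrt_dist (x e) (a (N :: e)); rewrite (exp2S N).
have -> : 2 ^- (N + N + 2) = 2 ^- N * 2 ^- N / 4 :> R.
  by rewrite !exp2D; congr (_ * _^-1); rewrite expr2; ring.
have d0 := exp2_gt0 N; move: (2 ^- N) d0 => d d0.
set s := `|_ - _|; have s0 : 0 <= s by exact: normr_ge0.
move=> h1 h2 h3; have h4 : s <= d / 2.
  have hd : 0 <= d / 2 by lra.
  rewrite -(@ler_sqr R) ?nnegrE // (le_trans h1) // (le_trans h3) //.
  by have -> : (d / 2) ^+ 2 = d * d / 4 by field.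
rewrite (le_trans (ler_distD (Num.sqrt (a (N :: e))) _ _)) // -/s.
by move: h2 h4; lra.
Qed.

(** A positive lower bound is needed in advance, as no test decides whether the value
    is zero. *)
Lemma rapp_inv K x : (forall e, 2 ^- K <= x e) -> rapp x -> rapp (fun e => (x e)^-1).
Proof.
move=> HK.
have HN : prec (fun e => nth 0 e 0 + (K + K.+1))%N.
  exact: (prec_add (prec_var 0) (prec_const _)).
move=> /(rapp_precision HN) [a Ha Hx].
have [b Hb Hab] := rat_prec_inv Ha; exists b => // e N.
have /= := Hx e N; have := HK e; move: (x e) (Hab (N :: e)) => X; move: (a _) => A HA.
rewrite !exp2D exp2S; have k0 := exp2_gt0 K; have d0 := exp2_gt0 N.
have d1 := exp2_le1 N.
have k1 := exp2_le1 K.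
move: (2 ^- N) (2 ^- K) d0 k0 d1 k1 => d k d0 k0 d1 k1 HX h.
have hA : k / 2 <= A.
  have : d * (k * (k / 2)) <= k / 2 by nra.
  by have := ler_norm (X - A); lra.
have A0 : 0 < A by lra.
have X0 : 0 < X by lra.
rewrite HA // -[d]mulr1 -ler_pdivrMl //.
have -> : X^-1 - A^-1 = (A - X) / (X * A) by field; rewrite !lt0r_neq0.
rewrite normrM normfV [`|X * A|]ger0_norm; last by rewrite mulr_ge0 ?ltW.
rewrite mulrA ler_pdivrMr ?mulr_gt0 // mul1r ler_pdivrMl // distrC (le_trans h) //.
by rewrite ler_pM2l // ler_pM //; lra.
Qed.

Lemma rapp_sum n x : prec n -> rapp x -> rapp (fun e => \sum_(i < n e) x ((i : nat) :: e)).
Proof.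
move=> Hn Hx'.
have := Hx' => -[a Ha Hx].
exists (fun e => \sum_(i < n (drop 1 e)) a ((nth 0 e 0 + n (drop 1 e))%N :: (i : nat) :: drop 1 e)).
  have Ha' : rat_prec (fun e => a ((nth 0 e 1 + n (drop 2 e))%N :: nth 0%N e 0 :: drop 2 e)).
    apply: (rat_prec_subst (r := fun e => (nth 0 e 1 + n (drop 2 e))%N :: nth 0%N e 0 :: drop 2 e))
      => // -[|[|i]] /=.
    - exact: (prec_add (prec_var 1) (prec_drop 2 Hn)).
    - exact: prec_var.
    - exact: (prec_drop 2 (prec_var i)).
  have := rat_prec_sum (prec_drop 1 Hn) Ha'.
  by move/rat_prec_ext; apply.
move=> e N; rewrite /= drop0 -sumrB (le_trans (ler_norm_sum _ _ _)) //.
apply: (@le_trans _ _ (\sum_(i < n e) 2 ^- (N + n e))).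
  by apply: ler_sum => i _; apply: Hx.
rewrite sumr_const card_ord exp2D -[_ *+ n e]mulr_natr -mulrA ler_piMr ?(ltW (exp2_gt0 _)) //.
by rewrite ler_pdivrMl ?exprn_gt0 // mulr1 ltn_exp2.
Qed.

Lemma rapp_lim x y : rapp y -> (forall e N, `|x e - y (N :: e)| <= 2 ^- N) -> rapp x.
Proof.
move=> [a Ha Hy] Hx; exists (fun e => a ((nth 0 e 0)%N.+1 :: (nth 0 e 0)%N.+1 :: drop 1 e)).
  apply: (rat_prec_subst (r := fun e => (nth 0 e 0)%N.+1 :: (nth 0 e 0)%N.+1 :: drop 1 e))
    => // -[|[|i]] /=; [exact: (prec_succ (prec_var 0)).. | exact: (prec_drop 1 (prec_var i))].
move=> e N; rewrite /= drop0; have := Hy (N.+1 :: e) N.+1; have := Hx e N.+1.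
by rewrite exp2S; have := ler_distD (y (N.+1 :: e)) (x e) (a (N.+1 :: N.+1 :: e)); lra.
Qed.

End Numbers.

(** * Square roots in the upper half plane *)

Section ComplexPlane.
Variable R : rcfType.
Local Open Scope ring_scope.
Local Notation C := R[i].
Implicit Types z w s t : C.

Lemma sqrnorm (x : R) : `|x| ^+ 2 = x ^+ 2.
Proof. exact: real_normK (num_real x). Qed.

Lemma normc_ge0 z : 0 <= normc z.
Proof. by case: z => a b; apply: sqrtr_ge0. Qed.

Lemma normc_sqr z : normc z ^+ 2 = Re z ^+ 2 + Im z ^+ 2.
Proof. by case: z => a b; rewrite /= sqr_sqrtr // addr_ge0 ?sqr_ge0. Qed.

Lemma normrc z : `|z| = (normc z)%:C.
Proof. by []. Qed.

Lemma normc_eq0 z : (normc z == 0) = (z == 0).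
Proof. by apply/eqP/eqP => [/eq0_normc|->]; rewrite ?normc0. Qed.

Lemma normc_gt0 z : (0 < normc z) = (z != 0).
Proof. by rewrite lt0r normc_eq0 normc_ge0 andbT. Qed.

Lemma normcD z w : normc (z + w) <= normc z + normc w.
Proof. exact: le_normcD. Qed.

Lemma normc_opp z : normc (- z) = normc z.
Proof. exact: normcN. Qed.

Lemma normc_dist z w : normc (z - w) = normc (w - z).
Proof. by rewrite -normc_opp opprB. Qed.

Lemma normcX z n : normc (z ^+ n) = normc z ^+ n.
Proof. by elim: n => [|n IH]; rewrite ?normc1 // !exprS normcM IH. Qed.

Lemma normc_le z (c : R) : 0 <= c -> (normc z <= c) = (Re z ^+ 2 + Im z ^+ 2 <= c ^+ 2).
Proof. by move=> c0; rewrite -normc_sqr ler_sqr // nnegrE normc_ge0. Qed.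

Lemma abs_Re_le z : `|Re z| <= normc z.
Proof.
by rewrite -(@ler_sqr R) ?nnegrE ?normc_ge0 // sqrnorm normc_sqr lerDl sqr_ge0.
Qed.

Lemma abs_Im_le z : `|Im z| <= normc z.
Proof.
by rewrite -(@ler_sqr R) ?nnegrE ?normc_ge0 // sqrnorm normc_sqr lerDr sqr_ge0.
Qed.

Lemma normc_le_ReIm z : normc z <= `|Re z| + `|Im z|.
Proof.
rewrite normc_le ?addr_ge0 // sqrrD !sqrnorm.
by have : 0 <= `|Re z| * `|Im z| by [rewrite mulr_ge0]; lra.
Qed.

Lemma RecB z w : Re (z - w) = Re z - Re w. Proof. by case: z w => ? ? []. Qed.
Lemma ImcB z w : Im (z - w) = Im z - Im w. Proof. by case: z w => ? ? []. Qed.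
Lemma RecD z w : Re (z + w) = Re z + Re w. Proof. by case: z w => ? ? []. Qed.
Lemma ImcD z w : Im (z + w) = Im z + Im w. Proof. by case: z w => ? ? []. Qed.
Lemma RecM z w : Re (z * w) = Re z * Re w - Im z * Im w. Proof. by case: z w => ? ? []. Qed.
Lemma ImcM z w : Im (z * w) = Re z * Im w + Im z * Re w. Proof. by case: z w => ? ? []. Qed.
Lemma complex_ext z w : Re z = Re w -> Im z = Im w -> z = w.
Proof. by case: z w => ? ? [? ?] /= -> ->. Qed.
Lemma Re_mulr (c : R) z : Re (c%:C * z) = c * Re z.
Proof. by rewrite RecM /= mul0r subr0. Qed.
Lemma Im_mulr (c : R) z : Im (c%:C * z) = c * Im z.
Proof. by rewrite ImcM /= mul0r addr0. Qed.
Lemma normcR (c : R) : normc c%:C = `|c|.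
Proof. by rewrite /= expr0n addr0 sqrtr_sqr. Qed.
Lemma normc_i : normc ('i%C : C) = 1.
Proof. by rewrite /= expr0n expr1n add0r sqrtr1. Qed.

(** The square root of the closed upper half plane with values in the closed first
    quadrant. *)
Definition rt z : C :=
  Num.sqrt ((normc z + Re z) / 2) +i* Num.sqrt ((normc z - Re z) / 2).

Lemma rt_Re z : 0 <= Re (rt z). Proof. exact: sqrtr_ge0. Qed.
Lemma rt_Im z : 0 <= Im (rt z). Proof. exact: sqrtr_ge0. Qed.

Lemma Re_rt_sqr z : Re (rt z) ^+ 2 = (normc z + Re z) / 2.
Proof.
rewrite [Re _]/= sqr_sqrtr // divr_ge0 //.
by have := abs_Re_le z; rewrite ler_norml => /andP[]; lra.
Qed.

Lemma Im_rt_sqr z : Im (rt z) ^+ 2 = (normc z - Re z) / 2.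
Proof.
rewrite [Im _]/= sqr_sqrtr // divr_ge0 //.
by have := abs_Re_le z; rewrite ler_norml => /andP[]; lra.
Qed.

Lemma rt_norm z : normc (rt z) ^+ 2 = normc z.
Proof. by rewrite normc_sqr Re_rt_sqr Im_rt_sqr; field. Qed.

Lemma rt_sqr z : 0 <= Im z -> rt z ^+ 2 = z.
Proof.
move=> Hz; apply: complex_ext; rewrite expr2 ?RecM ?ImcM -?expr2.
  by rewrite Re_rt_sqr Im_rt_sqr; field.
have H : (Re (rt z) * Im (rt z)) ^+ 2 = (Im z / 2) ^+ 2.
  have := normc_sqr z; rewrite exprMn Re_rt_sqr Im_rt_sqr => H.
  have -> : (normc z + Re z) / 2 * ((normc z - Re z) / 2) = (normc z ^+ 2 - Re z ^+ 2) / 4.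
    by field.
  by rewrite H; field.
have := rt_Re z; have := rt_Im z; move: (Re (rt z)) (Im (rt z)) H => a b H b0 a0.
have ab0 : 0 <= a * b by rewrite mulr_ge0.
have z20 : 0 <= Im z / 2 by rewrite divr_ge0.
have E : a * b = Im z / 2 by apply/eqP; rewrite -(@eqrXn2 R 2) //; apply/eqP.
by rewrite [b * a]mulrC E; field.
Qed.

Lemma quadrant_sqr_inj s t : 0 <= Re s -> 0 <= Im s -> 0 <= Re t -> 0 <= Im t ->
  s ^+ 2 = t ^+ 2 -> s = t.
Proof.
move=> s1 s2 t1 t2 /eqP; rewrite eqf_sqr => /orP[/eqP //|/eqP E].
move: s1 s2; rewrite E; case: t t1 t2 {E} => c d /= c0 d0 c1 d1.
by apply: complex_ext => /=; lra.
Qed.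

Lemma rt_unique s : 0 <= Re s -> 0 <= Im s -> rt (s ^+ 2) = s.
Proof.
move=> s1 s2; apply: quadrant_sqr_inj => //; try exact: rt_Re; try exact: rt_Im.
by apply: rt_sqr; rewrite expr2 ImcM; nra.
Qed.

(** The product of [s] and the conjugate of [t] has a nonnegative real part. *)
Lemma quadrant_dist s t : 0 <= Re s -> 0 <= Im s -> 0 <= Re t -> 0 <= Im t ->
  normc (s - t) <= normc (s + t).
Proof.
move=> s1 s2 t1 t2; rewrite normc_le ?normc_ge0 // normc_sqr.
by rewrite RecB ImcB RecD ImcD; nra.
Qed.

(** [z - w] is [(rt z - rt w) (rt z + rt w)], and the first factor is the smaller
    one. *)
Lemma rt_dist z w : 0 <= Im z -> 0 <= Im w ->
  normc (rt z - rt w) ^+ 2 <= normc (z - w).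
Proof.
move=> Hz Hw; rewrite -{2}(rt_sqr Hz) -{2}(rt_sqr Hw) subr_sqr normcM expr2.
rewrite ler_wpM2l ?normc_ge0 //; apply: quadrant_dist; try exact: rt_Re; exact: rt_Im.
Qed.

(** In terms of [s + t] and [s - t], the cube difference is [s - t] times
    [3 / 4 (s + t) ^ 2 + 1 / 4 (s - t) ^ 2]: cubes of [rt] are locally Lipschitz, which
    [rt] itself is not. *)
Lemma rt_cube_dist z w : 0 <= Im z -> 0 <= Im w ->
  normc (rt z ^+ 3 - rt w ^+ 3) <= 2 * normc (z - w) * normc (rt z + rt w).
Proof.
move=> Hz Hw.
have Hd : normc (rt z - rt w) <= normc (rt z + rt w).
  by apply: quadrant_dist; try exact: rt_Re; exact: rt_Im.
have Ezw : normc (z - w) = normc (rt z - rt w) * normc (rt z + rt w).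
  by rewrite -normcM -subr_sqr !rt_sqr.
rewrite Ezw; move: (rt z) (rt w) Hd => s t Hd.
have -> : s ^+ 3 - t ^+ 3 = (s - t) * ((3 / 4) * (s + t) ^+ 2 + (1 / 4) * (s - t) ^+ 2).
  by field.
rewrite normcM.
have -> : 2 * (normc (s - t) * normc (s + t)) * normc (s + t) =
    normc (s - t) * (2 * normc (s + t) ^+ 2) by ring.
rewrite ler_wpM2l ?normc_ge0 // (le_trans (normcD _ _)) // (normcM (3 / 4)) (normcM (1 / 4)) !normcX.
have quarters n : normc (n%:R / 4 : C) = n%:R / 4.
  have -> : n%:R / 4 = (n%:R / 4 : R)%:C :> C by rewrite rmorphM fmorphV !rmorph_nat.
  by rewrite normcR ger0_norm // divr_ge0.
rewrite (quarters 3) (quarters 1).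
by have := normc_ge0 (s + t); have := normc_ge0 (s - t); nra.
Qed.

(** * A conformal map onto the half disk *)

(** The square of [q = om * Troot z / Sroot z] is [i (1 - z) / (1 + z)], which
    maps the disk onto the upper half plane.  So [q] maps the disk onto the first
    quadrant, and [Mhd z = (q - 1) / (q + 1)] maps it onto the upper half disk.  After
    clearing the denominator of [q], the fraction makes sense on the whole closed
    disk. *)
Definition om : C := rt 'i%C.
Definition Sroot z := rt ('i%C * (1 + z)).
Definition Troot z := rt ('i%C * (1 - z)).
Definition Mden z := om * Troot z + Sroot z.
Definition Mhd := locked (fun z => (om * Troot z - Sroot z) / Mden z).

Lemma MhdE z : Mhd z = (om * Troot z - Sroot z) / Mden z.
Proof. by rewrite /Mhd -lock. Qed.

Lemma om_sqr : om ^+ 2 = 'i%C.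
Proof. by rewrite rt_sqr //= ler01. Qed.

Lemma om_norm : normc om = 1.
Proof.
have : normc om ^+ 2 = 1 by rewrite rt_norm normc_i.
by have := normc_ge0 om => h0 h; apply/eqP; rewrite -(@eqrXn2 R 2) ?h ?expr1n.
Qed.

Lemma om_ReIm : Re om = Im om /\ 0 < Re om.
Proof.
have := om_sqr; have := rt_Re ('i%C : C); have := rt_Im ('i%C : C); rewrite -/om.
case: om => a b /= b0 a0; rewrite expr2 => -[] h1 h2.
have /eqP : (a - b) * (a + b) = 0 by rewrite -h1; ring.
rewrite mulf_eq0 => /orP[|] /eqP h; split; nra.
Qed.

Lemma SR_arg z : normc z <= 1 -> 0 <= Im ('i%C * (1 + z)) /\ 0 <= Im ('i%C * (1 - z)).
Proof.
move=> /(le_trans (abs_Re_le z)); rewrite ler_norml => /andP[].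
by case: z => x y /=; split; lra.
Qed.

Lemma ST_coord z : normc z <= 1 -> exists a b c d,
  [/\ Sroot z = a +i* b, Troot z = c +i* d, [/\ 0 <= a, 0 <= b, 0 <= c & 0 <= d],
   a ^+ 2 - b ^+ 2 = - Im z /\ 2 * a * b = 1 + Re z &
   c ^+ 2 - d ^+ 2 = Im z /\ 2 * c * d = 1 - Re z].
Proof.
move=> /SR_arg [/rt_sqr HS /rt_sqr HT]; move: HS HT; rewrite -/(Sroot z) -/(Troot z).
have := rt_Re ('i%C * (1 + z)); have := rt_Im ('i%C * (1 + z)).
have := rt_Re ('i%C * (1 - z)); have := rt_Im ('i%C * (1 - z)).
rewrite -/(Sroot z) -/(Troot z).
case: (Sroot z) (Troot z) => a b [c d] /= d0 c0 b0 a0 hS hT; exists a, b, c, d; split=> //.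
- by move: (congr1 Re hS) (congr1 Im hS); rewrite expr2 !RecM !ImcM RecD ImcD /= => *; split; lra.
- by move: (congr1 Re hT) (congr1 Im hT); rewrite expr2 !RecM !ImcM RecB ImcB /= => *; split; lra.
Qed.

(** Write [(a - i b) (c + i d) = P - i Q].  Up to positive factors, [P - Q] is the
    imaginary part of [Mhd z], and [P + Q] is the mixed term in the square of the modulus
    of its denominator.  Both are nonnegative because their product is [1 - |z| ^ 2] and
    their sum is [2 P]. *)
Lemma ST_quadrant (x y a b c d : R) : x ^+ 2 + y ^+ 2 <= 1 ->
  [/\ 0 <= a, 0 <= b, 0 <= c & 0 <= d] ->
  a ^+ 2 - b ^+ 2 = - y /\ 2 * a * b = 1 + x ->
  c ^+ 2 - d ^+ 2 = y /\ 2 * c * d = 1 - x ->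
  [/\ 0 <= (a * c + b * d) - (b * c - a * d),
      0 <= (a * c + b * d) + (b * c - a * d)
    & x ^+ 2 + y ^+ 2 < 1 -> 0 < (a * c + b * d) - (b * c - a * d) /\
                             0 < (a * c + b * d) + (b * c - a * d)].
Proof.
move=> xy [a0 b0 c0 d0] [h1 h2] [h3 h4].
have hp : ((a * c + b * d) - (b * c - a * d)) * ((a * c + b * d) + (b * c - a * d)) =
    1 - (x ^+ 2 + y ^+ 2).
  have -> : 1 - (x ^+ 2 + y ^+ 2) = (1 + x) * (1 - x) - y * y by ring.
  have -> : y * y = - ((a ^+ 2 - b ^+ 2) * (c ^+ 2 - d ^+ 2)) by rewrite h1 h3; ring.
  by rewrite -h2 -h4; ring.
have hs : 0 <= a * c + b * d by rewrite addr_ge0 ?mulr_ge0.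
move: (a * c + b * d) (b * c - a * d) hp hs => P Q hp hs.
have h5 : 0 <= P - Q.
  by rewrite leNgt; apply/negP => h; nra.
have h6 : 0 <= P + Q.
  by rewrite leNgt; apply/negP => h; nra.
split=> // hlt; rewrite !lt_neqAle h5 h6 !andbT.
by split; rewrite eq_sym; apply/eqP => h; move: hp; rewrite h; lra.
Qed.

Lemma om_coord : exists2 u : R, 0 < u /\ 2 * u ^+ 2 = 1 & om = u +i* u.
Proof.
have [E u0] := om_ReIm; exists (Re om); last by move: E; case: om => u v /= <-.
split=> //; have : normc om ^+ 2 = 1 by rewrite om_norm expr1n.
by rewrite normc_sqr -E => h; lra.
Qed.

Lemma disk_coord z : normc z <= 1 -> Re z ^+ 2 + Im z ^+ 2 <= 1.
Proof. by rewrite normc_le ?ler01 // expr1n. Qed.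

Lemma Mden_norm z : normc z <= 1 -> 2 <= normc (Mden z) ^+ 2.
Proof.
move=> Hz; have [a [b [c [d [ES ET h0 h1 h2]]]]] := ST_coord Hz.
have [_ hQ _] := ST_quadrant (disk_coord Hz) h0 h1 h2.
rewrite /Mden ES ET normc_sqr; have [u [u0 hu] ->] := om_coord.
have -> : Re ((u +i* u) * (c +i* d) + (a +i* b)) ^+ 2 +
    Im ((u +i* u) * (c +i* d) + (a +i* b)) ^+ 2 =
  2 * u ^+ 2 * (c ^+ 2 + d ^+ 2) + (a ^+ 2 + b ^+ 2) +
  2 * (u * (a * c + b * d + (b * c - a * d))) by rewrite /=; ring.
have := mulr_ge0 (ltW u0) hQ; rewrite hu mul1r.
have := sqr_ge0 (a - b); have := sqr_ge0 (c - d); rewrite !sqrrB.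
by case: h1 h2 => _ h1 [_ h2]; lra.
Qed.

Lemma Mden_neq0 z : normc z <= 1 -> Mden z != 0.
Proof.
move=> /Mden_norm H; apply: contraTneq H => ->.
by rewrite normc0 expr0n /= -ltNge ltr0n.
Qed.

Lemma Im_div s t : Im (s / t) = (Im s * Re t - Re s * Im t) / normc t ^+ 2.
Proof. by rewrite normc_sqr; case: s t => a b [c d] /=; ring. Qed.

Lemma Mhd_Im_coord z : normc z <= 1 -> exists2 p : R,
  Im (Mhd z) = p / normc (Mden z) ^+ 2 & 0 <= p /\ (normc z < 1 -> 0 < p).
Proof.
move=> Hz; have [a [b [c [d [ES ET h0 h1 h2]]]]] := ST_coord Hz.
have [hP _ hP'] := ST_quadrant (disk_coord Hz) h0 h1 h2.
have [u [u0 hu] Eom] := om_coord.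
exists (2 * (u * (a * c + b * d - (b * c - a * d)))).
  rewrite MhdE Im_div; congr (_ / _); rewrite /Mden ES ET Eom /=; ring.
split; first by rewrite mulr_ge0 // mulr_ge0 // ltW.
move=> Hz1; rewrite mulr_gt0 // mulr_gt0 //.
by have [] := hP'; rewrite // -normc_sqr expr_lt1 // normc_ge0.
Qed.

Lemma Mhd_Im_ge0 z : normc z <= 1 -> 0 <= Im (Mhd z).
Proof.
by move=> /Mhd_Im_coord [p -> [p0 _]]; rewrite divr_ge0 // exprn_ge0 // normc_ge0.
Qed.

Lemma Mhd_Im_gt0 z : normc z < 1 -> 0 < Im (Mhd z).
Proof.
move=> Hz; have [p -> [_ /(_ Hz) p0]] := Mhd_Im_coord (ltW Hz).
by rewrite divr_gt0 // exprn_gt0 // normc_gt0 Mden_neq0 // ltW.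
Qed.

Lemma Mhd_norm z : normc z <= 1 -> normc (Mhd z) <= 1.
Proof.
move=> Hz; have [a [b [c [d [ES ET h0 h1 h2]]]]] := ST_coord Hz.
have [_ hQ _] := ST_quadrant (disk_coord Hz) h0 h1 h2.
have D0 : 0 < normc (Mden z) by rewrite normc_gt0 Mden_neq0.
rewrite MhdE normcM normcV ler_pdivrMr // mul1r -(@ler_sqr R) ?nnegrE ?normc_ge0 //.
rewrite !normc_sqr /Mden ES ET; have [u [u0 hu] ->] := om_coord.
have := mulr_ge0 (ltW u0) hQ => /=; nra.
Qed.

Lemma Mhd_norm_lt z : normc z < 1 -> normc (Mhd z) < 1.
Proof.
move=> Hz; have [a [b [c [d [ES ET h0 h1 h2]]]]] := ST_coord (ltW Hz).
have [_ _ hQ'] := ST_quadrant (disk_coord (ltW Hz)) h0 h1 h2.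
have {hQ'} [|_ hQ] := hQ'; first by rewrite -normc_sqr expr_lt1 // normc_ge0.
have D0 : 0 < normc (Mden z) by rewrite normc_gt0 Mden_neq0 // ltW.
rewrite MhdE normcM normcV ltr_pdivrMr // mul1r -(@ltr_sqr R) ?nnegrE ?normc_ge0 //.
rewrite !normc_sqr /Mden ES ET; have [u [u0 hu] ->] := om_coord.
have := mulr_gt0 u0 hQ => /=; nra.
Qed.

(** The square of the relation [(1 + Mhd z) / (1 - Mhd z) = om * Troot z / Sroot z]; it is
    linear in [z]. *)
Lemma Mhd_inv z : normc z <= 1 ->
  (1 + z) * (1 + Mhd z) ^+ 2 = 'i%C * (1 - z) * (1 - Mhd z) ^+ 2.
Proof.
move=> Hz; have D0 := Mden_neq0 Hz.
have -> : 1 + Mhd z = 2 * om * Troot z / Mden z.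
  by rewrite MhdE; move: D0; rewrite /Mden => D0; field.
have -> : 1 - Mhd z = 2 * Sroot z / Mden z.
  by rewrite MhdE; move: D0; rewrite /Mden => D0; field.
have [/rt_sqr HS /rt_sqr HT] := SR_arg Hz.
have -> : (2 * om * Troot z / Mden z) ^+ 2 = 4 * om ^+ 2 * Troot z ^+ 2 / Mden z ^+ 2 by field.
have -> : (2 * Sroot z / Mden z) ^+ 2 = 4 * Sroot z ^+ 2 / Mden z ^+ 2 by field.
rewrite HS HT om_sqr; field; exact: D0.
Qed.

Lemma Mhd_inj z w : normc z <= 1 -> normc w <= 1 -> Mhd z = Mhd w -> z = w.
Proof.
move=> /Mhd_inv Hz /Mhd_inv Hw E; move: Hz; rewrite E.
move: Hw; move: (Mhd w) => m Hw Hz.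
have H0 : (z - w) * ((1 + m) ^+ 2 + 'i%C * (1 - m) ^+ 2) = 0.
  have -> : (z - w) * ((1 + m) ^+ 2 + 'i%C * (1 - m) ^+ 2) =
    ((1 + z) * (1 + m) ^+ 2 - 'i%C * (1 - z) * (1 - m) ^+ 2) -
    ((1 + w) * (1 + m) ^+ 2 - 'i%C * (1 - w) * (1 - m) ^+ 2) by ring.
  by rewrite Hz Hw !subrr.
move/eqP: H0; rewrite mulf_eq0 subr_eq0 => /orP[/eqP //|/eqP H0].
have H1 : (1 + m) ^+ 2 = 0.
  have : 2 * (1 + m) ^+ 2 = ((1 + w) * (1 + m) ^+ 2 - 'i%C * (1 - w) * (1 - m) ^+ 2) +
     (1 - w) * ((1 + m) ^+ 2 + 'i%C * (1 - m) ^+ 2) by ring.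
  rewrite Hw H0 subrr mulr0 addr0 => /eqP; rewrite mulf_eq0 pnatr_eq0 /= => /eqP //.
have m1 : m = -1.
  by move/eqP: H1; rewrite expf_eq0 /= addrC addr_eq0 => /eqP.
move/eqP: H0; rewrite m1 subrr expr0n add0r mulf_eq0 expf_eq0 /= opprK.
rewrite -[1 + 1]/(2%:R) pnatr_eq0 orbF => /eqP /(congr1 Im) /= /eqP.
by rewrite oner_eq0.
Qed.

Lemma root_dist z w : normc z <= 1 -> normc w <= 1 ->
  normc (Sroot z - Sroot w) ^+ 2 <= normc (z - w) /\
  normc (Troot z - Troot w) ^+ 2 <= normc (z - w).
Proof.
move=> /SR_arg [Sz Tz] /SR_arg [Sw Tw]; split.
  rewrite (le_trans (rt_dist Sz Sw)) //.
  have -> : 'i%C * (1 + z) - 'i%C * (1 + w) = 'i%C * (z - w) by ring.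
  by rewrite normcM normc_i mul1r.
rewrite (le_trans (rt_dist Tz Tw)) //.
have -> : 'i%C * (1 - z) - 'i%C * (1 - w) = 'i%C * (w - z) by ring.
by rewrite normcM normc_i mul1r normc_dist.
Qed.

(** The square roots are Hoelder continuous of exponent [1 / 2], and the denominator is
    bounded below by [Mden_norm]. *)
Lemma Mhd_dist z w : normc z <= 1 -> normc w <= 1 ->
  normc (Mhd z - Mhd w) ^+ 2 <= 16 * normc (z - w).
Proof.
move=> Hz Hw; have [hS hT] := root_dist Hz Hw.
have Dz := Mden_norm Hz; have Dz0 := Mden_neq0 Hz; have Dw0 := Mden_neq0 Hw.
have E : (Mhd z - Mhd w) * Mden z = om * (Troot z - Troot w) * (1 - Mhd w)
    - (Sroot z - Sroot w) * (1 + Mhd w).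
  have EN : om * Troot w - Sroot w = Mhd w * Mden w by rewrite MhdE divfK.
  rewrite mulrBl {1}MhdE divfK //.
  transitivity (om * Troot z - Sroot z - Mhd w * Mden z - (om * Troot w - Sroot w)
      + Mhd w * Mden w); first by rewrite EN subrK.
  by rewrite /Mden; ring.
have Mw := Mhd_norm Hw.
have h1 : normc (1 - Mhd w) <= 2.
  by rewrite (le_trans (normcD _ _)) // normc1 normc_opp; lra.
have h2 : normc (1 + Mhd w) <= 2.
  by rewrite (le_trans (normcD _ _)) // normc1; lra.
have h3 : normc (Mhd z - Mhd w) * normc (Mden z) <=
    2 * (normc (Troot z - Troot w) + normc (Sroot z - Sroot w)).
  rewrite -normcM E (le_trans (normcD _ _)) // normc_opp !normcM om_norm mul1r.
  have := normc_ge0 (Troot z - Troot w); have := normc_ge0 (Sroot z - Sroot w); nra.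
move: (normc (Troot z - Troot w)) (normc (Sroot z - Sroot w)) hS hT h3
  (normc_ge0 (Troot z - Troot w)) (normc_ge0 (Sroot z - Sroot w)) => t s hs ht h3 t0 s0.
have h4 : (normc (Mhd z - Mhd w) * normc (Mden z)) ^+ 2 <= (2 * (t + s)) ^+ 2.
  by rewrite ler_sqr ?nnegrE ?mulr_ge0 ?normc_ge0 ?addr_ge0.
rewrite exprMn in h4.
have h5 : normc (Mhd z - Mhd w) ^+ 2 * 2 <= normc (Mhd z - Mhd w) ^+ 2 * normc (Mden z) ^+ 2.
  by rewrite ler_wpM2l // sqr_ge0.
have := sqr_ge0 (t - s); rewrite sqrrB; move: h4; rewrite exprMn sqrrD; nra.
Qed.

(** The preimage of [x] is the solution of the equation [Mhd_inv] for [z]. *)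
Lemma Mhd_onto_segment (x : R) : -1 < x < 1 ->
  exists2 z, normc z = 1 & Mhd z = x%:C.
Proof.
move=> /andP[x0 x1].
pose den : C := (1 + x) ^+ 2 +i* (1 - x) ^+ 2.
have den0 : den != 0.
  apply/eqP => -[] /eqP; rewrite expf_eq0 /= => /eqP; lra.
pose z : C := (- (1 + x) ^+ 2 +i* (1 - x) ^+ 2) / den.
have Hz : normc z = 1.
  rewrite /z normcM normcV (_ : normc (_ +i* _) = normc den); last by rewrite /= sqrrN.
  by rewrite divff // normc_eq0.
pose k := rt (2 * 'i%C / den).
have Dden : 0 < normc den ^+ 2 by rewrite exprn_gt0 // normc_gt0.
have k2 : k ^+ 2 = 2 * 'i%C / den.
  rewrite rt_sqr // Im_div divr_ge0 ?(ltW Dden) //=; nra.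
have [u [u0 hu] Eom] := om_coord.
have kk := rt_Re (2 * 'i%C / den); have kk' := rt_Im (2 * 'i%C / den); rewrite -/k in kk kk'.
have ok : 0 <= Re (om * k) /\ 0 <= Im (om * k).
  have : 0 <= Re (k ^+ 2).
    have -> : Re (k ^+ 2) = (2 * (1 - x) ^+ 2) / normc den ^+ 2.
      rewrite k2 normc_sqr /=; ring.
    by rewrite divr_ge0 ?(ltW Dden) // mulr_ge0 // sqr_ge0.
  move: kk kk'; rewrite Eom; case: (k) => p q /= p0 q0; move=> h.
  have pq : q <= p by rewrite leNgt; apply/negP => h'; nra.
  split; nra.
have ET : Troot z = (1 + x)%:C * k.
  rewrite /Troot (_ : 'i%C * (1 - z) = ((1 + x)%:C * k) ^+ 2).
    by rewrite rt_unique // ?Re_mulr ?Im_mulr mulr_ge0 //; lra.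
  have hd : 1 - z = 2 * (1 + x)%:C ^+ 2 / den.
    rewrite /z -[1 in LHS](divff den0) -mulrBl; congr (_ / _).
    by apply: complex_ext; rewrite !expr2 /=; ring.
  by rewrite hd exprMn k2; field.
have ES : Sroot z = (1 - x)%:C * (om * k).
  case: ok => ok1 ok2.
  rewrite /Sroot (_ : 'i%C * (1 + z) = ((1 - x)%:C * (om * k)) ^+ 2).
    by rewrite rt_unique // ?Re_mulr ?Im_mulr mulr_ge0 //; lra.
  have hd : 1 + z = 2 * 'i%C * (1 - x)%:C ^+ 2 / den.
    rewrite /z -[1 in LHS](divff den0) -mulrDl; congr (_ / _).
    by apply: complex_ext; rewrite !expr2 /=; ring.
  by rewrite hd !exprMn k2 om_sqr; field.
exists z => //; have := Mden_neq0; move=> /(_ z); rewrite Hz lexx => /(_ isT).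
rewrite MhdE /Mden ET ES.
have -> : om * ((1 + x)%:C * k) - (1 - x)%:C * (om * k) = 2 * x%:C * (om * k).
  by rewrite !rmorphD rmorphN rmorph1; ring.
have -> : om * ((1 + x)%:C * k) + (1 - x)%:C * (om * k) = 2 * (om * k).
  by rewrite !rmorphD rmorphN rmorph1; ring.
move=> h; rewrite (_ : 2 * x%:C * (om * k) = x%:C * (2 * (om * k))); last by ring.
by rewrite mulfK.
Qed.

(** * Bumps *)

(** A branch of [- ((w - a) (w - b)) ^ (3 / 2)] on the closed upper half plane. The
    exponent makes it Lipschitz up to the real axis. Between [a] and [b] the product of
    the roots is purely imaginary, and the bump is [i] times a positive number. *)
Definition bump (a b : R) w : C := - (rt (w - a%:C) * rt (w - b%:C)) ^+ 3.

Lemma rt_ge0 (x : R) : 0 <= x -> rt x%:C = (Num.sqrt x)%:C.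
Proof.
move=> x0; have -> : x%:C = ((Num.sqrt x)%:C) ^+ 2 by rewrite -rmorphXn /= sqr_sqrtr.
by rewrite rt_unique ?sqrtr_sqr //= ?sqrtr_ge0 // sqr_sqrtr.
Qed.

Lemma rt_le0 (x : R) : x <= 0 -> rt x%:C = 0 +i* Num.sqrt (- x).
Proof.
move=> x0; have E : x%:C = (0 +i* Num.sqrt (- x)) ^+ 2.
  rewrite expr2; apply: complex_ext; rewrite /=; last by ring.
  by rewrite mul0r sub0r -expr2 sqr_sqrtr ?opprK // oppr_ge0.
by rewrite {1}E rt_unique //= sqrtr_ge0.
Qed.

Lemma bump_Im_inside (a b x : R) : a <= x <= b ->
  Im (bump a b x%:C) = (Num.sqrt ((x - a) * (b - x))) ^+ 3.
Proof.
move=> /andP[ax xb]; rewrite /bump -!rmorphB rt_ge0 ?subr_ge0 // rt_le0 ?subr_le0 //.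
rewrite opprB sqrtrM ?subr_ge0 //; move: (Num.sqrt (x - a)) (Num.sqrt (b - x)) => p q.
by rewrite !exprS expr0 /=; ring.
Qed.

Lemma bump_Im_outside (a b x : R) : a <= b -> x <= a \/ b <= x -> Im (bump a b x%:C) = 0.
Proof.
move=> ab [xa|bx]; rewrite /bump -!rmorphB.
  have xb := le_trans xa ab.
  rewrite !rt_le0 ?subr_le0 //; move: (Num.sqrt _) (Num.sqrt _) => p q.
  by rewrite !exprS expr0 /=; ring.
have ax := le_trans ab bx.
rewrite !rt_ge0 ?subr_ge0 //; move: (Num.sqrt _) (Num.sqrt _) => p q.
by rewrite !exprS expr0 /=; ring.
Qed.

Lemma bump_Im_ge0 (a b x : R) : a <= b -> 0 <= Im (bump a b x%:C).
Proof.
move=> ab; have [h|h] := boolP (a <= x <= b).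
  by rewrite bump_Im_inside // exprn_ge0 // sqrtr_ge0.
rewrite bump_Im_outside //; move: h; rewrite negb_and -!ltNge => /orP[] /ltW; tauto.
Qed.

Lemma bump_Im_center (c r : R) : 0 <= r -> Im (bump (c - r) (c + r) c%:C) = r ^+ 3.
Proof.
move=> r0; rewrite bump_Im_inside; last by lra.
by rewrite (_ : _ * _ = r ^+ 2) ?sqrtr_sqr ?ger0_norm //; ring.
Qed.

Lemma bump_Im_near_center (c r x : R) : 0 <= r -> `|x - c| <= r / 2 ->
  r ^+ 3 / 8 <= Im (bump (c - r) (c + r) x%:C).
Proof.
rewrite ler_norml => r0 /andP[h1 h2]; rewrite bump_Im_inside; last by lra.
have -> : r ^+ 3 / 8 = (r / 2) ^+ 3 by field.
rewrite lerXn2r ?nnegrE ?sqrtr_ge0 //; first by lra.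
rewrite -(@ler_sqr R) ?nnegrE ?sqrtr_ge0 //; last by lra.
by rewrite sqr_sqrtr; nra.
Qed.

Definition upper_disk w := 0 <= Im w /\ normc w <= 1.

Lemma upper_disk_shift w (a : R) : upper_disk w -> 0 <= a <= 1 ->
  0 <= Im (w - a%:C) /\ normc (rt (w - a%:C)) <= 3 / 2.
Proof.
move=> [w0 w1] /andP[a0 a1]; split; first by rewrite ImcB /= subr0.
have h0 : 0 <= 3 / 2 :> R by lra.
rewrite -(@ler_sqr R) ?nnegrE ?normc_ge0 //.
rewrite rt_norm (le_trans (normcD _ _)) // normc_opp normcR ger0_norm //.
rewrite (_ : (3 / 2) ^+ 2 = 9 / 4); [lra | by field].
Qed.

Lemma rt_cube_norm w (a : R) : upper_disk w -> 0 <= a <= 1 -> normc (rt (w - a%:C) ^+ 3) <= 27 / 8.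
Proof.
move=> Hw Ha; have [_ H] := upper_disk_shift Hw Ha.
rewrite normcX (_ : 27 / 8 = (3 / 2) ^+ 3); last by field.
by rewrite lerXn2r ?nnegrE ?normc_ge0 //; lra.
Qed.

Lemma rt_cube_lipschitz u w (a : R) : upper_disk u -> upper_disk w -> 0 <= a <= 1 ->
  normc (rt (u - a%:C) ^+ 3 - rt (w - a%:C) ^+ 3) <= 6 * normc (u - w).
Proof.
move=> Hu Hw Ha; have [u1 u2] := upper_disk_shift Hu Ha; have [w1 w2] := upper_disk_shift Hw Ha.
rewrite (le_trans (rt_cube_dist u1 w1)) //.
rewrite (_ : u - a%:C - (w - a%:C) = u - w); last by ring.
have h : normc (rt (u - a%:C) + rt (w - a%:C)) <= 3 by rewrite (le_trans (normcD _ _)) //; lra.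
by have := normc_ge0 (u - w); nra.
Qed.

Lemma bump_norm (a b : R) w : upper_disk w -> 0 <= a <= 1 -> 0 <= b <= 1 ->
  normc (bump a b w) <= 12.
Proof.
move=> Hw Ha Hb; rewrite /bump normc_opp exprMn normcM.
have := rt_cube_norm Hw Ha; have := rt_cube_norm Hw Hb.
have := normc_ge0 (rt (w - a%:C) ^+ 3); have := normc_ge0 (rt (w - b%:C) ^+ 3); nra.
Qed.

Lemma bump_lipschitz (a b : R) u w : upper_disk u -> upper_disk w ->
  0 <= a <= 1 -> 0 <= b <= 1 ->
  normc (bump a b u - bump a b w) <= 48 * normc (u - w).
Proof.
move=> Hu Hw Ha Hb; rewrite /bump !exprMn.
have := rt_cube_lipschitz Hu Hw Ha; have := rt_cube_lipschitz Hu Hw Hb.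
have := rt_cube_norm Hw Ha; have := rt_cube_norm Hu Hb.
move: (rt (u - a%:C) ^+ 3) (rt (u - b%:C) ^+ 3) (rt (w - a%:C) ^+ 3) (rt (w - b%:C) ^+ 3).
move=> A B A' B' h1 h2 h3 h4.
have -> : - (A * B) - - (A' * B') = - ((A - A') * B + A' * (B - B')) by ring.
rewrite normc_opp (le_trans (normcD _ _)) // !normcM.
have := normc_ge0 B; have := normc_ge0 A'; have := normc_ge0 (A - A').
have := normc_ge0 (B - B'); have := normc_ge0 (u - w); nra.
Qed.

End ComplexPlane.

(** * Complex differentiability *)

Lemma derivable_comp (K : numFieldType) (f g : K -> K) (z : K) :
  derivable f z 1%R -> derivable g (f z) 1%R -> derivable (fun u => g (f u)) z 1%R.
Proof.
move=> /derivable1_diffP Hf /derivable1_diffP Hg; apply/derivable1_diffP.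
exact: (differentiable_comp Hf Hg).
Qed.

Lemma derivable_mul (K : numFieldType) (f g : K -> K) (z : K) :
  derivable f z 1%R -> derivable g z 1%R -> derivable (fun u => f u * g u)%R z 1%R.
Proof. exact: derivableM. Qed.

Lemma derivable_inv (K : numFieldType) (z : K) :
  z != 0%R -> derivable (fun u : K => u^-1)%R z 1%R.
Proof. by move=> z0; apply: derivableV z0 _; exact: derivable_id. Qed.

Section Differentiability.
Variable R : realType.
Local Open Scope ring_scope.
Local Open Scope classical_set_scope.
Local Notation CR := (Defs.C R).
Local Notation C := R[i].

Lemma posc (e : CR) : 0 < e -> 0 < Re e /\ e = (Re e)%:C.
Proof. by case: e => a b; rewrite ltcE /= => /andP[/eqP -> ?]. Qed.

Lemma nbhs_normc (z : CR) (U : set CR) :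
  nbhs z U <-> exists2 e : R, 0 < e & forall u, normc (u - z) < e -> U u.
Proof.
split=> [/nbhs_ballP[e /= /posc [e0 Ee] H]|[e e0 H]].
  exists (Re e) => // u hu; apply: H; rewrite -ball_normE /= Ee normrc ltcR.
  by rewrite normc_dist.
apply/nbhs_ballP; exists e%:C; first by rewrite /= ltcR.
by move=> u; rewrite -ball_normE /= normrc ltcR normc_dist; apply: H.
Qed.

(** Complex differentiability with explicit [e] and [del] in terms of the real-valued
    modulus, which is convenient for series and square roots. *)
Definition cdiff (f : C -> C) (z : C) := exists d, forall e, 0 < e -> exists2 del, 0 < del &
  forall u, normc (u - z) < del -> normc (f u - f z - d * (u - z)) <= e * normc (u - z).

Lemma cdiffP (f : CR -> CR) (z : CR) : cdiff f z <-> derivable f z 1.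
Proof.
split=> [[d Hd]|/cvg_ex[d /cvgrPdist_le Hd]].
  apply/cvg_ex; exists (d : CR); apply/cvgrPdist_le => e /posc [e0 ->].
  have [del del0 H] := Hd _ e0.
  apply/nbhs_normc; exists del => // h; rewrite subr0 => hdel h0.
  have := H (h + z); rewrite addrK => /(_ hdel) h1.
  rewrite /= normrc lecR -[h *: 1]/(h * 1) mulr1.
  have hn : 0 < normc h by rewrite normc_gt0.
  rewrite -(ler_pM2r hn) -normcM mulrBl -[h^-1 *: _]/(h^-1 * _) mulrAC mulVf // mul1r.
  by rewrite normc_dist.
exists d => e e0; have /Hd : 0 < e%:C :> CR by rewrite ltcR.
move=> /nbhs_normc[del del0 H]; exists del => // u.
have [->|uz] := eqVneq u z; first by rewrite !subrr mulr0 subr0 normc0 mulr0.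
have h0 : u - z != 0 by rewrite subr_eq0.
move=> hu; have := H (u - z); rewrite subr0 => /(_ hu h0).
rewrite /= normrc lecR -[(u - z) *: 1]/((u - z) * 1) mulr1 subrK.
have hn : 0 < normc (u - z) by rewrite normc_gt0.
rewrite -(ler_pM2r hn) -normcM mulrBl -[_^-1 *: _]/(_^-1 * _) mulrAC mulVf // mul1r.
by rewrite normc_dist.
Qed.

Lemma cdiff_ext f g z : cdiff f z -> f =1 g -> cdiff g z.
Proof.
move=> [d Hd] E; exists d => e /Hd[del del0 H]; exists del => // u /H.
by rewrite !E.
Qed.

Lemma cdiff_const (c z : C) : cdiff (fun=> c) z.
Proof. exact/cdiffP/derivable_cst. Qed.

Lemma cdiff_id (z : C) : cdiff (fun u => u) z.
Proof. exact/cdiffP/derivable_id. Qed.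

Lemma cdiff_add (f g : C -> C) (z : C) :
  cdiff f z -> cdiff g z -> cdiff (fun u => f u + g u) z.
Proof. move=> /cdiffP Hf /cdiffP Hg; apply/cdiffP; exact: derivableD. Qed.

Lemma cdiff_mul (f g : C -> C) (z : C) :
  cdiff f z -> cdiff g z -> cdiff (fun u => f u * g u) z.
Proof. move=> /cdiffP Hf /cdiffP Hg; apply/cdiffP; exact: (@derivable_mul CR f g z Hf Hg). Qed.

Lemma cdiff_comp (f g : C -> C) (z : C) :
  cdiff f z -> cdiff g (f z) -> cdiff (fun u => g (f u)) z.
Proof. move=> /cdiffP Hf /cdiffP Hg; apply/cdiffP; exact: (@derivable_comp CR f g z Hf Hg). Qed.

Lemma cdiff_inv (z : C) : z != 0 -> cdiff (fun u => u^-1) z.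
Proof. move=> z0; apply/cdiffP; exact: (@derivable_inv CR z z0). Qed.

(** [rt u - rt z] is [(u - z) / (rt u + rt z)], and the sum of the roots is at least
    as large as [rt z] because both lie in the first quadrant. *)
Lemma cdiff_rt z : 0 < Im z -> cdiff (@rt R) z.
Proof.
move=> z0; have E := rt_sqr (ltW z0).
have m0 : 0 < normc (rt z).
  by rewrite normc_gt0; apply: contraTneq z0 => h; rewrite -E h expr0n ltxx.
have rz0 : rt z != 0 by rewrite -normc_gt0.
exists ((2 * rt z)^-1) => e e0; set m := normc (rt z) in m0.
exists (Num.min (Im z) ((e * (2 * m ^+ 2)) ^+ 2)).
  by rewrite lt_min z0 exprn_gt0 // !mulr_gt0 // exprn_gt0.
move=> u; rewrite lt_min => /andP[h1 h2].
have u0 : 0 <= Im u.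
  by have := abs_Im_le (u - z); rewrite ImcB ler_norml => /andP[]; lra.
have hs : m <= normc (rt u + rt z).
  rewrite normc_le ?normc_ge0 // normc_sqr RecD ImcD.
  by have := rt_Re u; have := rt_Im u; have := rt_Re z; have := rt_Im z; nra.
have s0 : rt u + rt z != 0 by rewrite -normc_gt0 (lt_le_trans m0).
have -> : rt u - rt z - (2 * rt z)^-1 * (u - z) =
   (u - z) * (rt z - rt u) / (2 * rt z * (rt u + rt z)).
  have -> : u - z = rt u ^+ 2 - rt z ^+ 2 by rewrite E rt_sqr.
  by field; rewrite s0 rz0.
rewrite normcM normcV [normc (2 * rt z * _)]normcM ler_pdivrMr; last first.
  by rewrite mulr_gt0 // normc_gt0 // mulf_neq0 // pnatr_eq0.
have hd : normc (rt z - rt u) <= e * (2 * m ^+ 2).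
  have := rt_dist (ltW z0) u0; rewrite [normc (z - u)]normc_dist => h3.
  rewrite -(@ler_sqr R) ?nnegrE ?normc_ge0 //.
    by rewrite (le_trans _ (ltW h2)).
  by rewrite mulr_ge0 ?(ltW e0) // mulr_ge0 // exprn_ge0 // ltW.
have h2' : normc (2 * rt z) = 2 * m.
  by rewrite normcM (_ : 2 = (2 : R)%:C) ?normcR ?ger0_norm // rmorph_nat.
rewrite h2' normcM -[X in _ <= X]mulrA mulrCA ler_wpM2l ?normc_ge0 // (le_trans hd) //.
by rewrite ler_wpM2l ?(ltW e0) // expr2 mulrA ler_wpM2l // mulr_ge0 // ltW.
Qed.

End Differentiability.

(** * Dominated series *)

Section Sums.
Variable R : realType.
Local Open Scope ring_scope.
Local Notation C := R[i].
Implicit Types (u v : nat -> R) (p q : nat -> C) (K : R).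

(** All series here are dominated by a geometric series of ratio [1 / 2]. *)
Definition dominated u K := forall j, `|u j| <= K * 2 ^- j.
Definition rsum u : R := limn (series u).

Lemma half_sum (K : R) n d :
  \sum_(n <= j < n + d) K * 2 ^- j = 2 * K * 2 ^- n - 2 * K * 2 ^- (n + d).
Proof.
elim: d => [|d IH]; first by rewrite addn0 big_geq // subrr.
rewrite addnS big_nat_recr ?leq_addr //= IH exprS invfM.
by set x := 2 ^- (n + d); field.
Qed.

Lemma series_dist u K n m : dominated u K -> (n <= m)%N ->
  `|series u m - series u n| <= 2 * K * 2 ^- n.
Proof.
move=> Hu nm; rewrite /series /= (big_cat_nat (leq0n n) nm) /= addrAC subrr add0r.
rewrite (le_trans (ler_norm_sum _ _ _)) //.
rewrite (le_trans (ler_sum _ (fun j _ => Hu j))) // -{1}(subnKC nm) half_sum subnKC //.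
have K0 : 0 <= K by have := Hu 0%N; rewrite expr0 invr1 mulr1; apply: le_trans.
by rewrite lerBlDr lerDl mulr_ge0 ?mulr_ge0 // invr_ge0 exprn_ge0.
Qed.

Lemma dominated_cvg u K : dominated u K -> cvgn (series u).
Proof.
move=> Hu; apply: normed_cvg.
apply: (@series_le_cvg _ (fun n => `|u n|) (fun n => geometric K 2^-1 n)).
- by move=> n; apply: normr_ge0.
- by move=> n; rewrite /geometric /= (le_trans (normr_ge0 (u n))) // exprVn.
- by move=> n; rewrite /geometric /= exprVn.
- by apply: is_cvg_geometric_series; rewrite ger0_norm //; lra.
Qed.

Lemma rsum_tail u K n : dominated u K ->
  `|rsum u - \sum_(j < n) u j| <= 2 * K * 2 ^- n.
Proof.
move=> Hu; rewrite -(big_mkord xpredT) -[\sum_(_ <= _ < _) _]/(series u n) ler_norml.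
have cu := dominated_cvg Hu.
apply/andP; split.
  rewrite lerBrDl; apply: limr_ge => //; exists n => // m /= nm.
  by have := series_dist Hu nm; rewrite ler_norml => /andP[]; lra.
rewrite lerBlDl; apply: limr_le => //; exists n => // m /= nm.
by have := series_dist Hu nm; rewrite ler_norml => /andP[]; lra.
Qed.

Lemma vanishing (x K : R) : (forall n, `|x| <= K * 2 ^- n) -> x = 0.
Proof.
move=> H; apply/eqP; rewrite -normr_eq0; apply/negPn/negP => x0.
have K0 : 0 < K.
  have := H 0%N; rewrite expr0 invr1 mulr1; apply: lt_le_trans.
  by rewrite lt_neqAle eq_sym x0 normr_ge0.
have xp : 0 < `|x| by rewrite lt_neqAle eq_sym x0 normr_ge0.
pose n := Num.truncn (K / `|x|).
have := truncnS_gt (K / `|x|); rewrite -/n ltr_pdivrMr // => hn.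
have := H n.+1; rewrite ler_pdivlMr ?exprn_gt0 // => h.
have : (n.+1)%:R <= 2 ^+ n.+1 :> R by rewrite -natrX ler_nat ltnW // ltn_expl.
by nra.
Qed.

Definition cdominated p K := forall j, normc (p j) <= K * 2 ^- j.
Definition csum p : C := rsum (fun j => Re (p j)) +i* rsum (fun j => Im (p j)).

Lemma cdominated_Re p K : cdominated p K -> dominated (fun j => Re (p j)) K.
Proof. by move=> H j; apply: le_trans (abs_Re_le _) _. Qed.

Lemma cdominated_Im p K : cdominated p K -> dominated (fun j => Im (p j)) K.
Proof. by move=> H j; apply: le_trans (abs_Im_le _) _. Qed.

Lemma Re_sum n p : Re (\sum_(j < n) p j) = \sum_(j < n) Re (p j).
Proof. by elim/big_rec2: _ => // j x y _ <-; rewrite RecD. Qed.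

Lemma Im_sum n p : Im (\sum_(j < n) p j) = \sum_(j < n) Im (p j).
Proof. by elim/big_rec2: _ => // j x y _ <-; rewrite ImcD. Qed.

Lemma csum_tail p K n : cdominated p K ->
  normc (csum p - \sum_(j < n) p j) <= 4 * K * 2 ^- n.
Proof.
move=> Hp; rewrite (le_trans (normc_le_ReIm _)) // RecB ImcB Re_sum Im_sum /=.
have := rsum_tail n (cdominated_Re Hp); have := rsum_tail n (cdominated_Im Hp); lra.
Qed.

Lemma csum_norm p K : cdominated p K -> normc (csum p) <= 4 * K.
Proof. by move=> /(csum_tail 0); rewrite big_ord0 subr0 expr0 invr1 mulr1. Qed.

Lemma csum_unique p K s L : cdominated p K ->
  (forall n, normc (s - \sum_(j < n) p j) <= L * 2 ^- n) -> s = csum p.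
Proof.
move=> Hp Hs; apply/eqP; rewrite -subr_eq0 -normc_eq0; apply/eqP.
apply: (@vanishing _ (L + 4 * K)) => n; rewrite ger0_norm ?normc_ge0 //.
have -> : s - csum p = (s - \sum_(j < n) p j) - (csum p - \sum_(j < n) p j) by ring.
rewrite (le_trans (normcD _ _)) // normc_opp mulrDl lerD //.
exact: csum_tail.
Qed.

Lemma csumB p q K L : cdominated p K -> cdominated q L ->
  csum (fun j => p j - q j) = csum p - csum q.
Proof.
move=> Hp Hq; apply/esym; apply: (@csum_unique _ (K + L) _ (4 * K + 4 * L)).
  by move=> j; rewrite (le_trans (normcD _ _)) // normc_opp mulrDl lerD.
move=> n; rewrite sumrB.
have -> : csum p - csum q - (\sum_(j < n) p j - \sum_(j < n) q j) =
  (csum p - \sum_(j < n) p j) - (csum q - \sum_(j < n) q j) by ring.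
by rewrite (le_trans (normcD _ _)) // normc_opp mulrDl lerD // csum_tail.
Qed.

Lemma csumZ c p K : cdominated p K -> csum (fun j => c * p j) = c * csum p.
Proof.
move=> Hp; apply/esym; apply: (@csum_unique _ (normc c * K) _ (normc c * (4 * K))).
  by move=> j; rewrite normcM -mulrA ler_wpM2l ?normc_ge0.
by move=> n; rewrite -mulr_sumr -mulrBr normcM -mulrA ler_wpM2l ?normc_ge0 // csum_tail.
Qed.

Lemma Im_csum_ge p K j : cdominated p K -> (forall k, 0 <= Im (p k)) ->
  Im (p j) <= Im (csum p).
Proof.
move=> Hp H0; apply: limr_ge; first exact: dominated_cvg (cdominated_Im Hp).
exists j.+1 => // n /= jn; rewrite /series /= big_mkord.
by rewrite (bigD1 (Ordinal jn)) //= lerDl sumr_ge0.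
Qed.

Lemma Im_csum_single p K j : cdominated p K -> (forall k, k != j -> Im (p k) = 0) ->
  Im (csum p) = Im (p j).
Proof.
move=> Hp H0; apply/eqP; rewrite -subr_eq0; apply/eqP.
apply: (@vanishing _ (2 * K)) => n.
have K0 : 0 <= K by have := Hp 0%N; rewrite expr0 invr1 mulr1; apply: le_trans; apply: normc_ge0.
have := rsum_tail (j.+1 + n) (cdominated_Im Hp).
rewrite (bigD1 (Ordinal (leq_addr n j.+1 : (j < j.+1 + n)%N))) //= big1 ?addr0; last first.
  by move=> i Hi; apply: H0; apply: contraNneq Hi => h; apply/eqP/val_inj.
move=> h; rewrite (le_trans h) // ler_wpM2l ?mulr_ge0 //.
by rewrite lef_pV2 ?posrE ?exprn_gt0 // ler_weXn2l ?ler1n // leq_addl.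
Qed.

End Sums.

(** * The half disk with a bumpy side *)

Section Map.
Variable R : realType.
Local Open Scope ring_scope.
Local Notation C := R[i].
Implicit Types z w u : C.

Lemma Re_realc (x : R) : Re x%:C = x. Proof. by []. Qed.
Lemma Im_realc (x : R) : Im x%:C = 0. Proof. by []. Qed.

(** ** Termwise differentiation *)

Lemma small_real z (del : R) : 0 < del -> exists2 u, u != z & normc (u - z) < del.
Proof.
move=> d0; exists (z + (del / 2)%:C).
  rewrite -subr_eq0 addrAC subrr add0r; apply/eqP => -[] /eqP.
  by rewrite mulf_eq0 invr_eq0 pnatr_eq0 orbF gt_eqF.
by rewrite addrAC subrr add0r normcR ger0_norm; lra.
Qed.

(** The derivatives are dominated by the Lipschitz constants.  A finite part of the
    sum is differentiable, and the rest contributes a difference quotient below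
    [e / 2], uniformly in [u]. *)
Lemma cdiff_csum (p : nat -> C -> C) w (L K rho : R) : 0 < rho ->
  (forall u, normc (u - w) < rho -> cdominated (p^~ u) K) ->
  (forall j u, normc (u - w) < rho -> normc (p j u - p j w) <= L * 2 ^- j * normc (u - w)) ->
  (forall j, cdiff (p j) w) -> cdiff (fun u => csum (p^~ u)) w.
Proof.
move=> rho0 Hdom Hlip /choice[d Hd].
have Hdw : cdominated (p^~ w) K by apply: Hdom; rewrite subrr normc0.
have L0 j : 0 <= L * 2 ^- j.
  have [u uw ur] := small_real w rho0.
  have := le_trans (normc_ge0 _) (Hlip j u ur).
  by rewrite pmulr_lge0 // normc_gt0 subr_eq0.
have dL : cdominated d L.
  move=> j; apply/ler_addgt0Pr => e e0; have [del del0 H] := Hd j e e0.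
  have [|u uw] := small_real w (_ : 0 < Num.min del rho); first by rewrite lt_min del0.
  rewrite lt_min => /andP[/H h1 /(Hlip j) h2].
  rewrite -(ler_pM2r (_ : 0 < normc (u - w))); last by rewrite normc_gt0 subr_eq0.
  rewrite -normcM mulrDl.
  have -> : d j * (u - w) = (p j u - p j w) - (p j u - p j w - d j * (u - w)) by ring.
  by rewrite (le_trans (normcD _ _)) // normc_opp lerD.
pose q j u := p j u - p j w - d j * (u - w).
have Hfin n e : 0 < e -> exists2 del, 0 < del & forall u, normc (u - w) < del ->
    normc (\sum_(j < n) q j u) <= e * normc (u - w).
  elim: n e => [|n IH] e e0.
    by exists 1 => // u _; rewrite big_ord0 normc0 mulr_ge0 ?normc_ge0 // ltW.
  have e20 : 0 < e / 2 by lra.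
  have [d1 d10 H1] := IH _ e20; have [d2 d20 H2] := Hd n _ e20.
  exists (Num.min d1 d2); first by rewrite lt_min d10.
  move=> u; rewrite lt_min => /andP[/H1 h1 /H2 h2]; rewrite big_ord_recr /=.
  by rewrite (le_trans (normcD _ _)) //; move: h2; rewrite -/(q n u); lra.
exists (csum d) => e e0.
(* From the index [n] on, the difference quotients add up to at most
   [8 * L * 2 ^- n <= e / 2]. *)
pose n := Num.truncn (16 * L / e).
have hn : 8 * L * 2 ^- n <= e / 2.
  have := truncnS_gt (16 * L / e); rewrite -/n ltr_pdivrMr // => hn.
  rewrite ler_pdivrMr ?exprn_gt0 //.
  have : n.+1%:R <= 2 ^+ n :> R by rewrite -natrX ler_nat ltn_expl.
  by nra.
have e20 : 0 < e / 2 by lra.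
have [d1 d10 H1] := Hfin n _ e20.
exists (Num.min d1 rho); first by rewrite lt_min d10.
move=> u; rewrite lt_min => /andP[/H1 h1 ur].
have Hq : cdominated (q^~ u) (2 * L * normc (u - w)).
  move=> j; rewrite /q (le_trans (normcD _ _)) // normc_opp normcM.
  have := Hlip j u ur; have := ler_wpM2r (normc_ge0 (u - w)) (dL j).
  by rewrite -!mulrA [2 ^- j * _]mulrC; lra.
have -> : csum (p^~ u) - csum (p^~ w) - csum d * (u - w) = csum (q^~ u).
  rewrite -(csumB (Hdom _ ur) Hdw) mulrC -(csumZ _ dL).
  rewrite -(@csumB _ _ _ (K + K) (normc (u - w) * L)).
  - by congr csum; apply/funext => j; rewrite /q [d j * _]mulrC.
  - by move=> j; rewrite (le_trans (normcD _ _)) // normc_opp mulrDl lerD // ?Hdw ?(Hdom _ ur).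
  - by move=> j; rewrite normcM -mulrA ler_wpM2l ?normc_ge0.
have h2 : normc (csum (q^~ u) - \sum_(j < n) q j u) <=
    4 * (2 * L * normc (u - w)) * 2 ^- n := csum_tail n Hq.
rewrite -[csum _](subrK (\sum_(j < n) q j u)) (le_trans (normcD _ _)) //.
have := ler_wpM2r (normc_ge0 (u - w)) hn.
have -> : 8 * L * 2 ^- n * normc (u - w) = 4 * (2 * L * normc (u - w)) * 2 ^- n by ring.
by move=> h3; rewrite (le_trans (lerD (le_trans h2 h3) h1)) // -mulrDl -splitr.
Qed.

(** ** The domain with bumps *)

Variables (tau : nat -> bool) (site : nat -> nat).

(** The sites cluster at [1 / 2] from the right, with disjoint intervals of radius
    [rad n] around [center n].  The weight [2 ^ -(j + 10)] makes the sum of all bumps small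
    compared to the identity, whatever [tau] is. *)
Definition rad (n : nat) : R := 2 ^- (n + 4).
Definition center (n : nat) : R := 1 / 2 + 3 * rad n.
Definition bump_at n w := bump (center n - rad n) (center n + rad n) w.
Definition weight j : R := (tau j)%:R * 2 ^- (j + 10).
Definition bump_term j w := (weight j)%:C * bump_at (site j) w.
Definition Gmap := locked (fun w => w + csum (bump_term^~ w)).

Lemma GmapE w : Gmap w = w + csum (bump_term^~ w).
Proof. by rewrite /Gmap -lock. Qed.

Lemma rad_gt0 n : 0 < rad n.
Proof. exact: exp2_gt0. Qed.

Lemma rad_le n : rad n <= 1 / 16.
Proof.
rewrite /rad exprD invfM; have := exp2_le1 R n.
have -> : 2 ^- 4 = 1 / 16 :> R by rewrite -natrX; field.
by have := exp2_gt0 R n; lra.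
Qed.

Lemma site_bounds n : [/\ 0 <= center n - rad n <= 1, 0 <= center n + rad n <= 1 &
  1 / 2 <= center n <= 11 / 16].
Proof. by rewrite /center; have := rad_gt0 n; have := rad_le n; split; lra. Qed.

Lemma weight_ge0 j : 0 <= weight j.
Proof. by rewrite mulr_ge0 ?ler0n // invr_ge0 exprn_ge0. Qed.

Definition weight_scale : R := 2 ^- 10.

Lemma weight_scale_val : 0 < weight_scale <= 1 / 32 * (1 / 32).
Proof.
apply/andP; split; first by rewrite invr_gt0 exprn_gt0.
rewrite /weight_scale -[10%N]/(5 + 5)%N exprD invfM.
have -> : 2 ^- 5 = 1 / 32 :> R by rewrite -natrX; field.
exact: lexx.
Qed.

Lemma weight_le j : weight j <= 2 ^- j * weight_scale.
Proof.
rewrite /weight exprD invfM; case: (tau j); first by rewrite mul1r.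
by rewrite mul0r mulr_ge0 // invr_ge0 exprn_ge0.
Qed.

Lemma bump_term_dominated w : upper_disk w -> cdominated (bump_term^~ w) (12 * weight_scale).
Proof.
move=> Hw j; have [Ha Hb _] := site_bounds (site j).
rewrite normcM normcR ger0_norm ?weight_ge0 //.
have := bump_norm Hw Ha Hb; rewrite -/(bump_at _ _) => h.
rewrite (le_trans (ler_pM (weight_ge0 j) (normc_ge0 _) (weight_le j) h)) //.
by rewrite mulrC mulrA mulrAC.
Qed.

Lemma bump_term_lipschitz j u w : upper_disk u -> upper_disk w ->
  normc (bump_term j u - bump_term j w) <= 48 * weight_scale * 2 ^- j * normc (u - w).
Proof.
move=> Hu Hw; have [Ha Hb _] := site_bounds (site j).
rewrite -mulrBr normcM normcR ger0_norm ?weight_ge0 //.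
have := bump_lipschitz Hu Hw Ha Hb; rewrite -!/(bump_at _ _) => h.
rewrite (le_trans (ler_pM (weight_ge0 j) (normc_ge0 _) (weight_le j) h)) //.
by rewrite le_eqVlt; apply/orP; left; apply/eqP; ring.
Qed.

Lemma Gmap_near w : upper_disk w -> normc (Gmap w - w) <= 3 / 64.
Proof.
move=> /bump_term_dominated /csum_norm; rewrite GmapE addrAC subrr add0r => h.
by rewrite (le_trans h) //; have := weight_scale_val; lra.
Qed.

Lemma Gmap_perturb u w : upper_disk u -> upper_disk w ->
  normc ((Gmap u - u) - (Gmap w - w)) <= 3 / 16 * normc (u - w).
Proof.
move=> Hu Hw.
have -> : Gmap u - u - (Gmap w - w) = csum (fun j => bump_term j u - bump_term j w).
  rewrite (csumB (bump_term_dominated Hu) (bump_term_dominated Hw)) !GmapE; ring.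
have : cdominated (fun j => bump_term j u - bump_term j w) (48 * weight_scale * normc (u - w)).
  by move=> j; rewrite mulrAC; apply: bump_term_lipschitz.
move=> /csum_norm h; rewrite (le_trans h) //.
by have := weight_scale_val; have := normc_ge0 (u - w); nra.
Qed.

Lemma Gmap_lipschitz u w : upper_disk u -> upper_disk w ->
  normc (Gmap u - Gmap w) <= 19 / 16 * normc (u - w).
Proof.
move=> Hu Hw; have := Gmap_perturb Hu Hw.
have -> : Gmap u - Gmap w = (Gmap u - u - (Gmap w - w)) + (u - w) by ring.
by move=> h; rewrite (le_trans (normcD _ _)) //; lra.
Qed.

(** The sum of the bumps has Lipschitz constant [3 / 16], so that [Gmap] is
    injective. *)
Lemma Gmap_expand u w : upper_disk u -> upper_disk w ->
  normc (u - w) <= 2 * normc (Gmap u - Gmap w).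
Proof.
move=> Hu Hw; have := Gmap_perturb Hu Hw.
have := normcD (Gmap u - Gmap w) (- (Gmap u - u - (Gmap w - w))).
have -> : (Gmap u - Gmap w) + - (Gmap u - u - (Gmap w - w)) = u - w by ring.
by rewrite normc_opp; have := normc_ge0 (u - w); lra.
Qed.

Lemma upper_disk_real w : upper_disk w -> upper_disk (Re w)%:C.
Proof.
move=> [_ h]; split; first by rewrite /=.
by rewrite normcR (le_trans (abs_Re_le w)).
Qed.

Lemma Im_bump_term_ge0 (x : R) j : 0 <= Im (bump_term j x%:C).
Proof.
rewrite Im_mulr mulr_ge0 ?weight_ge0 // bump_Im_ge0 //.
by have := rad_gt0 (site j); lra.
Qed.

(** Compare [w] with the point below it on the real axis, where all bumps have a
    nonnegative imaginary part. *)
Lemma Gmap_Im w j : upper_disk w ->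
  13 / 16 * Im w + Im (bump_term j (Re w)%:C) <= Im (Gmap w).
Proof.
move=> Hw; have Hx := upper_disk_real Hw.
have : Im (bump_term j (Re w)%:C) <= Im (Gmap (Re w)%:C).
  rewrite GmapE ImcD Im_realc add0r; apply: Im_csum_ge (bump_term_dominated Hx) _ => k.
  exact: Im_bump_term_ge0.
move: (Im (bump_term j _)) => B HB.
have := Gmap_perturb Hw Hx; have -> : w - (Re w)%:C = 0 +i* Im w.
  by apply: complex_ext; rewrite ?RecB ?ImcB /= ?subrr ?subr0.
rewrite [normc (_ +i* _)]/= expr0n add0r sqrtr_sqr ger0_norm; last by case: Hw.
move=> /(le_trans (abs_Im_le _)); rewrite ler_norml => /andP[+ _].
by rewrite !ImcB Im_realc subr0; lra.
Qed.

Lemma Gmap_Im_gt0 w : upper_disk w -> 0 < Im w -> 0 < Im (Gmap w).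
Proof.
move=> Hw w0; have := Gmap_Im 0 Hw; have := Im_bump_term_ge0 (Re w) 0; lra.
Qed.

Lemma Gmap_cdiff w : 0 < Im w -> normc w < 1 -> cdiff Gmap w.
Proof.
move=> w0 w1; suff H : cdiff (fun u => u + csum (bump_term^~ u)) w.
  by apply: cdiff_ext H _ => u; rewrite GmapE.
apply: cdiff_add; first exact: cdiff_id.
have near u : normc (u - w) < Num.min (Im w) (1 - normc w) -> upper_disk u.
  rewrite lt_min => /andP[h1 h2]; split.
    by have := abs_Im_le (u - w); rewrite ImcB ler_norml => /andP[]; lra.
  by have := normcD (u - w) w; rewrite subrK; lra.
have r0 : 0 < Num.min (Im w) (1 - normc w) by rewrite lt_min w0 subr_gt0.
have Hw : upper_disk w by split; apply: ltW.
apply: (@cdiff_csum _ _ (48 * weight_scale) (12 * weight_scale) _ r0).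
- by move=> u /near; apply: bump_term_dominated.
- by move=> j u /near Hu; apply: bump_term_lipschitz.
move=> j; apply: cdiff_mul; first exact: cdiff_const.
have shift (a : R) : cdiff (fun u => rt (u - a%:C)) w.
  apply: (@cdiff_comp _ (fun u => u - a%:C) (@rt R)).
    by apply: cdiff_add; [exact: cdiff_id | exact: cdiff_const].
  by apply: cdiff_rt; rewrite ImcB subr0.
rewrite /bump_at /bump; set a := _ - _; set b := _ + _.
have := cdiff_mul (shift a) (shift b).
set f := fun u => rt (u - a%:C) * rt (u - b%:C) => Hf.
have -> : (fun u => - f u ^+ 3) = (fun u => -1 * (f u * (f u * f u))).
  by apply/funext => u; rewrite !exprS expr0 mulr1 mulN1r.
apply: cdiff_mul; first exact: cdiff_const.
exact: cdiff_mul Hf (cdiff_mul Hf Hf).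
Qed.

(** Distinct bumps are disjoint, so that a site is only lifted by its own bump. *)
Hypothesis site_inj : forall j k, tau j -> tau k -> site j = site k -> j = k.

Lemma rad_lt n m : (n < m)%N -> rad m <= rad n / 2.
Proof.
move=> nm; have -> : rad n / 2 = 2 ^- (n.+1 + 4) by rewrite addSn exprS invfM mulrC.
by rewrite lef_pV2 ?posrE ?exprn_gt0 // ler_weXn2l ?ler1n // leq_add2r.
Qed.

Lemma bump_at_other n m : n != m -> Im (bump_at m (center n)%:C) = 0.
Proof.
move=> nm; rewrite /bump_at bump_Im_outside //; first by have := rad_gt0 m; lra.
rewrite /center; have := rad_gt0 n; have := rad_gt0 m.
by case: (ltngtP n m) nm => // /rad_lt h _ h1 h2; [right | left]; lra.
Qed.

Lemma center_upper n : upper_disk (center n)%:C.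
Proof.
split; first by rewrite /=.
by have [_ _ h] := site_bounds n; rewrite normcR ger0_norm; lra.
Qed.

Lemma Gmap_center j : tau j ->
  Im (Gmap (center (site j))%:C) = 2 ^- (j + 10) * rad (site j) ^+ 3.
Proof.
move=> tj; have Hc := center_upper (site j).
rewrite GmapE ImcD Im_realc add0r (Im_csum_single (bump_term_dominated Hc) (j := j)).
  rewrite /bump_term Im_mulr /weight tj mul1r /bump_at bump_Im_center //.
  exact: ltW (rad_gt0 _).
move=> k kj; rewrite /bump_term Im_mulr /weight; case tk : (tau k); last by rewrite !mul0r.
by rewrite bump_at_other ?mulr0 //; apply: contraNneq kj => h; apply/eqP/site_inj.
Qed.

(** The tops of the bumps are flat enough that a whole neighbourhood of the site is
    lifted. *)
Lemma Gmap_lift j w : tau j -> upper_disk w ->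
  normc (w - (center (site j))%:C) <= rad (site j) / 2 ->
  2 ^- (j + 10) * rad (site j) ^+ 3 / 8 <= Im (Gmap w).
Proof.
move=> tj Hw Hc; apply: le_trans (Gmap_Im j Hw).
rewrite /bump_term Im_mulr /weight tj mul1r /bump_at.
have hx : `|Re w - center (site j)| <= rad (site j) / 2.
  by have := abs_Re_le (w - (center (site j))%:C); rewrite RecB /= => /le_trans; apply.
have := bump_Im_near_center (ltW (rad_gt0 (site j))) hx.
have w0 : 0 <= 2 ^- (j + 10) :> R by rewrite invr_ge0 exprn_ge0.
move=> /(ler_wpM2l w0); rewrite mulrA => h; apply: le_trans h _.
by case: Hw => h _; lra.
Qed.

Lemma Gmap_real (x : R) : x <= 1 / 2 -> upper_disk x%:C -> Im (Gmap x%:C) = 0.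
Proof.
move=> x0 Hx; rewrite GmapE ImcD Im_realc add0r.
rewrite (Im_csum_single (bump_term_dominated Hx) (j := 0)) => [|k _];
  rewrite /bump_term Im_mulr /bump_at bump_Im_outside ?mulr0 //; try left;
  by rewrite /center; have := rad_gt0 (site 0); try (have := rad_gt0 (site k)); lra.
Qed.

Lemma Re_bounds z (c : R) : normc z <= c -> - c <= Re z <= c.
Proof. by move=> h; rewrite -ler_norml (le_trans (abs_Re_le z)). Qed.

Lemma lipschitz_within (f : R -> R) (a b L : R) : 0 < L ->
  (forall x y, x \in `[a, b] -> y \in `[a, b] -> `|f x - f y| <= L * `|x - y|) ->
  {within `[a, b]%classic, continuous f}%classic.
Proof.
move=> L0 H; apply/subspace_continuousP => x Ax; apply/cvgrPdist_le => e e0.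
rewrite near_withinE; apply/nbhs_ballP; exists (e / L); first by rewrite /= divr_gt0.
move=> y; rewrite -ball_normE /= => xy Ay.
rewrite (le_trans (H x y Ax Ay)) // mulrC -ler_pdivlMr // ltW //.
Qed.

(** [Gmap] maps the negative half of the segment into the real axis, and moves no point by
    more than [3 / 64]. *)
Lemma Gmap_onto (c : R) : 1 / 4 <= c <= 7 / 8 ->
  exists2 x : R, -1 < x < 0 & Gmap x%:C = (- c)%:C.
Proof.
move=> /andP[c0 c1].
have Hup (x : R) : x \in `[-1, 0] -> upper_disk x%:C.
  by rewrite in_itv /= => /andP[h1 h2]; split; [by [] | rewrite normcR ler0_norm; lra].
have cont : {within `[-1, 0]%classic, continuous (fun x : R => Re (Gmap x%:C))}%classic.
  apply: (@lipschitz_within _ _ _ (19 / 16)); first by lra.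
  move=> x y /Hup Hx /Hup Hy; rewrite -RecB (le_trans (abs_Re_le _)) //.
  by rewrite (le_trans (Gmap_lipschitz Hx Hy)) // -rmorphB normcR.
have h1 : Re (Gmap (-1)%:C) <= - c.
  have I : -1 \in `[-1, 0 : R] by rewrite in_itv /= lexx lerN10.
  have /Re_bounds := Gmap_near (Hup (-1) I); rewrite RecB (Re_realc (-1)).
  by move=> /andP[_ ?]; lra.
have h2 : - c <= Re (Gmap 0%:C).
  have I : 0 \in `[-1, 0 : R] by rewrite in_itv /= lexx lerN10.
  have /Re_bounds := Gmap_near (Hup 0 I); rewrite RecB (Re_realc 0).
  by move=> /andP[? _]; lra.
have [||x Hx Ex] := IVT _ cont (v := - c); first by lra.
  by rewrite ge_min h1 le_max h2 orbT.
have h3 := Gmap_near (Hup x Hx).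
have hx : -1 < x < 0.
  move: h3 => /Re_bounds; rewrite RecB Ex (Re_realc x).
  by move=> /andP[? ?]; lra.
exists x => //; apply: complex_ext; rewrite ?Ex // Gmap_real; [by []|lra|exact: Hup].
Qed.

End Map.

(** * The slit map *)

Section SlitMap.
Variable R : realType.
Local Open Scope ring_scope.
Local Notation C := R[i].
Implicit Types z w u : C.
Variables (tau : nat -> bool) (site : nat -> nat).
Local Notation G := (@Gmap R tau site).

(** The translation makes the real and imaginary parts positive, which allows natural
    numbers to approximate them. *)
Definition kap : C := 20 +i* 20.
Definition slit_map z := kap + G (Mhd z) ^+ 2.

Lemma Mhd_upper z : normc z <= 1 -> upper_disk (Mhd z).
Proof. by move=> Hz; split; [exact: Mhd_Im_ge0 | exact: Mhd_norm]. Qed.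

Lemma Gmap_norm w : upper_disk w -> normc (G w) <= 67 / 64.
Proof.
move=> Hw; have := Gmap_near tau site Hw; have [_ h] := Hw.
by have := normcD (G w - w) w; rewrite subrK; lra.
Qed.

Lemma slit_map_bounded z : normc z <= 1 -> normc (slit_map z - kap) <= 2.
Proof.
move=> /Mhd_upper /Gmap_norm h; rewrite /slit_map addrAC subrr add0r normcX.
by have := normc_ge0 (G (Mhd z)); nra.
Qed.

(** Hoelder continuity of exponent [1 / 2] on the closed disk: the modulus of continuity
    that the algorithm uses. *)
Lemma slit_map_dist z w : normc z <= 1 -> normc w <= 1 ->
  normc (slit_map z - slit_map w) ^+ 2 <= 2 ^+ 8 * normc (z - w).
Proof.
move=> Hz Hw; have Uz := Mhd_upper Hz; have Uw := Mhd_upper Hw.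
have h1 := Gmap_lipschitz tau site Uz Uw.
have h2 : normc (G (Mhd z) + G (Mhd w)) <= 67 / 32.
  have := normcD (G (Mhd z)) (G (Mhd w)); have := Gmap_norm Uz; have := Gmap_norm Uw; lra.
have h3 := Mhd_dist Hz Hw.
have -> : slit_map z - slit_map w = (G (Mhd z) - G (Mhd w)) * (G (Mhd z) + G (Mhd w)).
  by rewrite /slit_map; move: kap (G _) (G _) => k p q; ring.
rewrite normcM; have h4 : normc (G (Mhd z) - G (Mhd w)) * normc (G (Mhd z) + G (Mhd w)) <=
    3 * normc (Mhd z - Mhd w).
  have := normc_ge0 (G (Mhd z) - G (Mhd w)); have := normc_ge0 (Mhd z - Mhd w).
  have := normc_ge0 (G (Mhd z) + G (Mhd w)); nra.
have h5 : (normc (G (Mhd z) - G (Mhd w)) * normc (G (Mhd z) + G (Mhd w))) ^+ 2 <=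
    (3 * normc (Mhd z - Mhd w)) ^+ 2.
  by rewrite ler_sqr ?nnegrE ?mulr_ge0 ?normc_ge0.
have -> : 2 ^+ 8 = 16 * 16 :> R by ring.
apply: le_trans h5 _; rewrite exprMn.
by have := normc_ge0 (z - w); lra.
Qed.

(** Equal squares are equal up to the sign, and the sign is fixed by the positive
    imaginary part of [G]. *)
Lemma slit_map_inj z w : normc z < 1 -> normc w < 1 -> slit_map z = slit_map w -> z = w.
Proof.
move=> Hz Hw /addrI /eqP; rewrite eqf_sqr.
have Uz := Mhd_upper (ltW Hz); have Uw := Mhd_upper (ltW Hw).
have pz := Gmap_Im_gt0 tau site Uz (Mhd_Im_gt0 Hz).
have pw := Gmap_Im_gt0 tau site Uw (Mhd_Im_gt0 Hw).
case/orP => /eqP E; last first.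
  have EN : Im (- G (Mhd w)) = - Im (G (Mhd w)) by case: (G (Mhd w)).
  by exfalso; move: pz; rewrite E EN; lra.
have h := Gmap_expand tau site Uz Uw; rewrite E subrr normc0 mulr0 in h.
have M0 : normc (Mhd z - Mhd w) = 0 by apply: le_anti; rewrite h normc_ge0.
have E' : Mhd z = Mhd w by exact: subr0_eq (eq0_normc M0).
exact: (Mhd_inj (ltW Hz) (ltW Hw) E').
Qed.

Lemma Mhd_cdiff z : normc z < 1 -> cdiff (@Mhd R) z.
Proof.
move=> Hz.
have pos : 0 < Im ('i%C * (1 + z)) /\ 0 < Im ('i%C * (1 - z)).
  move: (le_lt_trans (abs_Re_le z) Hz); rewrite ltr_norml => /andP[].
  by case: z {Hz} => x y /=; split; lra.
have HS : cdiff (@Sroot R) z.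
  apply: (@cdiff_comp _ (fun u => 'i%C * (1 + u)) (@rt R)); last by apply: cdiff_rt; case: pos.
  by apply: cdiff_mul; [exact: cdiff_const | apply: cdiff_add; [exact: cdiff_const | exact: cdiff_id]].
have HT : cdiff (@Troot R) z.
  apply: (@cdiff_comp _ (fun u => 'i%C * (1 - u)) (@rt R)); last by apply: cdiff_rt; case: pos.
  apply: cdiff_mul; [exact: cdiff_const | apply: cdiff_add; [exact: cdiff_const |]].
  rewrite (_ : -%R = fun u : C => -1 * u); last by apply/funext => u; rewrite mulN1r.
  by apply: cdiff_mul; [exact: cdiff_const | exact: cdiff_id].
have HT' : cdiff (fun u => om R * Troot u) z by apply: cdiff_mul HT; apply: cdiff_const.
suff H : cdiff (fun u => (om R * Troot u - Sroot u) / Mden u) z.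
  by apply: cdiff_ext H _ => u; rewrite MhdE.
apply: cdiff_mul.
  apply: cdiff_add => //.
  rewrite (_ : (fun u => - Sroot u) = fun u : C => -1 * Sroot u).
    by apply: cdiff_mul HS; apply: cdiff_const.
  by apply/funext => u; rewrite mulN1r.
apply: (@cdiff_comp _ (@Mden R) (fun u => u^-1)); first exact: cdiff_add.
by apply: cdiff_inv; apply: Mden_neq0; apply: ltW.
Qed.

Lemma slit_map_cdiff z : normc z < 1 -> cdiff slit_map z.
Proof.
move=> Hz; apply: cdiff_add; first exact: cdiff_const.
have H : cdiff (fun u => G (Mhd u)) z.
  apply: cdiff_comp (Mhd_cdiff Hz) _.
  by apply: Gmap_cdiff; [exact: Mhd_Im_gt0 | exact: Mhd_norm_lt].
by apply: cdiff_ext (cdiff_mul H H) _ => u; rewrite expr2.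
Qed.

Hypothesis site_inj : forall j k, tau j -> tau k -> site j = site k -> j = k.
Section Site.
Variable j : nat.
Hypothesis tj : tau j.
Let n := site j.
Let r : R := rad R n.
Let P := G (center R n)%:C.
Let b := Im P.
Let a := Re P.

(** [P] is the top of the bump and [b] its height; [a] is close to the site. *)
Lemma siteE : [/\ 0 < r <= 1 / 16, 0 < b, b <= r / 1000, b = 2 ^- (j + 10) * r ^+ 3
  & 7 / 16 <= a <= 7 / 8].
Proof.
have r0 : 0 < r := rad_gt0 R n; have r1 : r <= 1 / 16 := rad_le R n.
have Eb : b = 2 ^- (j + 10) * r ^+ 3 by exact: Gmap_center.
have w0 : 0 < 2 ^- (j + 10) :> R := exp2_gt0 R _.
have w1 : 2 ^- (j + 10) <= 1 / 32 * (1 / 32) :> R.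
  have /andP[_ h] := weight_scale_val R; apply: le_trans h.
  by rewrite lef_pV2 ?posrE ?exprn_gt0 // ler_weXn2l ?ler1n // leq_addl.
have r3 : r ^+ 3 <= r.
  have h : r ^+ 2 <= 1 by rewrite expr2; nra.
  by rewrite exprS ler_piMr // ltW.
have r30 : 0 < r ^+ 3 by rewrite exprn_gt0.
have [_ _ hc] := site_bounds R n.
have := Gmap_near tau site (center_upper R n).
move=> /Re_bounds; rewrite RecB Re_realc -/P -/a => ha.
have b0 : 0 < b by rewrite Eb mulr_gt0.
have b1 : b <= r / 1000.
  rewrite Eb; have : 2 ^- (j + 10) * r ^+ 3 <= 1 / 32 * (1 / 32) * r.
    by apply: ler_pM => //; apply: ltW.
  by lra.
by split=> //; [apply/andP; split | case/andP: ha; case/andP: hc => *; apply/andP; split; lra].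
Qed.

(** The lens between the two sides of the slit.  A point of the image just above
    [a ^ 2] would come from a square root close to [a] with a positive imaginary part,
    hence from a point of the half disk close to the site, but there [Gmap_lift] makes
    the imaginary part at least [b / 8]. *)
Lemma slit_map_gap z : normc z < 1 ->
  normc (slit_map z - (kap + (a ^+ 2)%:C)) < r / 16 ->
  ~ (0 < Im (slit_map z - kap) < a * b / 16).
Proof.
have [/andP[r0 r1] b0 br Eb /andP[a0 a1]] := siteE.
move=> Hz; have Uz := Mhd_upper (ltW Hz).
have -> : slit_map z - (kap + (a ^+ 2)%:C) = (G (Mhd z) - a%:C) * (G (Mhd z) + a%:C).
  have -> : (a ^+ 2)%:C = a%:C * a%:C by rewrite -rmorphM expr2.
  by rewrite /slit_map; move: kap (G (Mhd z)) (a%:C) => k p q; ring.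
rewrite normcM => h1; rewrite {1}/slit_map addrAC subrr add0r.
have pz := Gmap_Im_gt0 tau site Uz (Mhd_Im_gt0 Hz).
have EI : Im (G (Mhd z) ^+ 2) = 2 * (Re (G (Mhd z)) * Im (G (Mhd z))).
  by rewrite expr2 ImcM; ring.
rewrite EI => /andP[h2 h3].
have X0 : 0 < Re (G (Mhd z)).
  by rewrite ltNge; apply/negP => h; nra.
have h4 : a <= normc (G (Mhd z) + a%:C).
  have := abs_Re_le (G (Mhd z) + a%:C); rewrite RecD Re_realc ger0_norm; lra.
have h5 : normc (G (Mhd z) - a%:C) <= r / 7.
  have := normc_ge0 (G (Mhd z) - a%:C); nra.
have hP : normc (G (Mhd z) - P) <= r / 7 + b.
  have -> : G (Mhd z) - P = (G (Mhd z) - a%:C) - 'i%C * b%:C.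
    by rewrite [P]complexE -/a -/b; move: (G _) (a%:C) (b%:C) => k p q; ring.
  rewrite (le_trans (normcD _ _)) // normc_opp normcM normcR ger0_norm; last by lra.
  by rewrite normc_i; lra.
have hw : normc (Mhd z - (center R n)%:C) <= r / 2.
  rewrite (le_trans (Gmap_expand tau site Uz (center_upper R n))) //; lra.
have := Gmap_lift tj Uz hw; rewrite -/n -/r -Eb => h6.
have h7 : a / 2 <= Re (G (Mhd z)).
  by have /Re_bounds := h5; rewrite RecB Re_realc => /andP[]; lra.
have ab0 : 0 < a * b by rewrite mulr_gt0 //; lra.
have : a / 2 * (b / 8) <= Re (G (Mhd z)) * Im (G (Mhd z)).
  by rewrite ler_pM //; lra.
lra.
Qed.

Lemma slit_map_upper_side : exists2 z, normc z = 1 &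
  slit_map z = kap + ((a ^+ 2 - b ^+ 2) +i* (2 * a * b)).
Proof.
have [_ _ hc] := site_bounds R n.
have [|z Hz Ez] := @Mhd_onto_segment R (center R n); first by lra.
exists z => //; rewrite /slit_map Ez -/P; congr (_ + _).
by apply: complex_ext; rewrite expr2 ?RecM ?ImcM -/a -/b /=; ring.
Qed.

(** The preimage lies on the negative half of the segment, where [Gmap] is real. *)
Lemma slit_map_lower_side : exists2 z, normc z = 1 & slit_map z = kap + (a ^+ 2)%:C.
Proof.
have [_ _ _ _ ha] := siteE.
have [|x hx Ex] := @Gmap_onto R tau site a; first by lra.
have [|z Hz Ez] := @Mhd_onto_segment R x; first by lra.
by exists z => //; rewrite /slit_map Ez Ex rmorphN sqrrN rmorphXn.
Qed.

End Site.
End SlitMap.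

(** * Topology of the complex plane *)

Section Topology.
Variable R : realType.
Local Open Scope ring_scope.
Local Open Scope classical_set_scope.
Local Notation CR := (Defs.C R).

Lemma closure_normc (A : set CR) (z : CR) :
  closure A z <-> forall e : R, 0 < e -> exists2 a, A a & normc (a - z) < e.
Proof.
split=> [H e e0|H B /nbhs_normc[e e0 He]].
  have [|a [Aa Ba]] := H [set u | normc (u - z) < e].
    by apply/nbhs_normc; exists e.
  by exists a.
by have [a Aa Ha] := H e e0; exists a; split=> //; apply: He.
Qed.

Lemma unit_diskE (z : CR) : unit_disk R z <-> normc z < 1.
Proof.
rewrite /unit_disk /= normrc; have -> : (1 : CR) = 1%:C by [].
by rewrite ltcR.
Qed.

Lemma closure_unit_disk (z : CR) : closure (unit_disk R) z -> normc z <= 1.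
Proof.
move=> /closure_normc H; apply/ler_addgt0Pr => e /H[a /unit_diskE a1 az].
by have := normcD (z - a) a; rewrite subrK normc_dist; lra.
Qed.

Lemma closure_unit_disk_sub (z : CR) : normc z <= 1 -> closure (unit_disk R) z.
Proof.
move=> z1; apply/closure_normc => e e0.
pose t := Num.min 1 (e / 2).
have [t0 t1 te] : [/\ 0 < t, t <= 1 & t < e].
  rewrite /t; case: (leP 1 (e / 2)) => h; split=> //; lra.
exists ((1 - t)%:C * z).
  apply/unit_diskE; rewrite normcM normcR ger0_norm; last by lra.
  by have := normc_ge0 z; nra.
have -> : (1 - t)%:C * z - z = - (t%:C * z) by rewrite rmorphB rmorph1; ring.
by rewrite normc_opp normcM normcR ger0_norm; [have := normc_ge0 z; nra | lra].
Qed.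

Lemma closure_image_disk (f : CR -> CR) (K : R) (z : CR) : 0 < K ->
  (forall u v : CR, normc u <= 1 -> normc v <= 1 ->
     normc (f u - f v) ^+ 2 <= K * normc (u - v)) ->
  normc z <= 1 -> closure (f @` unit_disk R) (f z).
Proof.
move=> K0 Hf z1; apply/closure_normc => e e0.
have ek : 0 < e ^+ 2 / K by rewrite divr_gt0 // exprn_gt0.
have /closure_normc /(_ _ ek) [a a1 az] := closure_unit_disk_sub z1.
exists (f a); first by exists a.
have a1' : normc a <= 1 by move/unit_diskE: a1; lra.
rewrite -(@ltr_sqr R) ?nnegrE ?normc_ge0 // ?(ltW e0) //.
rewrite (le_lt_trans (Hf _ _ a1' z1)) //.
by move: az; rewrite ltr_pdivlMr // mulrC.
Qed.

Lemma disk_continuous (f : CR -> CR) (K : R) : 0 < K ->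
  (forall u v : CR, normc u <= 1 -> normc v <= 1 ->
     normc (f u - f v) ^+ 2 <= K * normc (u - v)) ->
  {within closure (unit_disk R), continuous f}.
Proof.
move=> K0 Hf; apply/subspace_continuousP => z /closure_unit_disk z1.
apply/cvgrPdist_le => e /posc [e0 ->]; rewrite near_withinE.
have ek : 0 < Re e ^+ 2 / K by rewrite divr_gt0 // exprn_gt0.
apply/nbhs_normc; exists (Re e ^+ 2 / K) => // u uz /closure_unit_disk u1.
rewrite normrc lecR -(@ler_sqr R) ?nnegrE ?normc_ge0 // ?(ltW e0) //.
rewrite (le_trans (Hf _ _ z1 u1)) // normc_dist.
by move: uz => /ltW; rewrite ler_pdivlMr // mulrC.
Qed.

(** On the way from a point outside of the closure to a point of the closure, the
    first point of the closure belongs to the boundary. *)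
Lemma segment_boundary (D : set CR) (x y : CR) : ~ closure D x -> closure D y ->
  exists2 t : R, 0 <= t <= 1 & boundary D (x + t%:C * (y - x)).
Proof.
move=> + Dy; have [S SE] : exists S : set R,
    S = [set t : R | 0 <= t <= 1 /\ closure D (x + t%:C * (y - x))] by eexists.
have S1 : S 1.
  by rewrite SE; split; [rewrite ler01 lexx | rewrite mul1r addrCA subrr addr0].
have Slb : lbound S 0 by rewrite SE => t [/andP[h _] _]; exact: h.
have [d Ed] : exists d, d = inf S by exists (inf S).
have Snn : S !=set0 by exists 1.
have Slb' : has_lbound S by exists 0.
have Sinf : has_inf S := conj Snn Slb'.
have d0 : 0 <= d by rewrite Ed; exact: lb_le_inf Snn Slb.
have dS t : S t -> d <= t by rewrite Ed; exact: ge_inf Slb' t.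
have d1 := dS _ S1.
have [L L0 HL] : exists2 L : R, 0 < L & normc (y - x) <= L.
  by exists (normc (y - x) + 1); have := normc_ge0 (y - x); lra.
have move_t s t : normc ((x + s%:C * (y - x)) - (x + t%:C * (y - x))) <= `|s - t| * L.
  have -> : (x + s%:C * (y - x)) - (x + t%:C * (y - x)) = (s - t)%:C * (y - x).
    by rewrite rmorphB; ring.
  rewrite normcM normcR; apply: ler_wpM2l HL; exact: normr_ge0.
have Sd : closure D (x + d%:C * (y - x)).
  apply/closure_normc => e e0.
  have e1 : 0 < e / (2 * L) by rewrite divr_gt0 // mulr_gt0.
  have [t St td] := inf_adherent e1 Sinf; rewrite -Ed in td.
  have [_ /closure_normc Ht] : 0 <= t <= 1 /\ closure D (x + t%:C * (y - x)).
    by rewrite SE in St.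
  have [|a Da Ha] := Ht (e / 2); first by lra.
  exists a; first exact: Da.
  have dt := dS _ St.
  have := normcD (a - (x + t%:C * (y - x))) ((x + t%:C * (y - x)) - (x + d%:C * (y - x))).
  rewrite subrKA => h; rewrite (le_lt_trans h) //.
  have := move_t t d; rewrite ger0_norm ?subr_ge0 // => h2.
  have : (t - d) * L <= e / 2.
    rewrite -ler_pdivlMr // (_ : e / 2 / L = e / (2 * L)); first by lra.
    by field; rewrite gt_eqF.
  by lra.
move=> Dx; exists d; first by apply/andP; split.
split; first exact: Sd.
move: Dx => + /nbhs_normc[e e0 He].
case: (eqVneq d 0) => [E|dn0] => [|_].
  by apply; move: Sd; rewrite E mul0r addr0.
have d0' : 0 < d by rewrite lt_neqAle eq_sym dn0 d0.
pose s := Num.max 0 (d - e / (2 * L)).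
have e1 : 0 < e / (2 * L) by rewrite divr_gt0 // mulr_gt0.
have [s0 sd ds] : [/\ 0 <= s, s < d & d - s <= e / (2 * L)].
  by rewrite /s; case: (leP 0 (d - e / (2 * L))) => h; split; lra.
have : S s.
  rewrite SE; split; first by apply/andP; split; lra.
  apply: subset_closure; apply: He; rewrite (le_lt_trans (move_t _ _)) //.
  rewrite distrC ger0_norm; last by lra.
  rewrite -ltr_pdivlMr // (le_lt_trans ds) //.
  rewrite ltr_pM2l // ltf_pV2 ?posrE ?mulr_gt0 //; lra.
by move=> /dS; lra.
Qed.

End Topology.

(** * Boundary connectivity *)

Section Connectivity.
Variable R : realType.
Local Open Scope ring_scope.
Local Open Scope classical_set_scope.
Local Notation CR := (Defs.C R).
Variables (tau : nat -> bool) (site : nat -> nat).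
Hypothesis site_inj : forall j k, tau j -> tau k -> site j = site k -> j = k.
Let f : CR -> CR := slit_map tau site.

Lemma slit_map_conformal : conformal_on_disk f.
Proof.
split=> [z /unit_diskE z1|z w /set_mem/unit_diskE z1 /set_mem/unit_diskE w1].
  exact/cdiffP/slit_map_cdiff.
exact: slit_map_inj.
Qed.

Lemma slit_map_extension : boundary_extension f f.
Proof.
split=> //; apply: (@disk_continuous _ _ (2 ^+ 8)); first by rewrite exprn_gt0.
exact: slit_map_dist.
Qed.

Lemma Im_bounds (z : R[i]) (c : R) : normc z <= c -> - c <= Im z <= c.
Proof. by move=> h; rewrite -ler_norml (le_trans (abs_Im_le z)). Qed.

Lemma diameter_lt (A : set CR) (e : R) (x y : CR) :
  (diameter A < e%:E)%E -> A x -> A y -> normc (x - y) < e.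
Proof.
move=> Ae Ax Ay; rewrite -lte_fin; apply: le_lt_trans Ae.
by apply: ereal_sup_ubound; exists x => //; exists y.
Qed.

Lemma four_bumps (j n : nat) :
  4 * (2 ^- (j + 10) * rad R n ^+ 3) = 2 ^- (j + 3 * n + 20) :> R.
Proof.
have E : 2 ^+ 2 * 2 ^+ (j + 3 * n + 20) = 2 ^+ (j + 10) * (2 ^+ (n + 4)) ^+ 3 :> R.
  by rewrite -exprM -!exprD; congr (_ ^+ _); lia.
have E4 : 4 = 2 ^+ 2 :> R by ring.
have nz k : (2 : R) ^+ k != 0 by rewrite expf_neq0 // pnatr_eq0.
by rewrite /rad E4 exprVn -invfM -E invfM mulrA divff ?mul1r.
Qed.

Lemma rad32 (n : nat) : 2 ^- (n + 9) = rad R n / 32 :> R.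
Proof.
rewrite /rad (_ : n + 9 = n + 4 + 5)%N; last lia.
by rewrite exprD invfM; congr (_ * _); congr (_^-1); ring.
Qed.

Section Site.
Variable j : nat.
Hypothesis tj : tau j.
Let n := site j.
Let r : R := rad R n.
Let P := Gmap tau site (center R n)%:C.
Let b := Im P.
Let a := Re P.
Let D : set CR := f @` unit_disk R.
Let tip : CR := kap R + (a ^+ 2)%:C.

Lemma closure_gap (u : CR) : closure D u -> normc (u - tip) < r / 16 ->
  0 < Im (u - kap R) < a * b / 16 -> False.
Proof.
move=> /closure_normc Hu u1 /andP[u2 u3].
pose e := Num.min (r / 16 - normc (u - tip))
  (Num.min (Im (u - kap R)) (a * b / 16 - Im (u - kap R))).
have e0 : 0 < e by rewrite !lt_min u2 !subr_gt0 u1 u3.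
have [_ [z /unit_diskE z1 <-]] := Hu e e0.
rewrite !lt_min => /andP[h1 /andP[h2 h3]].
apply: (slit_map_gap site_inj tj z1).
  have h := normcD (f z - u) (u - tip); rewrite subrKA in h.
  by apply: le_lt_trans h _; rewrite -ltrBrDr.
have /Im_bounds : normc (f z - u) <= normc (f z - u) by exact: lexx.
rewrite -/(f z) -/P -/a -/b.
have -> : Im (f z - u) = Im (f z - kap R) - Im (u - kap R) by rewrite !ImcB; ring.
move: (Im (f z - kap R)) => X; move: (Im (u - kap R)) (normc (f z - u)) h2 h3 => Y N h2 h3.
by move=> /andP[h4 h5]; apply/andP; split; lra.
Qed.

(** Let [g0] be a point of the lens above [tip].  The segments from [g0] to the
    upper and to the lower side meet the boundary in points [p] and [q], one not below
    and one not above the level [d] of [g0], at a distance of at most [4 b].  If [g (n + 9)] were small, an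
    arc of diameter below [r / 32] would join them in the boundary; by the intermediate
    value theorem it would contain a point at the level [d], inside the lens. *)
Lemma slit_map_connectivity g : boundary_connectivity_function D g ->
  (j + 3 * n + 19 < g (n + 9))%N.
Proof.
move=> Hg; rewrite ltnNge; apply/negP => gm.
have [/andP[r0 r1] b0 br Eb /andP[a0 a1]] : [/\ 0 < r <= 1 / 16, 0 < b, b <= r / 1000,
    b = 2 ^- (j + 10) * r ^+ 3 & 7 / 16 <= a <= 7 / 8] := siteE R site_inj tj.
have ab0 : 0 < a * b by rewrite mulr_gt0 //; lra.
(* Half the height of the lens in [closure_gap]. *)
pose d := a * b / 32.
have d0 : 0 < d by rewrite /d; lra.
have db : d <= b by rewrite /d; nra.
pose g0 : CR := tip + d *i.
have [zu zu1 Ezu] : exists2 z : CR, normc z = 1 &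
    f z = kap R + ((a ^+ 2 - b ^+ 2) +i* (2 * a * b)) := slit_map_upper_side R tau site j.
have [zl zl1 Ezl] : exists2 z : CR, normc z = 1 & f z = tip :=
  slit_map_lower_side R site_inj tj.
have Ezut : f zu - tip = (- b ^+ 2) +i* (2 * a * b).
  by rewrite Ezu /tip; apply: complex_ext; rewrite /=; ring.
have Dimg z : normc z <= 1 -> closure D (f z).
  apply: (@closure_image_disk _ _ (2 ^+ 8)); first by rewrite exprn_gt0.
  exact: slit_map_dist.
have Du : closure D (f zu) by apply: Dimg; rewrite zu1.
have Dl : closure D (f zl) by apply: Dimg; rewrite zl1.
have g0tip : g0 - tip = d *i by rewrite /g0 addrAC subrr add0r.
have Im_tip u : Im (u - kap R) = Im (u - tip).
  by rewrite /tip opprD addrA [RHS]ImcB Im_realc subr0.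
have ng0 : normc (d *i) = d by rewrite /= expr0n add0r sqrtr_sqr ger0_norm // ltW.
have Dg0 : closure D g0 -> False.
  move=> /closure_gap; rewrite g0tip ng0 Im_tip g0tip /=; apply; first by lra.
  by rewrite d0 /= /d; lra.
have side (y : CR) : closure D y -> normc (y - tip) <= 2 * b -> exists t : R, [/\ 0 <= t <= 1,
    boundary D (g0 + t%:C * (y - g0)),
    normc (g0 + t%:C * (y - g0) - tip) <= 2 * b &
    Im (g0 + t%:C * (y - g0) - tip) = d + t * (Im (y - tip) - d)].
  move=> Dy ny; have [t /andP[t0 t1] Ht] := segment_boundary Dg0 Dy.
  move=> {Dg0 Dy}.
  have E : g0 + t%:C * (y - g0) - tip = (1 - t)%:C * (d *i) + t%:C * (y - tip).
    by rewrite -g0tip rmorphB rmorph1; ring.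
  exists t; split; [by rewrite t0 | exact: Ht | |].
    rewrite E (le_trans (normcD _ _)) // !normcM !normcR ng0 !ger0_norm ?subr_ge0 //.
    have := normc_ge0 (y - tip); nra.
  by rewrite E ImcD !Im_mulr /=; ring.
move=> {Dg0}; have [|s [s01 Bp np Ip]] := side _ Du.
  rewrite Ezut (le_trans (normc_le_ReIm _)) //= normrN !ger0_norm ?sqr_ge0 //; last by lra.
  by rewrite expr2; nra.
have [|t [t01 Bq nq Iq]] := side _ Dl.
  by rewrite Ezl subrr normc0; lra.
move: Bp Bq np nq Ip Iq; rewrite Ezl subrr.
set p := g0 + _; set q := g0 + _ => Bp Bq np nq Ip Iq.
move=> {Du Dl side}.
have Ip' : d <= Im (p - tip).
  rewrite Ip Ezut /=; case/andP: s01 => s0 s1.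
  by rewrite lerDl mulr_ge0 // subr_ge0 /d; lra.
have Iq' : Im (q - tip) <= d.
  by rewrite Iq /=; case/andP: t01 => t0 t1; nra.
have pq : normc (p - q) <= 4 * b.
  have -> : p - q = (p - tip) - (q - tip) by ring.
  by rewrite (le_trans (normcD _ _)) // normc_opp; lra.
have not_d (u : CR) : closure D u -> normc (u - tip) < r / 16 -> Im (u - tip) = d -> False.
  move=> Du hu Eu; apply: (closure_gap Du hu); rewrite Im_tip Eu d0 /d; lra.
have p16 : normc (p - tip) < r / 16 by lra.
have pq0 : p != q.
  apply/eqP => E; apply: (not_d p); [by case: Bp | by [] |].
  by apply: le_anti; rewrite Ip' andbT {1}E Iq'.
have pqC : 0 < `|p - q| <= 2 ^- g (n + 9)%N.
  rewrite normr_gt0 subr_eq0 pq0 /= normrc.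
  have -> : 2 ^- g (n + 9)%N = (2 ^- g (n + 9)%N : R)%:C :> CR.
    by rewrite fmorphV rmorphXn rmorph_nat.
  rewrite lecR (le_trans pq) // Eb.
  have -> : 4 * (2 ^- (j + 10) * r ^+ 3) = 2 ^- (j + 3 * n + 20) :> R.
    exact: four_bumps.
  by apply: exp2_le; apply: leq_trans gm _; rewrite leq_add2l.
have [A [Abd [gam [del [[cgam _] gA _ gam0 gam1]]] dA]] := Hg _ p q Bp Bq pqC.
have cont : {within `[0, 1], continuous (fun t : R => Im (gam t - tip))}.
  move/subspace_continuousP: cgam => cgam; apply/subspace_continuousP => x Ax.
  apply/cvgrPdist_le => e e0; have /cvgrPdist_le /(_ e%:C) := cgam x Ax.
  rewrite ltcR => /(_ e0); rewrite !near_withinE; apply: filterS => y h Ay.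
  have := h Ay; rewrite normrc lecR => /Im_bounds; rewrite -ler_norml !ImcB.
  by congr (`|_| <= _); ring.
have [|c c01 Ec] := IVT ler01 cont (v := d).
  by rewrite gam0 gam1 ge_min le_max Iq' Ip' orbT.
have Ac : A (gam c) by rewrite -gA; exists c.
have Ap : A p by rewrite -gA -gam0; exists 0 => //; rewrite /= in_itv /= lexx ler01.
have hc := diameter_lt dA Ac Ap.
apply: (not_d (gam c)) => //; first by case: (Abd _ Ac).
have := normcD (gam c - p) (p - tip); rewrite subrKA.
have E9 : 2 ^- (n + 9) = r / 32 :> R := rad32 n.
rewrite E9 in hc; move: hc np br; rewrite -/p -/q; lra.
Qed.

End Site.
End Connectivity.

(** * Computable families of complex numbers *)

Section ComplexNumbers.
Variable R : realType.
Local Open Scope ring_scope.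
Local Notation C := R[i].
Implicit Types (x y : seq nat -> C) (B : seq nat -> nat).

Definition capp x := rapp (fun e => Re (x e)) /\ rapp (fun e => Im (x e)).

Lemma capp_ext x y : capp x -> x =1 y -> capp y.
Proof. by move=> Hx /funext <-. Qed.

Lemma capp_real (u : seq nat -> R) : rapp u -> capp (fun e => (u e)%:C).
Proof.
move=> Hu; split=> //=; apply: rapp_ext (rapp_rat (rat_prec_nat R prec_zero)) _.
by move=> e.
Qed.

Lemma capp_nat (n : nat) : capp (fun=> n%:R).
Proof.
have -> : (fun=> n%:R) = (fun=> (n%:R : R)%:C) :> (seq nat -> C).
  by apply/funext => e; rewrite rmorph_nat.
exact/capp_real/rapp_rat/rat_prec_nat/prec_const.
Qed.

Lemma capp_i : capp (fun=> 'i%C).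
Proof.
split; apply: rapp_ext (rapp_rat (rat_prec_nat R (prec_const _))) _.
  by move=> e; apply: (_ : 0%:R = _).
by move=> e; apply: (_ : 1%:R = _).
Qed.

Lemma capp_add x y : capp x -> capp y -> capp (fun e => x e + y e).
Proof.
move=> [x1 x2] [y1 y2]; split.
  by apply: rapp_ext (rapp_add x1 y1) _ => e; rewrite RecD.
by apply: rapp_ext (rapp_add x2 y2) _ => e; rewrite ImcD.
Qed.

Lemma capp_opp x : capp x -> capp (fun e => - x e).
Proof.
move=> [x1 x2]; split.
  by apply: rapp_ext (rapp_opp x1) _ => e; case: (x e).
by apply: rapp_ext (rapp_opp x2) _ => e; case: (x e).
Qed.

Lemma capp_sub x y : capp x -> capp y -> capp (fun e => x e - y e).
Proof. by move=> Hx /capp_opp; apply: capp_add. Qed.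

Lemma capp_mul B x y : prec B -> (forall e, normc (x e) <= (B e)%:R) ->
  (forall e, normc (y e) <= (B e)%:R) -> capp x -> capp y -> capp (fun e => x e * y e).
Proof.
move=> HB Bx By [x1 x2] [y1 y2].
have r1 e := le_trans (abs_Re_le (x e)) (Bx e).
have r2 e := le_trans (abs_Im_le (x e)) (Bx e).
have r3 e := le_trans (abs_Re_le (y e)) (By e).
have r4 e := le_trans (abs_Im_le (y e)) (By e).
split.
  apply: rapp_ext (rapp_sub (rapp_mul HB r1 r3 x1 y1) (rapp_mul HB r2 r4 x2 y2)) _ => e.
  by rewrite RecM.
apply: rapp_ext (rapp_add (rapp_mul HB r1 r4 x1 y2) (rapp_mul HB r2 r3 x2 y1)) _ => e.
by rewrite ImcM.
Qed.

Lemma capp_conj x : capp x -> capp (fun e => (x e)^*%C).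
Proof.
move=> [x1 x2]; split; first by apply: rapp_ext x1 _ => e; case: (x e).
by apply: rapp_ext (rapp_opp x2) _ => e; case: (x e).
Qed.

Lemma rapp_normc B x : prec B -> (forall e, normc (x e) <= (B e)%:R) -> capp x ->
  rapp (fun e => normc (x e)).
Proof.
move=> HB Bx [x1 x2].
have r1 e := le_trans (abs_Re_le (x e)) (Bx e).
have r2 e := le_trans (abs_Im_le (x e)) (Bx e).
apply: rapp_ext (rapp_sqrt (rapp_add (rapp_mul HB r1 r1 x1 x1) (rapp_mul HB r2 r2 x2 x2))) _.
by move=> e; case: (x e).
Qed.

Lemma rapp_half (u : seq nat -> R) : rapp u -> rapp (fun e => u e / 2).
Proof.
move=> [a Ha Hu]; exists (fun e => a e * (1 / 2)).
  apply: rat_prec_mul Ha _; exists (fun=> 1%N), (fun=> 0%N), (fun=> 1%N).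
  by split=> [|||e]; [exact: prec_const..|rewrite subr0].
move=> e N; rewrite mul1r -mulrBl normrM [`|2^-1|]ger0_norm ?invr_ge0 //.
by have := Hu e N; have := normr_ge0 (u e - a (N :: e)); lra.
Qed.

Lemma capp_rt B x : prec B -> (forall e, normc (x e) <= (B e)%:R) -> capp x ->
  capp (fun e => rt (x e)).
Proof.
move=> HB Bx Hx; have Hn := rapp_normc HB Bx Hx; have [x1 _] := Hx.
split; first exact: rapp_sqrt (rapp_half (rapp_add Hn x1)).
exact: rapp_sqrt (rapp_half (rapp_sub Hn x1)).
Qed.

Lemma capp_div B x y : prec B -> (forall e, normc (x e) <= (B e)%:R) ->
  (forall e, normc (y e) <= (B e)%:R) -> (forall e, 1 <= normc (y e)) ->
  capp x -> capp y -> capp (fun e => x e / y e).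
Proof.
move=> HB Bx By y1 Hx Hy.
have nc (z : C) : normc z^*%C = normc z by case: z => a b /=; rewrite sqrrN.
have Byc e : normc (y e)^*%C <= (B e)%:R by rewrite nc.
have Hn := rapp_normc HB By Hy.
have Hn2 : rapp (fun e => (normc (y e) * normc (y e))^-1).
  apply: (@rapp_inv _ 0) (rapp_mul HB _ _ Hn Hn) => [e|e|e].
  - by rewrite expr0 invr1; have := y1 e; nra.
  - by rewrite ger0_norm ?normc_ge0.
  - by rewrite ger0_norm ?normc_ge0.
have HBB : prec (fun e => B e * B e + 1)%N by apply: prec_add (prec_mul HB HB) (prec_const 1).
have := capp_mul HBB _ _ (capp_mul HB Bx Byc Hx (capp_conj Hy)) (capp_real Hn2).
move=> H; apply: capp_ext (H _ _) _ => e.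
- rewrite normcM nc natrD natrM; have := ler_pM (normc_ge0 _) (normc_ge0 _) (Bx e) (By e); lra.
- rewrite normcR ger0_norm ?invr_ge0 ?mulr_ge0 ?normc_ge0 // natrD natrM.
  apply: (@le_trans _ _ 1); last by rewrite lerDr mulr_ge0.
  by rewrite invf_le1; have := y1 e; nra.
have y0 : y e != 0 by rewrite -normc_gt0 (lt_le_trans ltr01).
have n0 : normc (y e) != 0 by rewrite normc_eq0.
have E : y e * (y e)^*%C = (normc (y e) * normc (y e))%:C.
  rewrite -expr2 normc_sqr; case: (y e) => a b; apply: complex_ext => /=; ring.
apply: (mulIf y0); rewrite divfK // -!mulrA [_ * y e]mulrC mulrA mulrA.
by rewrite -[x e * _ * _]mulrA [_^*%C * _]mulrC E -mulrA -rmorphM divff ?rmorph1 ?mulr1 // mulf_neq0.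
Qed.

Lemma capp_subst x (r : seq nat -> seq nat) : capp x ->
  (forall i, prec (fun e => nth 0%N (r e) i)) -> capp (fun e => x (r e)).
Proof.
by move=> [x1 x2] Hr; split; [exact: (rapp_subst x1 Hr) | exact: (rapp_subst x2 Hr)].
Qed.

Lemma capp_drop k x : capp x -> capp (fun e => x (drop k e)).
Proof. by move=> Hx; apply: capp_subst => // i; apply: (prec_drop k (prec_var i)). Qed.

Lemma capp_sum n x : prec n -> capp x -> capp (fun e => \sum_(i < n e) x ((i : nat) :: e)).
Proof.
move=> Hn [x1 x2]; split.
  by apply: rapp_ext (rapp_sum Hn x1) _ => e; rewrite (Re_sum _ (fun i => x (i :: e))).
by apply: rapp_ext (rapp_sum Hn x2) _ => e; rewrite (Im_sum _ (fun i => x (i :: e))).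
Qed.

Lemma capp_lim x y : capp y -> (forall e N, normc (x e - y (N :: e)) <= 2 ^- N) -> capp x.
Proof.
move=> [y1 y2] H; split.
  by apply: rapp_lim y1 _ => e N; rewrite -RecB (le_trans (abs_Re_le _)).
by apply: rapp_lim y2 _ => e N; rewrite -ImcB (le_trans (abs_Im_le _)).
Qed.

(** ** The slit map *)

Lemma capp_om : capp (fun=> om R).
Proof.
by apply: (capp_rt (prec_const 1)) capp_i => e; rewrite normc_i.
Qed.

Section Disk.
Variable z : seq nat -> C.
Hypothesis Hz : capp z.
Hypothesis z1 : forall e, normc (z e) <= 1.

Lemma capp_roots : capp (fun e => Sroot (z e)) /\ capp (fun e => Troot (z e)).
Proof.
have b1 e : normc (1 + z e) <= 2%:R.
  by have := normcD 1 (z e); have := z1 e; rewrite normc1; lra.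
have b2 e : normc (1 - z e) <= 2%:R.
  by have := normcD 1 (- z e); have := z1 e; rewrite normc_opp normc1; lra.
have i2 : seq nat -> normc ('i%C : C) <= 2%:R by move=> _; rewrite normc_i; lra.
have c1 : capp (fun=> 1) by exact: capp_nat 1.
split.
  apply: (capp_rt (prec_const 2)); first by move=> e; rewrite normcM normc_i mul1r.
  exact: (capp_mul (prec_const 2) i2 b1 capp_i (capp_add c1 Hz)).
apply: (capp_rt (prec_const 2)); first by move=> e; rewrite normcM normc_i mul1r.
exact: (capp_mul (prec_const 2) i2 b2 capp_i (capp_sub c1 Hz)).
Qed.

Lemma roots_norm e : normc (Sroot (z e)) <= 2 /\ normc (om R * Troot (z e)) <= 2.
Proof.
have b1 : normc ('i%C * (1 + z e)) <= 2.
  by rewrite normcM normc_i; have := normcD 1 (z e); have := z1 e; rewrite normc1; lra.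
have b2 : normc ('i%C * (1 - z e)) <= 2.
  rewrite normcM normc_i; have := normcD 1 (- z e); have := z1 e.
  by rewrite normc_opp normc1; lra.
rewrite normcM om_norm mul1r; split.
  by have := rt_norm ('i%C * (1 + z e)); have := normc_ge0 (Sroot (z e)); rewrite /Sroot; nra.
by have := rt_norm ('i%C * (1 - z e)); have := normc_ge0 (Troot (z e)); rewrite /Troot; nra.
Qed.

Lemma capp_Mhd : capp (fun e => Mhd (z e)).
Proof.
have [HS HT] := capp_roots.
have HoT : capp (fun e => om R * Troot (z e)).
  apply: (capp_mul (prec_const 2)) capp_om HT => e; first by rewrite om_norm; lra.
  by have [_] := roots_norm e; rewrite normcM om_norm mul1r.
suff H : capp (fun e => (om R * Troot (z e) - Sroot (z e)) / Mden (z e)).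
  by apply: capp_ext H _ => e; rewrite MhdE.
apply: (capp_div (prec_const 4)) (capp_sub HoT HS) (capp_add HoT HS) => e.
- by rewrite (le_trans (normcD _ _)) // normc_opp; have [] := roots_norm e; lra.
- by rewrite /Mden (le_trans (normcD _ _)) //; have [] := roots_norm e; lra.
- by have := Mden_norm (z1 e); have := normc_ge0 (Mden (z e)); nra.
Qed.

End Disk.

Section Bumps.
Variables (tau : nat -> bool) (site : nat -> nat).
Hypothesis Htau : prec (fun e => tau (nth 0%N e 0) : nat).
Hypothesis Hsite : prec (fun e => site (nth 0%N e 0)).
Variable w : seq nat -> C.
Hypothesis Hw : capp w.
Hypothesis w_upper : forall e, upper_disk (w e).

Lemma rat_prec_exp2 f : prec f -> rat_prec (fun e => 2 ^- f e : R).
Proof.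
move=> Hf; exists (fun=> 1%N), (fun=> 0%N), (fun e => (2 ^ f e).-1).
split; [exact: prec_const | exact: prec_const | exact: (prec_pred (prec_pow (prec_const 2) Hf)) |].
by move=> e; rewrite subr0 prednK ?expn_gt0 // natrX div1r.
Qed.

Lemma rat_prec_rad : rat_prec (fun e => rad R (site (nth 0%N e 0))).
Proof. by apply: rat_prec_exp2; apply: prec_add Hsite (prec_const 4). Qed.

Lemma rat_prec_center : rat_prec (fun e => center R (site (nth 0%N e 0))).
Proof.
apply: rat_prec_add.
  exists (fun=> 1%N), (fun=> 0%N), (fun=> 1%N).
  by split=> [|||e]; [exact: prec_const..|rewrite subr0].
exact: rat_prec_mul (rat_prec_nat R (prec_const 3)) rat_prec_rad.
Qed.

Lemma capp_bump_term : capp (fun e => bump_term tau site (nth 0%N e 0) (w (drop 1 e))).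
Proof.
have Hwd := capp_drop 1 Hw.
have Ha := rat_prec_add rat_prec_center (rat_prec_opp rat_prec_rad).
have Hb := rat_prec_add rat_prec_center rat_prec_rad.
have side (a : seq nat -> R) : rat_prec a -> (forall e, 0 <= a e <= 1) ->
    capp (fun e => rt (w (drop 1 e) - (a e)%:C)) /\
    forall e, normc (rt (w (drop 1 e) - (a e)%:C)) <= 2%:R.
  move=> Ha' a01; split.
    apply: (capp_rt (prec_const 2)) (capp_sub Hwd (capp_real (rapp_rat Ha'))) => e.
    have [_ h] := w_upper (drop 1 e); have /andP[h0 h1] := a01 e.
    have := normcD (w (drop 1 e)) (- (a e)%:C); rewrite normc_opp normcR ger0_norm //; lra.
  move=> e; have [_ h] := upper_disk_shift (w_upper (drop 1 e)) (a01 e); lra.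
have hA e : 0 <= center R (site (nth 0%N e 0)) + - rad R (site (nth 0%N e 0)) <= 1.
  by have [] := site_bounds R (site (nth 0%N e 0)).
have hB e : 0 <= center R (site (nth 0%N e 0)) + rad R (site (nth 0%N e 0)) <= 1.
  by have [] := site_bounds R (site (nth 0%N e 0)).
have [Ha1 Ha2] := side _ Ha hA; have [Hb1 Hb2] := side _ Hb hB.
set s := (fun e : seq nat => rt (w (drop 1 e) - _)) in Ha1 Ha2.
set t := (fun e : seq nat => rt (w (drop 1 e) - _)) in Hb1 Hb2.
have bound4 e : normc (s e * t e) <= 4%:R.
  by rewrite normcM; have := Ha2 e; have := Hb2 e; have := normc_ge0 (s e);
    have := normc_ge0 (t e); rewrite -/(s e) -/(t e); nra.
have Hst : capp (fun e => s e * t e) by exact: (capp_mul (prec_const 2) Ha2 Hb2 Ha1 Hb1).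
have Hst2 := capp_mul (prec_const 4) bound4 bound4 Hst Hst.
have bound16 e : normc (s e * t e * (s e * t e)) <= 16%:R.
  by rewrite normcM; have := bound4 e; have := normc_ge0 (s e * t e); nra.
have bound4' e : normc (s e * t e) <= 16%:R by have := bound4 e; lra.
have Hst3 := capp_mul (prec_const 16) bound4' bound16 Hst Hst2.
have Hwt : rapp (fun e => weight R tau (nth 0%N e 0)).
  apply: rapp_rat (rat_prec_mul (rat_prec_nat R Htau) _).
  exact: rat_prec_exp2 (prec_add (prec_var 0) (prec_const 10)).
have bound64 e : normc (s e * t e * (s e * t e * (s e * t e))) <= 64%:R.
  rewrite normcM; have := bound4 e; have := normc_ge0 (s e * t e).
  by have := bound16 e; have := normc_ge0 (s e * t e * (s e * t e)); nra.
have bound1 (e : seq nat) : normc (weight R tau (nth 0%N e 0))%:C <= 64%:R.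
  rewrite normcR /weight normrM normr_nat [`|2 ^- _|]ger0_norm ?(ltW (exp2_gt0 _ _)) //.
  apply: (@le_trans _ _ (1 * 1)); last by lra.
  rewrite ler_pM ?ler0n ?(ltW (exp2_gt0 _ _)) //; first by case: (tau _).
  exact: exp2_le1.
apply: capp_ext (capp_opp (capp_mul (prec_const 64) bound1 bound64 (capp_real Hwt) Hst3)) _ => e.
rewrite /bump_term /bump_at /bump -[X in rt (_ - X%:C) * _]/(_ + _) -/(s e) -/(t e).
by move: (s e * t e) (_%:C) => p q; ring.
Qed.

(** The partial sums are uniformly computable, and [csum_tail] bounds the rest. *)
Lemma capp_Gmap : capp (fun e => Gmap tau site (w e)).
Proof.
pose y e := w e + csum (fun j => bump_term tau site j (w e)).
suff H : capp y by apply: capp_ext H _ => e; rewrite GmapE.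
apply: (capp_add Hw).
apply: (@capp_lim _ (fun e => \sum_(j < nth 0%N e 0) bump_term tau site j (w (drop 1 e)))).
  have H : capp (fun e => bump_term tau site (nth 0%N e 0) (w (drop 2 e))).
    have := @capp_subst _ (fun e => nth 0%N e 0 :: drop 2 e) capp_bump_term.
    move=> /(_ _)/capp_ext; apply=> [[|i]|e] /=; [exact: prec_var| |by rewrite drop0].
    exact: (prec_drop 2 (prec_var i)).
  by apply: capp_ext (capp_sum (prec_var 0) H) _ => e; apply: eq_bigr => j _.
move=> e N; rewrite /= drop0.
apply: le_trans (csum_tail N (bump_term_dominated tau site (w_upper e))) _.
rewrite -[X in _ <= X]mul1r ler_wpM2r ?(ltW (exp2_gt0 _ _)) //.
by have /andP[] := weight_scale_val R; lra.
Qed.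

End Bumps.

Lemma capp_slit_map (tau : nat -> bool) (site : nat -> nat) (z : seq nat -> C) :
  prec (fun e => tau (nth 0%N e 0) : nat) -> prec (fun e => site (nth 0%N e 0)) ->
  capp z -> (forall e, normc (z e) <= 1) -> capp (fun e => slit_map tau site (z e)).
Proof.
move=> Htau Hsite Hz z1.
have HG := capp_Gmap Htau Hsite (capp_Mhd Hz z1) (fun e => Mhd_upper (z1 e)).
have b e : normc (Gmap tau site (Mhd (z e))) <= 2%:R.
  by have := @Gmap_norm _ tau site _ (Mhd_upper (z1 e)); lra.
have Hk : capp (fun=> kap R) by split; apply: rapp_rat; exact: rat_prec_nat (prec_const 20).
exact: capp_add Hk (capp_mul (prec_const 2) b b HG HG).
Qed.

End ComplexNumbers.

(** * Turing machines on rational rectangles *)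

Lemma tm_computes_unique M ws vs vs' : size vs = size vs' ->
  tm_computes M ws vs -> tm_computes M ws vs' -> vs = vs'.
Proof.
move=> Hsize [c [[n Hn] Hc] <-] [c' [[n' Hn'] Hc'] <-].
suff -> : c = c' by rewrite Hsize.
wlog nn : n n' c c' Hn Hc Hn' Hc' / n <= n'.
  move=> H; case: (leqP n n') => [|/ltnW] nn; first exact: (H n n').
  by apply/esym; apply: (H n' n).
move: Hn'; rewrite -(subnK nn) iterD Hn.
case: (n' - n)%N => [[]|m] //=; rewrite -iterS iterSr /= Hc.
by have -> : iter m (obind (tm_step (M:=M))) None = None by elim: m => //= m ->.
Qed.

Lemma int_word_inj : injective int_word.
Proof.
have H m n : nat_word m = nat_word n -> m = n by move=> /(congr1 size); rewrite !size_nseq.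
move=> [m|m] [n|n] /=; first by move/H ->.
- by case: m.
- by case: n.
- by case=> /H ->.
Qed.

Lemma rat_words_inj (p q : rat) : int_word (numq p) = int_word (numq q) ->
  int_word (denq p) = int_word (denq q) -> p = q.
Proof. by move=> /int_word_inj E /int_word_inj D; rewrite -[p]divq_num_den E D divq_num_den. Qed.

Lemma rect_words_inj Q Q' : rect_words Q = rect_words Q' ->
  [/\ rect_a Q = rect_a Q', rect_b Q = rect_b Q', rect_c Q = rect_c Q' & rect_d Q = rect_d Q'].
Proof. by case=> *; split; apply: rat_words_inj. Qed.

Definition rect_ints (Q : rat_rect) : seq int :=
  flatten [seq [:: numq q; denq q] | q <- [:: rect_a Q; rect_b Q; rect_c Q; rect_d Q]].

Lemma dyadic_num_den m k : odd m ->
  numq (m%:R / (2 ^ k)%:R) = m /\ denq (m%:R / (2 ^ k)%:R) = (2 ^ k)%N.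
Proof.
move=> Hm; have H : coprime m (2 ^ k) by rewrite coprimeXr // coprimen2.
have := @coprimeq_num m (2 ^ k)%N H; have := @coprimeq_den m (2 ^ k)%N H.
rewrite eqz_nat expn_eq0 /= gtr0_sg ?ltz_nat ?expn_gt0 // mul1r => D E.
by rewrite -!pmulrn in D E; rewrite D E.
Qed.

(** The search for the largest index at which a decreasing predicate holds. *)
Lemma count_decreasing (P : nat -> bool) B : (forall i, P i.+1 -> P i) ->
  let s := \sum_(i < B) P i.+1 in
  (s <= B) /\ (0 < s -> P s) /\ (forall i, i <= B -> P i -> i <= s).
Proof.
move=> HP /=.
have anti i j : i <= j -> P j -> P i.
  by move=> /subnK <-; elim: (j - i) => // d IH /HP.
elim: B => [|B [s1 [s2 s3]]]; first by rewrite big_ord0; split=> //; split=> // i; lia.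
rewrite big_ord_recr /=; case E : (P B.+1); split; first lia.
- split; first by rewrite addn1 => _; apply: anti E.
  move=> i iB Pi; case: (leqP i B) => iB'; first by have := s3 i iB' Pi; lia.
  by have := s3 B (leqnn _) (HP _ E); lia.
- lia.
- split; first by rewrite addn0.
  move=> i; rewrite leq_eqVlt => /orP[/eqP ->|]; first by rewrite E.
  by rewrite addn0; apply: s3.
Qed.

(** * Halting times *)

(** The index [pairn n s] records that the machine with code [n] halts on [n + 9] after
    exactly [s] steps.  Not every number is a pair, which the second condition takes into
    account. *)
Definition halting_index j :=
  univ_halts_at (fstn j) (fstn j + 9) (sndn j) && (pairn (fstn j) (sndn j) == j).

Lemma halting_index_inj j k : halting_index j -> halting_index k -> fstn j = fstn k -> j = k.
Proof.
move=> /andP[Hj /eqP Ej] /andP[Hk /eqP Ek] E; rewrite -Ej -Ek; rewrite E in Hj *.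
by rewrite (univ_halts_at_unique Hj Hk).
Qed.

Lemma prec_halting_index : prec (fun e => halting_index (nth 0 e 0) : nat).
Proof.
have Hf := prec_fstn (prec_var 0); have Hs := prec_sndn (prec_var 0).
apply: prec_and; first exact: prec_univ_halts_at Hf (prec_add Hf (prec_const 9)) Hs.
exact: prec_eq (prec_pairn Hf Hs) (prec_var 0).
Qed.

(** If the machine with code [n] computes [g] and halts on [n + 9] after [s] steps, then
    [g (n + 9)] is at most [n + s + 10], which is below [pairn n s + 3 n + 19]. *)
Lemma halting_growth g : (forall j, halting_index j -> j + 3 * fstn j + 19 < g (fstn j + 9)) ->
  ~ computable_nat_fun g.
Proof.
move=> H /computable_halting_time[n /(_ (n + 9))[s [Hs Hg]]].
have := H (pairn n s); rewrite /halting_index fstnK sndnK Hs eqxx => /(_ isT).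
by rewrite /pairn; nia.
Qed.

(** * Computing the map on rational rectangles *)

Section RationalFamilies.
Variable R : rcfType.
Local Open Scope ring_scope.
Implicit Types a b : seq nat -> R.

Lemma rat_prec_bound a : rat_prec a -> exists2 B, prec B & forall e, `|a e| <= (B e)%:R.
Proof.
move=> [p [q [v [Hp Hq Hv Ha]]]]; exists (fun e => p e + q e)%N; first exact: prec_add.
move=> e; rewrite Ha normrM [`|_^-1|]ger0_norm ?invr_ge0 // ler_pdivrMr // natrD.
rewrite (le_trans (ler_normB _ _)) // !normr_nat ler_peMr ?addr_ge0 // ler1n //.
Qed.

Lemma prec_nneg a : rat_prec a -> prec (fun e => nat_of_bool (0 <= a e)).
Proof.
move=> [p [q [v [Hp Hq Hv Ha]]]]; apply: prec_ext (prec_leq Hq Hp) _ => e.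
by rewrite Ha pmulr_lge0 ?invr_gt0 ?ltr0Sn // subr_ge0 ler_nat.
Qed.

Lemma rat_prec_floor a : rat_prec a ->
  exists2 u, prec u & forall e, 0 <= a e -> (u e)%:R <= a e < (u e).+1%:R.
Proof.
move=> [p [q [v [Hp Hq Hv Ha]]]]; exists (fun e => (p e - q e) %/ (v e).+1)%N.
  exact: prec_div (prec_sub Hp Hq) (prec_succ Hv).
move=> e; rewrite Ha pmulr_lge0 ?invr_gt0 ?ltr0Sn // subr_ge0 ler_nat => H.
rewrite -natrB // ler_pdivlMr ?ltr0Sn // ltr_pdivrMr ?ltr0Sn // -!natrM ler_nat ltr_nat.
by rewrite leq_trunc_div ltn_ceil.
Qed.

End RationalFamilies.

Section Rectangles.
Variable R : realType.
Local Open Scope ring_scope.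
Local Open Scope classical_set_scope.
Local Notation CR := (Defs.C R).

(** ** Projection to the disk *)

(** A corner of the input rectangle can lie outside of the disk.  It is scaled back
    into the disk; compared to a point of the disk, this at most doubles the
    distance. *)
Definition disk_proj (z : R[i]) : R[i] := z * ((Num.max 1 (normc z))^-1)%:C.

Lemma disk_proj_norm z : normc (disk_proj z) <= 1.
Proof.
have m1 : 1 <= Num.max 1 (normc z) by rewrite le_max lexx.
have m0 : 0 < Num.max 1 (normc z) by rewrite (lt_le_trans _ m1).
rewrite normcM normcR ger0_norm ?invr_ge0 ?(ltW m0) // ler_pdivrMr // mul1r.
by rewrite le_max lexx orbT.
Qed.

Lemma disk_proj_dist u z : normc u <= 1 -> normc (u - disk_proj z) <= 2 * normc (u - z).
Proof.
move=> u1; have -> : u - disk_proj z = (u - z) + (z - disk_proj z) by ring.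
rewrite (le_trans (normcD _ _)) // mulr_natl mulr2n lerD2l.
have -> : z - disk_proj z = z * (1 - (Num.max 1 (normc z))^-1)%:C.
  by rewrite /disk_proj rmorphB /= mulrBr mulr1.
have tri : normc z <= normc u + normc (u - z).
  by have := normcD u (z - u); rewrite [u + _]addrC subrK normc_dist.
have := normc_ge0 (u - z); move: (normc (u - z)) tri => d tri d0.
rewrite normcM normcR; case: (leP 1 (normc z)) => z1; last by rewrite invr1 subrr normr0 mulr0.
have z0 : 0 < normc z by lra.
rewrite ger0_norm ?subr_ge0 ?invf_le1 // mulrBr mulr1 divff ?gt_eqF //; lra.
Qed.

Lemma capp_disk_proj (a c : seq nat -> R) : rat_prec a -> rat_prec c ->
  capp (fun e => disk_proj (a e +i* c e)).
Proof.
move=> Ha Hc.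
have rmax (x : R) : Num.max 1 (Num.sqrt x) = Num.sqrt (1 + Num.max (x + - 1) 0).
  case: (leP 1 (Num.sqrt x)) => H.
    have x0 : 0 <= x.
      by case: (leP 0 x) => // /ltW x0; move: H; rewrite ler0_sqrtr //; lra.
    have x1 : 1 <= x by have := sqr_sqrtr x0; nra.
    by rewrite max_l ?subr_ge0 //; congr Num.sqrt; ring.
  rewrite max_r ?addr0 ?sqrtr1 // subr_le0 leNgt; apply/negP => x1.
  have x0 : 0 <= x by lra.
  by have := sqr_sqrtr x0; have := sqrtr_ge0 x; nra.
have one := rat_prec_nat R (prec_const 1).
have Hm : rapp (fun e => Num.max 1 (normc (a e +i* c e))).
  apply: rapp_ext (rat_prec_sqrt (rat_prec_add one (rat_prec_pos (rat_prec_add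
    (rat_prec_add (rat_prec_mul Ha Ha) (rat_prec_mul Hc Hc)) (rat_prec_opp one))))) _.
  by move=> e /=; rewrite rmax.
have m1 e : 2 ^- 0 <= Num.max 1 (normc (a e +i* c e)).
  by rewrite expr0 invr1 le_max lexx.
have Hi := rapp_inv m1 Hm.
have bi e : `|(Num.max 1 (normc (a e +i* c e)))^-1| <= 1.
  have := m1 e; rewrite expr0 invr1 => h.
  by rewrite ger0_norm ?invr_ge0 ?invf_le1 //; lra.
have Hz : capp (fun e => a e +i* c e) by split; apply: rapp_rat.
have [B HB aB] := rat_prec_bound Ha; have [B' HB' cB] := rat_prec_bound Hc.
have HBB : prec (fun e => B e + B' e + 1)%N by apply: prec_add (prec_add HB HB') (prec_const 1).
apply: (capp_mul HBB _ _ Hz (capp_real Hi)) => e.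
  have -> : a e +i* c e = (a e)%:C + 'i%C * (c e)%:C.
    by apply: complex_ext => /=; ring.
  rewrite (le_trans (normcD _ _)) // normcM !normcR normc_i mul1r !natrD.
  by have := aB e; have := cB e; lra.
rewrite normcR (le_trans (bi e)) // natrD lerDr ler0n //.
Qed.

(** ** Reading the input *)

(** The environment lists the absolute values of the eight integers of the input and
    then their signs; [endpoint k] is the [k]-th rational number of the rectangle. *)
Definition endpoint k (e : seq nat) : R :=
  ((nth 0%N e k.*2 * (1 - nth 0%N e (k.*2 + 8)))%:R - (nth 0%N e k.*2 * nth 0%N e (k.*2 + 8))%:R) /
  (nth 0%N e k.*2.+1).-1.+1%:R.

Lemma rat_prec_endpoint k : rat_prec (endpoint k).
Proof.
have v i : prec (fun e => nth 0%N e i) := prec_var i.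
exists (fun e => nth 0%N e k.*2 * (1 - nth 0%N e (k.*2 + 8)))%N,
  (fun e => nth 0%N e k.*2 * nth 0%N e (k.*2 + 8))%N, (fun e => (nth 0%N e k.*2.+1).-1).
split=> //; [exact: prec_mul (v _) (prec_sub (prec_const 1) (v _)) | exact: prec_mul |].
exact: prec_pred.
Qed.

Lemma signed_fraction (q : rat) :
  ((absz (numq q) * (1 - (numq q < 0)%R))%:R - (absz (numq q) * (numq q < 0)%R)%:R) /
  (absz (denq q)).-1.+1%:R = ratr q :> R.
Proof.
rewrite /ratr prednK ?absz_gt0 ?denq_neq0 //; congr (_ / _); last first.
  by rewrite -{2}(gtz0_abs (denq_gt0 q)).
case: (numq q) => n /=; first by rewrite subn0 muln1 muln0 subr0.
by rewrite muln0 muln1 sub0r NegzE mulrNz.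
Qed.

Lemma endpointE (Q : rat_rect) k : (k < 4)%N -> endpoint k (int_env (rect_ints Q)) =
  ratr (nth 0 [:: rect_a Q; rect_b Q; rect_c Q; rect_d Q] k).
Proof. by case: k => [|[|[|[|k]]]] // _; rewrite -signed_fraction. Qed.

(** The length of the interval times the product of the denominators is a positive
    integer.  So the denominators bound the search for [depth]. *)
Lemma narrow_denominators (p q : rat) N : p < q -> 2 ^+ N * (q - p) <= 1 ->
  (N <= absz (denq p) * absz (denq q))%N.
Proof.
move=> pq H; apply: leq_trans (ltnW (ltn_expl N (isT : 1 < 2)%N)) _.
rewrite -(ler_nat rat) natrX natrM.
have dE (x : rat) : (absz (denq x))%:R = (denq x)%:~R :> rat.
  by rewrite -{2}(gtz0_abs (denq_gt0 x)).
rewrite !dE.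
have dp : 0 < (denq p)%:~R :> rat by rewrite ltr0z denq_gt0.
have dq : 0 < (denq q)%:~R :> rat by rewrite ltr0z denq_gt0.
have : 1 <= (q - p) * ((denq p)%:~R * (denq q)%:~R).
  have -> : (q - p) * ((denq p)%:~R * (denq q)%:~R) =
      (numq q * denq p - numq p * denq q)%:~R.
    rewrite rmorphB /= !rmorphM /= -{1}[q]divq_num_den -{1}[p]divq_num_den.
    by field; rewrite !gt_eqF.
  rewrite -[1]/(1%:~R) ler_int -gtz0_ge1 -(ltr0z rat) rmorphB /= !rmorphM /= !numqE.
  have := mulr_gt0 (mulr_gt0 (_ : 0 < q - p) dp) dq; rewrite subr_gt0 => /(_ pq).
  by set P := (denq p)%:~R; set D := (denq q)%:~R; lra.
have P0 : 0 <= 2 ^+ N :> rat by rewrite exprn_ge0.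
move=> /(ler_wpM2l P0); rewrite mulr1 mulrA => h; apply: le_trans h _.
by rewrite ler_piMl // mulr_ge0 ?(ltW dp) ?(ltW dq).
Qed.

Definition narrow (e : seq nat) (N : nat) : bool :=
  (0 <= 1 - 2 ^+ N * (endpoint 1 e - endpoint 0 e)) &&
  (0 <= 1 - 2 ^+ N * (endpoint 3 e - endpoint 2 e)).

(** The largest [N] such that both sides of the rectangle have length at most
    [2 ^ -N], or [0] if there is none. *)
Definition depth (e : seq nat) : nat :=
  (\sum_(i < nth 0 e 1 * nth 0 e 3) narrow e i.+1)%N.

Lemma prec_depth : prec depth.
Proof.
have side k l : rat_prec (fun e => 1 - 2 ^+ (nth 0%N e 0).+1 *
    (endpoint k (drop 1 e) - endpoint l (drop 1 e))).
  have H j : rat_prec (fun e => endpoint j (drop 1 e)).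
    apply: rat_prec_subst (rat_prec_endpoint j) _ => i; exact: (prec_drop 1 (prec_var i)).
  apply: rat_prec_add (rat_prec_nat R (prec_const 1)) (rat_prec_opp (rat_prec_mul _
    (rat_prec_add (H k) (rat_prec_opp (H l))))).
  apply: rat_prec_ext (rat_prec_nat R (prec_pow (prec_const 2) (prec_succ (prec_var 0)))) _.
  by move=> e; rewrite natrX.
have := prec_sum (prec_mul (prec_var 1) (prec_var 3))
  (prec_and (prec_nneg (side 1 0)) (prec_nneg (side 3 2))).
move/prec_ext; apply => e; apply: eq_bigr => i _; by rewrite /narrow /= !drop0.
Qed.

Section Rect.
Variable Q : rat_rect.
Let e := int_env (rect_ints Q).

Lemma narrowE N : narrow e N =
  (2 ^+ N * (rect_b Q - rect_a Q) <= 1) && (2 ^+ N * (rect_d Q - rect_c Q) <= 1).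
Proof.
rewrite /narrow !endpointE //= !subr_ge0 -!rmorphB /=.
have E : 2 ^+ N = ratr (2 ^+ N) :> R by rewrite rmorphXn /= ratr_nat.
have E1 : 1 = ratr 1 :> R by rewrite rmorph1.
by rewrite E E1 -!rmorphM /= !ler_rat.
Qed.

Lemma depth_spec : ((0 < depth e)%N -> narrow e (depth e)) /\
  (forall N, narrow e N -> (N <= depth e)%N).
Proof.
have decr N : narrow e N.+1 -> narrow e N.
  rewrite !narrowE => /andP[h1 h2].
  have := rect_ltab Q; have := rect_ltcd Q; rewrite -subr_gt0 -[rect_a Q < _]subr_gt0 => g1 g2.
  have : 0 < 2 ^+ N :> rat by rewrite exprn_gt0.
  by move: h1 h2; rewrite exprS => h1 h2 P0; apply/andP; split; nra.
have [_ [H1 H2]] := count_decreasing (nth 0 e 1 * nth 0 e 3)%N decr.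
split=> // N HN; apply: H2 => //.
move: HN; rewrite narrowE => /andP[/(narrow_denominators (rect_ltab Q)) h _].
exact: h.
Qed.

Lemma rect_corner_dist (z : CR) : (0 < depth e)%N -> rect_set Q z ->
  normc (z - (endpoint 0 e +i* endpoint 2 e)) <= 2 * 2 ^- depth e.
Proof.
move=> /depth_spec.1 /andP[n1 n2] [/andP[a1 a2] /andP[c1 c2]].
rewrite (le_trans (normc_le_ReIm _)) // RecB ImcB /=.
move: n1 n2; rewrite !endpointE //=.
have := exp2_gt0 R (depth e); have : 2 ^+ depth e * 2 ^- depth e = 1 :> R.
  by rewrite divff // lt0r_neq0 // exprn_gt0.
move: (2 ^+ _) (2 ^- _) => P d Pd d0.
move: (ratr _) (ratr _) (ratr _) (ratr _) a1 a2 c1 c2 => a b c d' a1 a2 c1 c2.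
rewrite !subr_ge0 => /(ler_wpM2l (ltW d0)) n1 /(ler_wpM2l (ltW d0)) n2.
have E x : d * (P * x) = x by rewrite mulrA [d * P]mulrC Pd mul1r.
rewrite !E mulr1 in n1 n2.
rewrite !ger0_norm ?subr_ge0 ?(ltW a1) ?(ltW c1) //; lra.
Qed.

End Rect.

(** ** Writing the output *)

(** A rectangle of size [2 ^ -N] contains points whose images differ by at most
    [2 ^ ((10 - N) / 2)], where [10] comes from [2 ^ 8] in the modulus and from a factor
    [4] in the distance to the projected corner. *)
Definition level e := ((depth e - 10) %/ 2)%N.

Lemma prec_level : prec level.
Proof. exact: prec_div (prec_sub prec_depth (prec_const 10)) (prec_const 2). Qed.

Lemma dyadic_approximation (x : seq nat -> R) : rapp x -> (forall e, 18 <= x e) ->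
  exists2 u, prec u & forall e, (16 <= u e)%N /\
    `|x e - (u e)%:R / 2 ^+ level e| <= 2 * 2 ^- level e.
Proof.
move=> [a Ha Hx] x18.
have Hp : rat_prec (fun e => 2 ^+ level e : R).
  by apply: rat_prec_ext (rat_prec_nat R (prec_pow (prec_const 2) prec_level)) _ => e; rewrite natrX.
have Hal : rat_prec (fun e => a (level e :: e)).
  apply: (rat_prec_subst (r := fun e => level e :: e)) => // -[|i] /=; [exact: prec_level|exact: prec_var].
have [u Hu uP] := rat_prec_floor (rat_prec_mul Hal Hp); exists u => // e.
have := Hx e (level e); have := uP e; have := x18 e.
have := exp2_le1 R (level e).
have P1 : 1 <= 2 ^+ level e :> R by rewrite exprn_ege1 // ler1n.
move: P1; move: (a _) (x e) (2 ^+ _) => A X P P1 d1 X18 fl near.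
have P0 : 0 < P by lra.
have A17 : 17 <= A by move: near; rewrite ler_norml => /andP[]; lra.
have [|f1 f2] := andP (fl _); first by nra.
rewrite -natr1 in f2; split.
  by rewrite -(ler_nat R); nra.
have E : (u e)%:R / P = A - (A * P - (u e)%:R) / P by field; rewrite gt_eqF.
have h : 0 <= (A * P - (u e)%:R) / P <= P^-1.
  by rewrite divr_ge0 ?subr_ge0 ?(ltW P0) //= ler_pdivrMr // mulVf ?gt_eqF //; lra.
rewrite E; move: near h; rewrite !ler_norml => /andP[n1 n2] /andP[h1 h2].
by apply/andP; split; lra.
Qed.

Definition dyadic (m k : nat) : rat := m%:R / (2 ^ k)%N%:R.

Lemma dyadic_lt m n k : (m < n)%N -> dyadic m k < dyadic n k.
Proof. by move=> H; rewrite ltr_pM2r ?invr_gt0 ?ltr0n ?expn_gt0 // ltr_nat. Qed.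

Lemma odd_endpoints u : (16 <= u)%N -> odd (2 * u - 15) /\ odd (2 * u + 15).
Proof. by move=> H; split; rewrite ?oddB ?oddD ?oddM //; lia. Qed.

(** A square of radius [15 / 2 * 2 ^ -k] around [(u + i v) / 2 ^ k].  Its endpoints
    have the odd numerators [2 u - 15] and [2 u + 15] over [2 ^ (k + 1)], so that they
    are written in lowest terms without any computation of divisors. *)
Definition dyadic_square u v k : rat_rect :=
  RatRect (@dyadic_lt (2 * u - 15) (2 * u + 15) k.+1 ltac:(lia))
          (@dyadic_lt (2 * v - 15) (2 * v + 15) k.+1 ltac:(lia)).

Definition square_word u v k i := nth 0%N
  [:: 2 * u - 15; 2 ^ k.+1; 2 * u + 15; 2 ^ k.+1;
      2 * v - 15; 2 ^ k.+1; 2 * v + 15; 2 ^ k.+1]%N i.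

Lemma dyadic_square_words u v k : (16 <= u)%N -> (16 <= v)%N ->
  rect_words (dyadic_square u v k) = [seq nat_word (square_word u v k i) | i <- iota 0 8].
Proof.
move=> /odd_endpoints[u1 u2] /odd_endpoints[v1 v2].
have [n1 d1] := dyadic_num_den k.+1 u1; have [n2 d2] := dyadic_num_den k.+1 u2.
have [n3 d3] := dyadic_num_den k.+1 v1; have [n4 d4] := dyadic_num_den k.+1 v2.
by rewrite /rect_words /= /dyadic n1 d1 n2 d2 n3 d3 n4 d4.
Qed.

Lemma dyadic_squareE u v k (z : CR) : (16 <= u)%N -> (16 <= v)%N ->
  rect_set (dyadic_square u v k) z <->
  `|Re z - u%:R / 2 ^+ k| < 15 / 2 * 2 ^- k /\ `|Im z - v%:R / 2 ^+ k| < 15 / 2 * 2 ^- k.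
Proof.
have E m : (16 <= m)%N -> ratr (dyadic (2 * m - 15) k.+1) = m%:R / 2 ^+ k - 15 / 2 * 2 ^- k :> R /\
   ratr (dyadic (2 * m + 15) k.+1) = m%:R / 2 ^+ k + 15 / 2 * 2 ^- k :> R.
  move=> Hm; rewrite /dyadic !fmorph_div /= !ratr_nat natrX exprS natrB; last by lia.
  have : 2 ^+ k != 0 :> R by rewrite lt0r_neq0 ?exprn_gt0.
  by rewrite natrD natrM; move: (2 ^+ k) => P P0; split; field.
move=> Hu Hv; rewrite /rect_set /=; have [-> ->] := E u Hu; have [-> ->] := E v Hv.
by rewrite !ltr_distl.
Qed.

End Rectangles.

Section Computable.
Variable R : realType.
Local Open Scope ring_scope.
Local Open Scope classical_set_scope.
Local Notation CR := (Defs.C R).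
Variable f : CR -> CR.
Hypothesis f_capp : forall z : seq nat -> R[i],
  capp z -> (forall e, normc (z e) <= 1) -> capp (fun e => f (z e)).
Hypothesis f_dist : forall z w : R[i], normc z <= 1 -> normc w <= 1 ->
  normc (f z - f w) ^+ 2 <= 2 ^+ 8 * normc (z - w).
Hypothesis f_bounded : forall z : R[i], normc z <= 1 -> normc (f z - kap R) <= 2.

Let corner e : R[i] := disk_proj (endpoint R 0 e +i* endpoint R 2 e).

(** At level [0] nothing is known about the rectangle, but [4] bounds the diameter of
    the image. *)
Lemma image_dist Q (z : CR) : rect_set Q z -> normc z <= 1 ->
  normc (f z - f (corner (int_env (rect_ints Q)))) <= 4 * 2 ^- level R (int_env (rect_ints Q)).
Proof.
move=> Qz z1; set e := int_env _; have w1 : normc (corner e) <= 1 := disk_proj_norm _.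
case: (leqP 10 (depth R e)) => D; last first.
  have -> : level R e = 0%N.
    by rewrite /level (eqP (ltnW D : depth R e - 10 == 0)%N).
  rewrite expr0 invr1 mulr1.
  have -> : f z - f (corner e) = (f z - kap R) - (f (corner e) - kap R) by ring.
  rewrite (le_trans (normcD _ _)) // normc_opp.
  by have := f_bounded z1; have := f_bounded w1; lra.
have hd : normc (z - corner e) <= 4 * 2 ^- depth R e.
  rewrite (le_trans (disk_proj_dist _ z1)) //.
  have := @rect_corner_dist R Q z (leq_trans (isT : 0 < 10)%N D) Qz; rewrite -/e; lra.
apply: (@le_trans _ _ (2 ^- level R e)); last by have := exp2_gt0 R (level R e); lra.
rewrite -(@ler_sqr R) ?nnegrE ?normc_ge0 ?(ltW (exp2_gt0 _ _)) //.
apply: le_trans (f_dist z1 w1) _.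
have -> : (2 ^- level R e) ^+ 2 = 2 ^- (level R e + level R e) :> R by rewrite exp2D expr2.
apply: le_trans (_ : 2 ^- (depth R e - 10) <= _); last first.
  by apply: exp2_le; rewrite /level; lia.
rewrite -{1}(subnKC D) exp2D in hd.
have E : 2 ^+ 8 * (4 * 2 ^- 10) = 1 :> R.
  have -> : 4 = 2 ^+ 2 :> R by rewrite expr2; ring.
  by rewrite mulrA -exprD divff // lt0r_neq0 // exprn_gt0.
have := ler_wpM2l (exprn_ge0 8 (ler0n R 2)) hd; rewrite !mulrA in E *; rewrite E mul1r.
exact.
Qed.

Lemma Re_image (w : R[i]) : normc w <= 1 -> 18 <= Re (f w) /\ 18 <= Im (f w).
Proof.
move=> /f_bounded h.
have := le_trans (abs_Re_le _) h; have := le_trans (abs_Im_le _) h.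
rewrite RecB ImcB /= !ler_norml => /andP[h1 h2] /andP[h3 h4]; split; lra.
Qed.

(** The errors add up to [4 + 2] units of [2 ^ -level], below the radius [15 / 2] of the
    output square.  For the convergence it suffices to take rational rectangles that
    are narrow enough to make the level large. *)
Theorem computable_on_disk : computable_complex_fun (closure (unit_disk R)) f.
Proof.
have w1 e : normc (corner e) <= 1 := disk_proj_norm _.
have Hc : capp corner by apply: capp_disk_proj; apply: rat_prec_endpoint.
have [HR HI] := f_capp Hc w1.
have [u Hu uP] := dyadic_approximation HR (fun e => (Re_image (w1 e)).1).
have [v Hv vP] := dyadic_approximation HI (fun e => (Re_image (w1 e)).2).
pose F i e := square_word (u e) (v e) (level R e) i.
have HF i : (i < 8)%N -> prec (F i).
  have low x : prec x -> prec (fun e => 2 * x e - 15)%N.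
    by move=> Hx; exact: prec_sub (prec_mul (prec_const 2) Hx) (prec_const 15).
  have high x : prec x -> prec (fun e => 2 * x e + 15)%N.
    by move=> Hx; exact: prec_add (prec_mul (prec_const 2) Hx) (prec_const 15).
  have pow : prec (fun e => 2 ^ (level R e).+1)%N.
    exact: prec_pow (prec_const 2) (prec_succ (prec_level R)).
  by case: i => [|[|[|[|[|[|[|[|i]]]]]]]] // _; rewrite /F /square_word /=; auto.
have [M HM] := prec_turing HF.
pose out Q := let e := int_env (rect_ints Q) in dyadic_square (u e) (v e) (level R e).
have Hout Q : tm_computes M (rect_words Q) (rect_words (out Q)).
  rewrite /out dyadic_square_words; [exact: (HM (rect_ints Q)) | exact: (uP _).1 | exact: (vP _).1].
have sound Q (z : CR) : rect_set Q z -> closure (unit_disk R) z -> rect_set (out Q) (f z).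
  move=> Qz /closure_unit_disk z1; have := image_dist Qz z1; rewrite /out.
  set e := int_env _ => h; have [u16 ud] := uP e; have [v16 vd] := vP e.
  apply/(dyadic_squareE _ _ u16 v16).
  have := le_trans (abs_Re_le _) h; have := le_trans (abs_Im_le _) h.
  rewrite RecB ImcB => h1 h2; have := exp2_gt0 R (level R e).
  have := ler_distD (Re (f (corner e))) (Re (f z)) ((u e)%:R / 2 ^+ level R e).
  have := ler_distD (Im (f (corner e))) (Im (f z)) ((v e)%:R / 2 ^+ level R e).
  by split; lra.
exists M; split.
- by move=> Q _; exists (out Q).
- move=> Q Q' HQ' z Qz Dz.
  have size_words : size (rect_words Q') = size (rect_words (out Q)) by [].
  have /rect_words_inj[Ea Eb Ec Ed] := tm_computes_unique size_words HQ' (Hout Q).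
  by rewrite /rect_set /= Ea Eb Ec Ed; exact: sound.
move=> z U V Dz /nbhs_normc[dU dU0 HU] /nbhs_normc[dV dV0 HV].
have [K HK] : exists K, 30 * 2 ^- K < dV.
  exists (Num.truncn (30 / dV)).+1; have := truncnS_gt (30 / dV).
  rewrite ltr_pdivrMr // ltr_pdivrMr ?exprn_gt0 // => h.
  by apply: (lt_le_trans h); rewrite mulrC ler_pM2l // ltn_exp2.
pose h : R := Num.min (dU / 4) (2 ^- (K + K + 10) / 2).
have h0 : 0 < h by rewrite lt_min !divr_gt0 ?exp2_gt0.
have hU : h <= dU / 4 by rewrite ge_min lexx.
have hK : h <= 2 ^- (K + K + 10) / 2 by rewrite ge_min lexx orbT.
have rat_between (x y : R) : x < y -> exists q : rat, x < ratr q < y.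
  by move=> /rat_in_itvoo[q]; rewrite in_itv /=; exists q.
have [a a0] : exists q : rat, (Re z - h) < ratr q < (Re z) by apply: rat_between; lra.
have [b b0] : exists q : rat, (Re z) < ratr q < (Re z + h) by apply: rat_between; lra.
have [c c0] : exists q : rat, (Im z - h) < ratr q < (Im z) by apply: rat_between; lra.
have [d d0] : exists q : rat, (Im z) < ratr q < (Im z + h) by apply: rat_between; lra.
have ab : a < b by rewrite -(ltr_rat R); lra.
have cd : c < d by rewrite -(ltr_rat R); lra.
pose Q := RatRect ab cd; exists Q, (out Q).
have Qz : rect_set Q z by split; rewrite /=; lra.
split=> //.
  move=> w [/= w1' w2']; apply: HU; rewrite (le_lt_trans (normc_le_ReIm _)) // RecB ImcB.
  have : `|Re w - Re z| <= h by rewrite ler_distl; lra.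
  have : `|Im w - Im z| <= h by rewrite ler_distl; lra.
  by lra.
(* Both sides of [Q] are shorter than [2 ^- (2 K + 10)]. *)
have lev : (K <= level R (int_env (rect_ints Q)))%N.
  suff : (K + K + 10 <= depth R (int_env (rect_ints Q)))%N 
    by rewrite /level; move: (depth _ _) => D; clear; lia.
  apply: (depth_spec R Q).2.
  rewrite narrowE -[rect_b Q]/b -[rect_a Q]/a -[rect_d Q]/d -[rect_c Q]/c.
  have side (p q : rat) (t : R) : t - h < ratr p -> ratr q < t + h ->
      2 ^+ (K + K + 10) * (q - p) <= 1.
    move=> tp tq; have E n : ratr (2 ^+ n) = 2 ^+ n :> R by rewrite rmorphXn /= ratr_nat.
    rewrite -(ler_rat R) rmorphM rmorphB rmorph1 /= E.
    apply: (@le_trans _ _ (2 ^+ (K + K + 10) * 2 ^- (K + K + 10))).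
      by rewrite ler_pM2l ?exprn_gt0 //; lra.
    by rewrite divff // lt0r_neq0 // exprn_gt0.
  by apply/andP; split; [apply: (side _ _ (Re z)) | apply: (side _ _ (Im z))]; lra.
move=> w Qw; apply: HV; rewrite (le_lt_trans (normc_le_ReIm _)) // RecB ImcB.
have := sound Q z Qz Dz; move: Qw; rewrite /out.
set e := int_env _ in lev *; have [u16 _] := uP e; have [v16 _] := vP e.
move=> /(dyadic_squareE _ _ u16 v16)[x1 x2] /(dyadic_squareE _ _ u16 v16)[y1 y2].
have := exp2_le R lev.
rewrite distrC in y1; rewrite distrC in y2.
have := ler_distD ((u e)%:R / 2 ^+ level R e) (Re w) (Re (f z)).
have := ler_distD ((v e)%:R / 2 ^+ level R e) (Im w) (Im (f z)).
by lra.
Qed.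

End Computable.

Local Open Scope classical_set_scope.

Theorem theorem1p1 (R : realType) :
  exists phi : C R -> C R,
    conformal_on_disk phi /\
    (exists f : C R -> C R,
        boundary_extension phi f /\
        computable_complex_fun (closure (unit_disk R)) f) /\
    (forall g : nat -> nat,
        boundary_connectivity_function (phi @` unit_disk R) g ->
        ~ computable_nat_fun g).
Proof.
exists (slit_map halting_index fstn); split; first exact: slit_map_conformal.
split=> [|g Hg].
  exists (slit_map halting_index fstn); split; first exact: slit_map_extension.
  apply: computable_on_disk; [|exact: slit_map_dist|exact: slit_map_bounded].
  move=> z Hz z1; exact: (capp_slit_map prec_halting_index (prec_fstn (prec_var 0)) Hz z1).
by apply: halting_growth => j tj; exact: (slit_map_connectivity halting_index_inj tj Hg).
Qed.
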